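(* Consider the $k$-CCA problem for $k \geq 2$ with signal-to-noise ratio $\lambda$ satisfying $\lambda^2 \asymp d^{-\gamma}$ (as $d \to \infty$) for any constant $\gamma > 3k/2$. Let $\hat{\boldsymbol V} \in (\mathbb{R}^d)^{\otimes k}$ denote any estimator for this $k$-CCA problem that can be computed using a memory bounded estimation algorithm with resource profile $(N,T,s)$ scaling with $d$ as $$N\lambda^2 \asymp d^{\eta}, \quad T \asymp d^{\tau}, \quad s \asymp d^{\mu}$$ for any constants $\eta \geq 1$, $\tau \geq 0$, $\mu \geq 0$. If $$\eta + \tau + \mu < k,$$ then, for any $t \in \mathbb{R}$, $$\limsup_{d \to \infty}\ \inf_{\boldsymbol V \in \mathcal{V}} \mathbb{P}_{\boldsymbol V}\left( \frac{|\langle \boldsymbol V, \hat{\boldsymbol V}\rangle|^2}{\|\boldsymbol V\|^2 \|\hat{\boldsymbol V}\|^2} \geq \frac{t^2}{d^k} \right) \leq \frac{1}{t^2}.$$ This holds even when $\boldsymbol V$ is promised to be of the form $\boldsymbol V = \sqrt{d^k}\, \boldsymbol e_{i_1} \otimes \boldsymbol e_{i_2} \otimes \dots \otimes \boldsymbol e_{i_k}$ for some $i_1,\dots,i_k \in [d]$ (i.e., when the infimum is restricted to such $\boldsymbol V$), where $\boldsymbol e_1,\dots,\boldsymbol e_d$ is the standard basis of $\mathbb{R}^d$, and the law $\mu_{\boldsymbol V}$ of a sample is promised to be the one with likelihood ratio, with respect to $\mu_0 = \mathcal{N}(\boldsymbol 0, \boldsymbol I_{kd})$, $$\frac{d\mu_{\boldsymbol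 V}}{d\mu_0}(\boldsymbol x) = 1 + \frac{\lambda}{\lambda_k} \cdot \mathrm{sign}\left(\frac{\langle \boldsymbol x^{(1)} \otimes \dots \otimes \boldsymbol x^{(k)}, \boldsymbol V\rangle}{\sqrt{d^k}}\right), \qquad \lambda_k = \left(\frac{2}{\pi}\right)^{k/2}.$$
   Context: **Order-$k$ Canonical Correlation Analysis ($k$-CCA).** The parameter space $\mathcal{V}$ consists of the tensors $\boldsymbol V = \sqrt{d^k}\, \boldsymbol v_1 \otimes \dots \otimes \boldsymbol v_k$ with $\boldsymbol v_1,\dots,\boldsymbol v_k \in \mathbb{R}^d$ unit vectors. One observes $N$ i.i.d. samples $\boldsymbol x_1,\dots,\boldsymbol x_N \in \mathbb{R}^{kd}$ with law $\mu_{\boldsymbol V}$, where each sample consists of $k$ views $\boldsymbol x = (\boldsymbol x^{(1)},\dots,\boldsymbol x^{(k)})$, $\boldsymbol x^{(j)} \in \mathbb{R}^d$, and $$\mathbb{E}\left[\boldsymbol x^{(1)} \otimes \boldsymbol x^{(2)} \otimes \dots \otimes \boldsymbol x^{(k)}\right] = \frac{\lambda}{\sqrt{d^k}} \boldsymbol V,$$ with $\lambda > 0$ the signal-to-noise ratio. The law $\mu_{\boldsymbol V}$ is not otherwise specified in the general problem; the displayed measure $\mu_{\boldsymbol V}$ in the claim is a valid probability measure with this property when $0 \leq \lambda \leq \lambda_k$. $\mathbb{P}_{\boldsymbol V}$ denotes probability when the data are i.i.d. from $\mu_{\boldsymbol V}$. Inner products and norms of tensors are Euclidean. $\mathrm{sign}(x)=1$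 if $x>0$, $-1$ if $x<0$, and $\mathrm{sign}(0)=0$. **Memory bounded estimation algorithm with resource profile $(N,T,s)$.** Such an algorithm makes $T$ passes over a dataset of $N$ samples $\boldsymbol x_1, \dots, \boldsymbol x_N \in \mathcal{X}$ using a memory state of $s$ bits, initially all zeros. It is specified by arbitrary update functions $f_{t,i} : \{0,1\}^s \times \mathcal{X} \to \{0,1\}^s$ ($t \in [T]$, $i \in [N]$) and an arbitrary estimator function $g$ on $\{0,1\}^s$. For $t = 1,\dots,T$ in order, and within each pass for $i = 1,\dots,N$ in order, the state is updated by $\mathtt{state} \leftarrow f_{t,i}(\mathtt{state}, \boldsymbol x_i)$. After all $T$ passes the output is $\hat{\boldsymbol V} = g(\mathtt{state})$. **Asymptotic notation.** For non-negative sequences indexed by $d$, $a_d \lesssim b_d$ means $\limsup_{d\to\infty} a_d/b_d < \infty$; $a_d \asymp b_d$ means $a_d \lesssim b_d$ and $b_d \lesssim a_d$. $k$ is fixed as $d \to \infty$. *)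

(* Defs.v *)
From HB Require Import structures.
From mathcomp Require Import all_boot all_order all_algebra.
From mathcomp Require Import all_classical all_reals all_analysis.

Set Implicit Arguments.
Unset Strict Implicit.
Unset Printing Implicit Defensive.
Import Order.TTheory GRing.Theory Num.Theory.
Import numFieldNormedType.Exports.

Local Open Scope classical_set_scope.
Local Open Scope ring_scope.

(* The quotient is taken in \bar R, where x / 0 = +oo for x > 0 (and
   0 / 0 = 0). *)
Definition asymp_le (R : realType) (a b : nat -> R) : Prop :=
  (limn_esup (fun d => (a d)%:E / (b d)%:E) < +oo)%E.

Definition asymp_eq (R : realType) (a b : nat -> R) : Prop :=
  asymp_le a b /\ asymp_le b a.

(* The law of n i.i.d. draws from P, i.e. the n-fold product measure on
   n.-tuple T, built by pushing P \x iid P n forward along (x, s) |-> x :: s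
   and characterized on boxes by iid_box below. *)
Section iid.
Context {d} {T : measurableType d} {R : realType}.

Section prod_probability.
Context {d'} {T' : measurableType d'}.
Variables (P : probability T R) (Q : probability T' R).

Definition prod_prob : set (T * T') -> \bar R := (P \x Q)%E.

HB.instance Definition _ := Measure.on prod_prob.

Let prod_prob_setT : prod_prob setT = 1%E.
Proof.
rewrite -setXTT; transitivity (P setT * Q setT)%E.
  exact: (product_measure1E P Q).
by rewrite !probability_setT mule1.
Qed.

HB.instance Definition _ :=
  Measure_isProbability.Build _ _ _ prod_prob prod_prob_setT.

End prod_probability.

Definition consp (n : nat) (p : T * n.-tuple T) : n.+1.-tuple T :=
  [tuple of p.1 :: p.2].

Lemma measurable_consp (n : nat) : measurable_fun setT (@consp n).
Proof.
exact: (@measurable_cons _ _ _ _ fst n snd measurable_fst measurable_snd).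
Qed.

HB.instance Definition _ (n : nat) :=
  isMeasurableFun.Build _ _ _ _ (@consp n) (@measurable_consp n).

Fixpoint iid (P : probability T R) (n : nat) : probability (n.-tuple T) R :=
  if n is m.+1 then distribution (prod_prob P (iid P m)) (@consp m)
  else \d_([tuple] : 0.-tuple T).

Lemma iid_box (P : probability T R) (n : nat) (B : 'I_n -> set T) :
  (forall i, measurable (B i)) ->
  iid P n [set x | forall i, B i (tnth x i)] = (\prod_(i < n) P (B i))%E.
Proof.
elim: n B => [|n IHn] B mB.
  by rewrite big_ord0 /= diracE mem_set//= => -[].
rewrite big_ord_recl /= -IHn; last by move=> i; exact: mB.
have mC : measurable [set x : n.-tuple T | forall i, B (lift ord0 i) (tnth x i)].
  rewrite (_ : mkset _ = \bigcap_(i in [set: 'I_n])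
      ((fun x : n.-tuple T => tnth x i) @^-1` B (lift ord0 i))); last first.
    by apply/seteqP; split => x /= Bx i; [move=> _|]; exact: Bx.
  apply: fin_bigcap_measurable => // i _.
  by rewrite -[_ @^-1` _]setTI; exact: (measurable_tnth i).
rewrite -product_measure1E//; congr (product_measure1 _ _ _).
apply/seteqP; split => -[x s] /=.
  move=> Bxs; split; first exact: (Bxs ord0).
  by move=> i; have := Bxs (lift ord0 i); rewrite tnthS.
move=> -[Bx Bs] i; case: (unliftP ord0 i) => [j ->|-> //].
by rewrite tnthS.
Qed.

End iid.

Section tensor.
Variables (R : realType) (k d : nat).

(* (R^d)^{\otimes k}, coordinatewise: a multi-index sends each of the k
   modes to a coordinate in 'I_d. *)
Definition tensor := {ffun {ffun 'I_k -> 'I_d} -> R}.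

Definition outer (v : 'I_k -> 'I_d -> R) : tensor :=
  [ffun j : {ffun 'I_k -> 'I_d} => \prod_(a < k) v a (j a)].

Definition inner (U V : tensor) : R := \sum_j U j * V j.

Definition tnorm (U : tensor) : R := Num.sqrt (inner U U).

Definition sqrt_dk : R := Num.sqrt (d%:R ^+ k).

Definition scaled_outer (v : 'I_k -> 'I_d -> R) : tensor :=
  [ffun j => sqrt_dk * outer v j].

Definition kcca_param (V : tensor) : Prop :=
  exists v : 'I_k -> 'I_d -> R,
    (forall a, \sum_(j < d) v a j ^+ 2 = 1) /\ V = scaled_outer v.

Definition basis_param (V : tensor) : Prop :=
  exists i : 'I_k -> 'I_d, V = scaled_outer (fun a j => (j == i a)%:R).

(* A point of R^{kd}, given as its k views. *)
Definition sample := k.-tuple (d.-tuple (measurableTypeR R)).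

Definition views (x : sample) : tensor := outer (fun a => tnth (tnth x a)).

Definition kcca_law (lambda : R) (V : tensor) (mu : probability sample R)
    : Prop :=
  forall j : {ffun 'I_k -> 'I_d},
    mu.-integrable setT (fun x => (views x j)%:E) /\
    ('E_mu [fun x => views x j] = (lambda / sqrt_dk * V j)%:E)%E.

(* N(0, I_{kd}) *)
Definition std_gaussian : probability sample R :=
  iid (iid (normal_prob (0 : R) 1) d) k.

Definition lambda_k : R := (2 / pi) `^ (k%:R / 2).

Definition likelihood_ratio (lambda : R) (V : tensor) (x : sample) : R :=
  1 + lambda / lambda_k * Num.sg (inner (views x) V / sqrt_dk).

(* Stated as a property of mu, since the likelihood ratio only defines a
   probability measure when lambda <= lambda_k. *)
Definition sign_law (lambda : R) (V : tensor) (mu : probability sample R)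
    : Prop :=
  forall B : set sample, measurable B ->
    mu B = (\int[std_gaussian]_(x in B) (likelihood_ratio lambda V x)%:E)%E.

End tensor.

(* The measurability of the updates in the sample makes the law of the output
   well defined; nothing else is required of the updates or the estimator. *)
Record mem_alg (d : measure_display) (X : measurableType d) (Y : Type)
    (N T s : nat) := MemAlg {
  update : 'I_T -> 'I_N -> s.-tuple bool -> X -> s.-tuple bool;
  measurable_update : forall t i st, measurable_fun setT (update t i st);
  estimator : s.-tuple bool -> Y }.

Section run.
Context {disp : measure_display} {X : measurableType disp} {Y : Type}.
Context {N T s : nat}.
Variables (A : mem_alg X Y N T s) (x : N.-tuple X).

(* enum 'I_n lists 0, ..., n-1 in increasing order. *)
Definition one_pass (st : s.-tuple bool) (t : 'I_T) : s.-tuple bool :=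
  foldl (fun st i => update A t i st (tnth x i)) st (enum 'I_N).

Definition final_state : s.-tuple bool :=
  foldl one_pass [tuple of nseq s false] (enum 'I_T).

Definition output : Y := estimator A final_state.

End run.

Section risk.
Variables (R : realType) (k d : nat).

Definition overlap (V U : tensor R k d) : R :=
  `|inner V U| ^+ 2 / (tnorm V ^+ 2 * tnorm U ^+ 2).

Definition success_prob (N T s : nat)
    (A : mem_alg (sample R k d) (tensor R k d) N T s) (t : R)
    (V : tensor R k d) (mu : probability (sample R k d) R) : \bar R :=
  iid mu N [set x | t ^+ 2 / d%:R ^+ k <= overlap V (output A x)].

(* Infimum over the problem instances (V, mu), mu a law allowed for V. *)
Definition worst_case_success (N T s : nat)
    (A : mem_alg (sample R k d) (tensor R k d) N T s) (t : R)
    (param : tensor R k d -> Prop)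
    (law : tensor R k d -> probability (sample R k d) R -> Prop) : \bar R :=
  ereal_inf [set p | exists V mu,
    [/\ param V, law V mu & p = success_prob A t V mu]].

End risk.

(* Main.v *)
Require Import Defs.
From HB Require Import structures.
From mathcomp Require Import all_boot all_order all_algebra.
From mathcomp Require Import all_classical all_reals all_analysis.
From mathcomp Require Import measurable_realfun measurable_fun_approximation.
From mathcomp Require Import simple_functions lebesgue_integral_fubini.
From mathcomp Require Import ring lra.

Set Implicit Arguments.
Unset Strict Implicit.
Unset Printing Implicit Defensive.
Import Order.TTheory GRing.Theory Num.Theory.
Local Open Scope ring_scope.

(** The error bound is proved for each fixed dimension, by averaging over the
    D = d^k basis tensors, with the sign law.

    A Gaussian sample is a uniform pattern of signs applied to independent
    moduli, and the likelihood ratio depends on the signs only.  So, given the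
    moduli of all samples, the problem is finite: the patterns are i.i.d.,
    uniform under the null and tilted by 1 + lam y_V under the tensor indexed
    by V, where lam = lambda / lambda_k and y_V is the product of the k signs
    that V selects ([success_prob_integral], from [iid_mixture] and
    [sign_law_mixture]).  Under the null the state does not depend on V, and
    Parseval with Markov bounds the average success by 1 / t^2
    ([null_success]).  It remains to show that the law of the final state is
    close to the null law, on average over V.

    The samples are cut into m blocks of n = 2^r samples, n being close to
    d^{3k/2}.  Negating the first view negates every y_V, so one conditions on
    each pattern up to this flip: block j is then a uniform point of the cube
    {-1, 1}^n, and the tilt is the likelihood ratio L_{j,V} of n biased bits,
    with known biases lam w_i(V), w_i(V) = 1 or -1.  The set of inputs with a
    given transcript is a product set over the blocks
    ([transcript_rectangle]), so the conditional expectations dev of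
    L_{j,V} - 1 given the transcript are orthogonal ([dev_orthogonal]), and
    the distance to the null is controlled by the sum of their squares
    ([transcript_distance]).

    With the other blocks fixed, block j only speaks T times with s bits.  A
    message that takes K values has cells of density q, and the entropy of
    the uniform law on a cell is ln (1 / q); the average of ln (1 / q) is at
    most ln K.  The level-one inequality bounds the squared biases of a
    density on the cube by its entropy, hence, summed over V, the linear part
    of L_V - 1 by lam^2 G times the entropy, where G is the largest eigenvalue
    of the Gram matrix of the vectors w_i.  The nonlinear part of L_V obeys
    the same bound: it is split along a dyadic tree, and at each node the
    product of the two halves is linear in the right half once the left half
    is fixed, with a coefficient L - 1 that is small for typical inputs, since
    lam^2 n is small for gamma > 3k/2 ([nonlinear_part], [lr_level1]).
    The fourth moment of the Gram matrix gives G of order n on average as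
    soon as n^2 >= D^3 ([avg_gram_bound]), which is the reason for this block
    length.  Altogether one block contributes lam^2 n (s T + 1) after the sum
    over V, and the m blocks, averaged over V, contribute about
    N lam^2 (s T + 1) / D, of order d^{eta + mu + tau - k}, which tends to 0
    ([finite_risk_bound], [hard_instance]). *)
(** * Averages over finite types *)

Section average.
Variable R : realType.
Implicit Types T U : finType.

Definition avg T (f : T -> R) : R := #|T|%:R^-1 * \sum_x f x.

Lemma eq_avg T (f g : T -> R) : f =1 g -> avg f = avg g.
Proof. by move=> fg; rewrite /avg (eq_bigr g). Qed.

Lemma avgD T (f g : T -> R) : avg (fun x => f x + g x) = avg f + avg g.
Proof. by rewrite /avg big_split mulrDr. Qed.

Lemma avgN T (f : T -> R) : avg (fun x => - f x) = - avg f.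
Proof. by rewrite /avg sumrN mulrN. Qed.

Lemma avgB T (f g : T -> R) : avg (fun x => f x - g x) = avg f - avg g.
Proof. by rewrite avgD avgN. Qed.

Lemma avgZl T c (f : T -> R) : avg (fun x => c * f x) = c * avg f.
Proof. by rewrite /avg -mulr_sumr mulrCA. Qed.

Lemma avgZr T c (f : T -> R) : avg (fun x => f x * c) = avg f * c.
Proof. by rewrite /avg -mulr_suml mulrA. Qed.

Lemma avg_sum T (J : finType) (P : pred J) (f : J -> T -> R) :
  avg (fun x => \sum_(j | P j) f j x) = \sum_(j | P j) avg (f j).
Proof. by rewrite /avg exchange_big /= mulr_sumr. Qed.

Lemma avg_cst T (c : R) : (0 < #|T|)%N -> avg (fun _ : T => c) = c.
Proof.
move=> T0; rewrite /avg sumr_const -[c *+ _]mulr_natl mulKf//.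
by rewrite pnatr_eq0 -lt0n.
Qed.

Lemma avg0 T : avg (fun _ : T => 0) = 0.
Proof. by rewrite /avg big1 // mulr0. Qed.

Lemma card_inv_ge0 T : 0 <= #|T|%:R^-1 :> R.
Proof. by rewrite invr_ge0. Qed.
Local Hint Resolve card_inv_ge0 : core.

Lemma avg_ge0 T (f : T -> R) : (forall x, 0 <= f x) -> 0 <= avg f.
Proof. by move=> f0; rewrite mulr_ge0 ?sumr_ge0. Qed.

Lemma le_avg T (f g : T -> R) : (forall x, f x <= g x) -> avg f <= avg g.
Proof. by move=> fg; rewrite ler_wpM2l// ler_sum. Qed.

Lemma avg_le_cst T (f : T -> R) c :
  (0 < #|T|)%N -> (forall x, f x <= c) -> avg f <= c.
Proof. by move=> T0 fc; rewrite -(avg_cst c T0) le_avg. Qed.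

Lemma avg_inj T (s : T -> T) (f : T -> R) :
  injective s -> avg (fun x => f (s x)) = avg f.
Proof. by move=> sI; rewrite /avg [in RHS](reindex_inj sI). Qed.

Lemma avg_exchange T U (f : T -> U -> R) :
  avg (fun x => avg (f x)) = avg (fun y => avg (f^~ y)).
Proof.
rewrite /avg -!mulr_sumr mulrCA; congr (_ * (_ * _)).
by rewrite exchange_big.
Qed.

Lemma avg_bij T U (s : T -> U) (f : U -> R) :
  bijective s -> avg (fun x => f (s x)) = avg f.
Proof.
move=> sb; rewrite /avg (bij_eq_card sb); congr (_ * _).
by rewrite [in RHS](reindex s) //; exact: onW_bij.
Qed.

(** The weighted sum of (s f - t g)^2 is a nonnegative quadratic form in
    (s, t); the claim is read off its value at the minimizer (B, C). *)
Lemma weighted_CauchySchwarz T (P : pred T) (w f g : T -> R) :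
  (forall x, 0 <= w x) ->
  (\sum_(x | P x) w x * (f x * g x)) ^+ 2 <=
  (\sum_(x | P x) w x * f x ^+ 2) * (\sum_(x | P x) w x * g x ^+ 2).
Proof.
move=> w0; set A := \sum_(x | P x) w x * f x ^+ 2.
set B := \sum_(x | P x) w x * g x ^+ 2; set C := \sum_(x | P x) _.
have A0 : 0 <= A by apply: sumr_ge0 => x _; rewrite mulr_ge0 ?sqr_ge0.
have B0 : 0 <= B by apply: sumr_ge0 => x _; rewrite mulr_ge0 ?sqr_ge0.
have q (s t : R) : 0 <= s ^+ 2 * A + t ^+ 2 * B - 2 * s * t * C.
  have -> : s ^+ 2 * A + t ^+ 2 * B - 2 * s * t * C =
            \sum_(x | P x) w x * (s * f x - t * g x) ^+ 2.
    rewrite !mulr_sumr -big_split -sumrB; apply: eq_bigr => x _ /=; ring.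
  by apply: sumr_ge0 => x _; rewrite mulr_ge0 ?sqr_ge0.
have [B0'|Bn0] := eqVneq B 0; last first.
  have Bp : 0 < B by rewrite lt_neqAle eq_sym Bn0.
  have := q B C; rewrite -(pmulr_rge0 _ Bp) => ?.
  suff : 0 <= B * (A * B - C ^+ 2) by rewrite pmulr_rge0// subr_ge0.
  by have := q B C; congr (0 <= _); ring.
rewrite B0' mulr0 /C big1 ?expr0n// => x Px.
have /eqP : w x * g x ^+ 2 = 0.
  apply: (psumr_eq0P _ B0') => // y _; by rewrite mulr_ge0 ?sqr_ge0.
by rewrite mulf_eq0 sqrf_eq0 => /orP[]/eqP->; rewrite ?(mul0r, mulr0).
Qed.

Lemma sum_CauchySchwarz T (P : pred T) (f g : T -> R) :
  (\sum_(x | P x) f x * g x) ^+ 2 <=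
  (\sum_(x | P x) f x ^+ 2) * (\sum_(x | P x) g x ^+ 2).
Proof.
have := @weighted_CauchySchwarz T P (fun=> 1) f g (fun=> ler01).
by under eq_bigr do rewrite mul1r; under [in leRHS]eq_bigr do rewrite mul1r;
   under [X in _ <= _ * X -> _]eq_bigr do rewrite mul1r.
Qed.

Lemma avg_CauchySchwarz T (f g : T -> R) :
  avg (fun x => f x * g x) ^+ 2 <=
  avg (fun x => f x ^+ 2) * avg (fun x => g x ^+ 2).
Proof.
rewrite exprMn [leRHS]mulrACA -expr2 ler_wpM2l ?sqr_ge0//.
exact: sum_CauchySchwarz.
Qed.

Lemma sqr_avg_le T (f : T -> R) : avg f ^+ 2 <= avg (fun x => f x ^+ 2).
Proof.
have [T0|T0] := posnP #|T|; first by rewrite /avg T0 invr0 !mul0r expr0n.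
have := avg_CauchySchwarz f (fun=> 1).
rewrite expr1n avg_cst// mulr1 => /(le_trans _); apply.
by rewrite (eq_avg (g := f)) // => x; rewrite mulr1.
Qed.

Lemma avg_le_sqrt T (f : T -> R) : avg f <= Num.sqrt (avg (fun x => f x ^+ 2)).
Proof.
rewrite (le_trans (ler_norm _))// -sqrtr_sqr ler_wsqrtr//; exact: sqr_avg_le.
Qed.

(** ** Averages over finite functions: independence of the coordinates *)

Lemma avg_ffun_prod (J T : finType) (f : J -> T -> R) :
  avg (fun x : {ffun J -> T} => \prod_j f j (x j)) = \prod_j avg (f j).
Proof.
rewrite /avg big_split prodr_const /= card_ffun natrX exprVn; congr (_ * _).
by rewrite (bigA_distr_bigA (fun j x => f j x)).
Qed.

Definition fupd (J T : finType) (x : {ffun J -> T}) (j : J) (y : T)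
  : {ffun J -> T} := [ffun i => if i == j then y else x i].

(** Exchanging a coordinate with its replacement is an involution of the pairs
    (x, y), so a uniform point stays uniform when a coordinate is redrawn. *)
Lemma avg_resample (J T : finType) (j : J) (f : {ffun J -> T} -> R) :
  avg f = avg (fun x => avg (fun y => f (fupd x j y))).
Proof.
have [T0|T0] := posnP #|T|.
  have e0 (x : {ffun J -> T}) : False by have := card0_eq T0 (x j); rewrite !inE.
  by rewrite /avg !big1 // => x; case: (e0 x).
rewrite /avg -mulr_sumr; congr (_ * _).
pose s (p : {ffun J -> T} * T) := (fupd p.1 j p.2, p.1 j).
have sK : involutive s.
  move=> [x y]; rewrite /s /= ffunE eqxx; congr pair.
  by apply/ffunP => i; rewrite !ffunE; case: eqP => // ->.
rewrite pair_big /= (reindex_inj (inv_inj sK)) /= -(pair_bigA _ (fun x y =>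
  f (fupd (fupd x j y) j (x j)))) /=.
rewrite mulr_sumr; apply: eq_bigr => x _.
rewrite (eq_bigr (fun=> f x)) => [|y _]; last first.
  by congr f; have [] := sK (x, y).
by rewrite sumr_const -[f x *+ _]mulr_natl mulKf// pnatr_eq0 -lt0n.
Qed.

Lemma avg_coord (J T : finType) (j : J) (f : T -> R) : (0 < #|T|)%N ->
  avg (fun x : {ffun J -> T} => f (x j)) = avg f.
Proof.
move=> T0; rewrite (avg_resample j).
under eq_avg do under eq_avg do rewrite ffunE eqxx.
by rewrite avg_cst// card_ffun expn_gt0 T0.
Qed.

Definition fjoin (a b : nat) T (x : {ffun 'I_a -> T}) (y : {ffun 'I_b -> T})
  : {ffun 'I_(a + b) -> T} :=
  [ffun i : 'I_(a + b) => match fintype.split i with inl i => x i | inr i => y i end].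

Lemma fjoinl a b T (x : {ffun 'I_a -> T}) (y : {ffun 'I_b -> T}) (i : 'I_a) :
  fjoin x y (lshift b i) = x i.
Proof. by rewrite ffunE; have /= -> := unsplitK (inl i : 'I_a + 'I_b). Qed.

Lemma fjoinr a b T (x : {ffun 'I_a -> T}) (y : {ffun 'I_b -> T}) (i : 'I_b) :
  fjoin x y (rshift a i) = y i.
Proof. by rewrite ffunE; have /= -> := unsplitK (inr i : 'I_a + 'I_b). Qed.

Lemma avg_fjoin a b T (f : {ffun 'I_(a + b) -> T} -> R) :
  avg f = avg (fun x => avg (fun y => f (fjoin x y))).
Proof.
rewrite /avg -mulr_sumr mulrA.
rewrite -invfM -natrM !card_ffun !card_ord expnD mulnC; congr (_ * _).
rewrite pair_big /= (reindex (fun p => fjoin p.1 p.2)) //=.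
apply: onW_bij; exists (fun z : {ffun 'I_(a + b) -> T} => ([ffun i => z (lshift b i)] : {ffun 'I_a -> T},
    [ffun i => z (rshift a i)] : {ffun 'I_b -> T})).
  by move=> [x y]; congr pair; apply/ffunP => i; rewrite ffunE ?fjoinl ?fjoinr.
move=> z; apply/ffunP => i; rewrite -[i]splitK.
by case: (fintype.split i) => j; rewrite ?fjoinl ?fjoinr ffunE.
Qed.

End average.

(** * Entropy of a density on a finite probability space *)

Section entropy.
Variable R : realType.
Implicit Types T U : finType.

(** The sharp constant is 1 / 2.  With 5 / 4, and u^2 <= 2, it is enough to
    combine two instances of e^s (1 - s / 2)^2 <= 1, which is 1 + x <= e^x squared. *)
Lemma cosh_le_expR (u : R) : (expR u + expR (- u)) / 2 <= expR (5 / 4 * u ^+ 2).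
Proof.
have [u2|u2] := leP (u ^+ 2) 2; last first.
  have le_e (s : R) : `|s| = `|u| -> expR s <= expR (5 / 4 * u ^+ 2).
    move=> su; rewrite ler_expR; apply: le_trans (ler_norm s) _; rewrite su.
    have := normr_ge0 u; move: u2; rewrite -[u ^+ 2]real_normK ?num_real//; nra.
  have := le_e u erefl; have := le_e (- u) (normrN u); lra.
have q (s : R) : s ^+ 2 <= 2 -> expR s * (1 - s / 2) ^+ 2 <= 1.
  move=> s2; have -> : expR s = expR (s / 2) ^+ 2.
    by rewrite -expRM_natl; congr expR; lra.
  rewrite -exprMn expr_le1 //; last by rewrite mulr_ge0 ?expR_ge0//; nra.
  by rewrite -[leRHS](expRxMexpNx_1 (s / 2)) ler_wpM2l ?expR_ge0//
    (le_trans _ (expR_ge1Dx _)).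
set v := u ^+ 2 / 4; have v0 : 0 <= v by rewrite divr_ge0 ?sqr_ge0.
have v1 : v <= 1 / 2 by rewrite /v; lra.
have X1 : (expR u + expR (- u)) / 2 * (1 - v) ^+ 2 <= 1 + v.
  have := q u u2; have := q (- u); rewrite sqrrN => /(_ u2).
  have -> : (1 - v) ^+ 2 = (1 - u / 2) ^+ 2 * (1 + u / 2) ^+ 2 by rewrite /v; field.
  have -> : 1 - - u / 2 = 1 + u / 2 by ring.
  have := sqr_ge0 (1 - u / 2); have := sqr_ge0 (1 + u / 2).
  move: (expR u) (expR (- u)) => e e'; rewrite /v; nra.
have E1 : 1 <= (1 - v) * expR (2 * v).
  have : (1 - v) * (1 + 2 * v) <= (1 - v) * expR (2 * v).
    by rewrite ler_wpM2l ?expR_ge1Dx //; lra.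
  apply: le_trans; nra.
have E2 : 1 <= ((1 - v) * expR (2 * v)) ^+ 2 by rewrite exprn_ege1.
have -> : 5 / 4 * u ^+ 2 = v + 2 * v *+ 2 by rewrite /v mulr2n; lra.
have -> : expR (v + 2 * v *+ 2) = expR v * expR (2 * v) ^+ 2.
  by rewrite mulr2n 2!expRD expr2.
have X0 : 0 <= (expR u + expR (- u)) / 2 by rewrite divr_ge0 ?addr_ge0 ?expR_ge0.
apply: le_trans (_ : (expR u + expR (- u)) / 2 * ((1 - v) * expR (2 * v)) ^+ 2 <= _).
  by rewrite ler_peMr.
rewrite exprMn mulrA ler_wpM2r ?sqr_ge0//.
apply: le_trans X1 _.
exact: expR_ge1Dx.
Qed.

Definition density T (h : T -> R) := (forall x, 0 <= h x) /\ avg h = 1.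

Definition ent T (h : T -> R) : R := avg (fun x => h x * ln (h x)).

Lemma density_card_gt0 T (h : T -> R) : density h -> (0 < #|T|)%N.
Proof.
case=> _; case: posnP => // T0; rewrite /avg T0 invr0 mul0r => /eqP.
by rewrite eq_sym oner_eq0.
Qed.

(** The Gibbs variational bound turns an exponential moment under the uniform
    law into a linear bound under a density of small entropy.  Pointwise it is
    ln z <= z - 1 at the ratio z of the Gibbs density of F to h. *)
Lemma gibbs T (h F : T -> R) : density h ->
  avg (fun x => h x * F x) <= ent h + ln (avg (fun x => expR (F x))).
Proof.
move=> hd; have T0 := density_card_gt0 hd; have [h0 h1] := hd.
set Z := avg (fun x => expR _).
have Z0 : 0 < Z.
  rewrite mulr_gt0 ?invr_gt0 ?ltr0n//.
  have [x _] := card_gt0P T0.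
  rewrite (bigD1 x)//= ltr_pwDl ?expR_gt0// sumr_ge0// => y _; exact: expR_ge0.
have pt x : h x * F x <= h x * ln (h x) + h x * ln Z + (expR (F x) / Z - h x).
  have [hx0|hx] := eqVneq (h x) 0.
    by rewrite hx0 !mul0r !add0r subr0 divr_ge0 ?expR_ge0// ltW.
  have hx0 : 0 < h x by rewrite lt_neqAle eq_sym hx h0.
  have e0 : 0 < expR (F x) / Z / h x by rewrite !divr_gt0 ?expR_gt0.
  have le1 : ln (expR (F x) / Z / h x) <= expR (F x) / Z / h x - 1.
    by rewrite -[X in ln X](subrKC 1) le_ln1Dx//; lra.
  rewrite !ln_div ?posrE ?expR_gt0 ?divr_gt0 ?expR_gt0// expRK in le1.
  have := ler_wpM2l (h0 x) le1.
  have -> : h x * (expR (F x) / Z / h x - 1) = expR (F x) / Z - h x.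
    by rewrite mulrBr mulr1 mulrC divfK.
  lra.
apply: le_trans (le_avg pt) _.
rewrite avgD avgB avgD !avgZr h1 mul1r divff ?gt_eqF// subrr addr0//.
Qed.

Lemma ent_ge0 T (h : T -> R) : density h -> 0 <= ent h.
Proof.
move=> hd; have := gibbs (fun=> 0) hd.
under eq_avg do rewrite mulr0.
by rewrite avg0 expR0 avg_cst ?(density_card_gt0 hd)// ln1 addr0.
Qed.

Definition sgb (b : bool) : R := (-1) ^+ b.

Lemma sgbM b c : sgb (b (+) c) = sgb b * sgb c.
Proof. by rewrite /sgb signr_addb. Qed.

Lemma sgb2 b : sgb b * sgb b = 1.
Proof. by rewrite -sgbM addbb. Qed.

Lemma avg_bool (f : bool -> R) : avg f = (f false + f true) / 2.
Proof. by rewrite /avg card_bool big_bool /=; lra. Qed.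

(** The coordinate biases of a density on the cube are paid for by its
    entropy, through the exponential moments of linear functions. *)
Lemma level1_inequality n (h : {ffun 'I_n -> bool} -> R) : density h ->
  \sum_i avg (fun x => h x * sgb (x i)) ^+ 2 <= 5 * ent h.
Proof.
move=> hd; pose u i := avg (fun x => h x * sgb (x i)).
pose s : R := \sum_i u i ^+ 2.
have s0 : 0 <= s by apply: sumr_ge0 => i _; rewrite sqr_ge0.
(* The linear function that points along the biases themselves; the factor
   c = 2 / 5 maximizes the balance c - 5 / 4 c^2 of gain against moment. *)
have := gibbs (fun x : {ffun 'I_n -> bool} => \sum_i (2 / 5) * u i * sgb (x i)) hd.
have -> : avg (fun x => h x * \sum_i (2 / 5) * u i * sgb (x i)) = 2 / 5 * s.
  under eq_avg do rewrite mulr_sumr.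
  rewrite avg_sum /s mulr_sumr; apply: eq_bigr => i _.
  rewrite expr2 [RHS]mulrA -[RHS]avgZl; apply: eq_avg => x; ring.
have : ln (avg (fun x : {ffun 'I_n -> bool} => expR (\sum_(i < n) 2 / 5 * u i * sgb (x i)))) <= s / 5.
  under eq_avg do rewrite expR_sum.
  rewrite (avg_ffun_prod (fun i b => expR (2 / 5 * u i * sgb b))).
  have P0 i : 0 < avg (fun b => expR (2 / 5 * u i * sgb b)).
    by rewrite avg_bool divr_gt0// addr_gt0 ?expR_gt0.
  rewrite -[leRHS]expRK ler_ln ?posrE ?expR_gt0 ?prodr_gt0//.
  rewrite mulr_suml expR_sum ler_prod// => i _; rewrite ltW//=.
  rewrite avg_bool /sgb expr0 expr1 mulr1 mulrN1.
  apply: le_trans (cosh_le_expR _) _; rewrite ler_expR; nra.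
by move: (ln _) => l ? ?; change (s <= 5 * ent h); lra.
Qed.

(** ** Chain rule *)

Section chain.
Variables (T U W : finType) (j : T -> U -> W).
Hypothesis avg_j : forall f : W -> R, avg f = avg (fun x => avg (fun y => f (j x y))).
Variable h : W -> R.
Hypothesis hd : density h.

Definition marg (x : T) : R := avg (fun y => h (j x y)).

(* Where the marginal vanishes the conditional law is set to the uniform one,
   so that it is a density everywhere. *)
Definition cond (x : T) (y : U) : R :=
  if marg x == 0 then 1 else h (j x y) / marg x.

Lemma chain_cards : (0 < #|T|)%N /\ (0 < #|U|)%N.
Proof.
have := hd.2; rewrite avg_j.
case: (posnP #|T|) => [T0|_].
  by rewrite /avg T0 invr0 mul0r => /eqP; rewrite eq_sym oner_eq0.
case: (posnP #|U|) => // U0.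
under eq_avg do rewrite /avg U0 invr0 mul0r.
by rewrite avg0 => /eqP; rewrite eq_sym oner_eq0.
Qed.

Lemma marg_density : density marg.
Proof.
split; last by rewrite -hd.2 [RHS]avg_j.
by move=> x; apply: avg_ge0 => y; exact: hd.1.
Qed.

Lemma cond_density x : density (cond x).
Proof.
rewrite /density /cond; have [m0|m0] := eqVneq (marg x) 0.
  by split => // ; rewrite avg_cst// chain_cards.2.
split; last by rewrite avgZr divff.
by move=> y; rewrite divr_ge0 ?hd.1 ?marg_density.1.
Qed.

Lemma marg_cond x y : marg x * cond x y = h (j x y).
Proof.
rewrite /cond; case: eqVneq => [m0|m0]; last by rewrite mulrC divfK.
rewrite m0 mul0r; apply/esym/eqP; move: m0; rewrite /marg /avg => /eqP.
rewrite mulf_eq0 invr_eq0 pnatr_eq0 -leqn0 leqNgt chain_cards.2 /=.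
by rewrite psumr_eq0 => [/allP/(_ y)|z _]; rewrite ?mem_index_enum ?hd.1// => /(_ isT).
Qed.

Lemma ent_chain : ent h = ent marg + avg (fun x => marg x * ent (cond x)).
Proof.
have [m0 _] := marg_density.
rewrite {1}/ent avg_j -avgD; apply: eq_avg => x.
rewrite -[X in _ + X]avgZl.
rewrite (eq_avg (g := fun y => h (j x y) * ln (marg x) +
    marg x * (cond x y * ln (cond x y)))).
  by rewrite avgD avgZr.
move=> y; rewrite -marg_cond mulrA -mulrDr; set p := marg x; set q := cond x y.
have [->|p0] := eqVneq p 0; first by rewrite !mul0r.
have [->|q0] := eqVneq q 0; first by rewrite !(mul0r, mulr0).
rewrite lnM// posrE lt_neqAle eq_sym ?p0 ?q0 /=; first exact: m0.
exact: (cond_density x).1.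
Qed.

Lemma avg_marg_cond (F : W -> R) : avg (fun z => h z * F z) =
  avg (fun x => marg x * avg (fun y => cond x y * F (j x y))).
Proof.
rewrite avg_j; apply: eq_avg => x; rewrite -avgZl; apply: eq_avg => y.
by rewrite mulrA marg_cond.
Qed.

End chain.

(** Jensen's inequality for the square root. *)
Lemma density_avg_sqrt T (h f : T -> R) : density h -> (forall x, 0 <= f x) ->
  avg (fun x => h x * Num.sqrt (f x)) <= Num.sqrt (avg (fun x => h x * f x)).
Proof.
move=> [h0 h1] f0; rewrite (le_trans (ler_norm _))// -sqrtr_sqr ler_wsqrtr//.
rewrite /avg exprMn.
have := weighted_CauchySchwarz predT (fun x => Num.sqrt (f x)) (fun=> 1) h0.
under eq_bigr do rewrite mulr1.
under [X in _ <= X * _ -> _]eq_bigr do rewrite sqr_sqrtr//.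
under [X in _ <= _ * X -> _]eq_bigr do rewrite expr1n mulr1.
move=> le; apply: le_trans (ler_wpM2l (sqr_ge0 _) le) _.
by rewrite [in leRHS]mulrC expr2 mulrACA [X in _ * X]h1 mulr1 mulrC.
Qed.

End entropy.

(** * Likelihood ratios of a block of biased signs *)

Section exponentials.
Variable R : realType.
Implicit Types y : R.

Lemma expR_sub_sqr_le y : - (1 / 2) <= y -> expR (y - 2 * y ^+ 2) <= 1 + y.
Proof.
move=> y12; have e0 := expR_gt0 (y - 2 * y ^+ 2).
have := expR_ge1Dx (- (y - 2 * y ^+ 2)); have := expRxMexpNx_1 (y - 2 * y ^+ 2).
move: (expR _) (expR (- _)) e0 => e e' e0 ee' le'.
have : 1 <= (1 + y) * (1 + - (y - 2 * y ^+ 2)).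
  have : 0 <= y ^+ 2 * (1 + 2 * y) by rewrite mulr_ge0 ?sqr_ge0//; lra.
  lra.
have : (1 + y) * (1 + - (y - 2 * y ^+ 2)) <= (1 + y) * e' by rewrite ler_wpM2l//; lra.
move=> h1 h2; have := ler_wpM2l (ltW e0) (le_trans h2 h1).
by rewrite mulr1 mulrCA ee' mulr1.
Qed.

Lemma expR_le_1D2 y : y <= 1 / 2 -> 0 <= y -> expR y <= 1 + 2 * y.
Proof.
move=> y1 y0; have := expR_ge1Dx (- y); have := expRxMexpNx_1 y.
have := expR_gt0 y; move: (expR y) (expR (- y)) => e e' e0 ee' le'.
have : e * (1 + - y) <= 1 by rewrite -[leRHS]ee' ler_wpM2l// ltW.
move=> le1; have y1' : 0 < 1 + - y by lra.
by rewrite -(ler_pM2r y1') (le_trans le1)//; nra.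
Qed.

End exponentials.

Section block.
Variables (R : realType) (I : finType) (lam : R).
Local Notation sgb := (sgb R).

Definition nrm (a : I -> R) : R := Num.sqrt (\sum_V a V ^+ 2).

Lemma sumsq_ge0 (a : I -> R) : 0 <= \sum_V a V ^+ 2.
Proof. by apply: sumr_ge0 => V _; rewrite sqr_ge0. Qed.

Lemma nrm_ge0 a : 0 <= nrm a. Proof. exact: sqrtr_ge0. Qed.

Lemma nrm_sqr a : nrm a ^+ 2 = \sum_V a V ^+ 2.
Proof. by rewrite sqr_sqrtr// sumsq_ge0. Qed.

Lemma nrmM_le (a g : I -> R) z : 0 <= z -> (forall V, `|g V| <= z) ->
  nrm (fun V => a V * g V) <= z * nrm a.
Proof.
move=> z0 gz; rewrite -[z * _]ger0_norm ?mulr_ge0 ?nrm_ge0//.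
rewrite -sqrtr_sqr ler_wsqrtr// exprMn nrm_sqr mulr_sumr ler_sum// => V _.
rewrite exprMn mulrC ler_wpM2r ?sqr_ge0// -[g V ^+ 2]real_normK ?num_real//.
by rewrite lerXn2r ?nnegrE.
Qed.

Section sums.
Variables (n : nat) (w : 'I_n -> I -> R).

Definition walk (x : {ffun 'I_n -> bool}) (V : I) : R := \sum_i sgb (x i) * w i V.

Definition lr (x : {ffun 'I_n -> bool}) (V : I) : R :=
  \prod_i (1 + lam * (sgb (x i) * w i V)).

(** Under the bias indexed by V the block has likelihood ratio [lr]; subtracting
    its mean and its linear term leaves the products over at least two signs. *)
Definition nonlin x V := lr x V - 1 - lam * walk x V.

(** The largest eigenvalue of the Gram matrix of the columns of w is at most
    G. *)
Definition gram_le (G : R) := forall b : I -> R,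
  \sum_i (\sum_V b V * w i V) ^+ 2 <= G * \sum_V b V ^+ 2.

End sums.

Section halves.
Variables (n m : nat) (w : 'I_(n + m) -> I -> R).

Definition wl i := w (lshift m i).
Definition wr i := w (rshift n i).

Definition fl (x : {ffun 'I_(n + m) -> bool}) : {ffun 'I_n -> bool} :=
  [ffun i => x (lshift m i)].
Definition fr (x : {ffun 'I_(n + m) -> bool}) : {ffun 'I_m -> bool} :=
  [ffun i => x (rshift n i)].

Lemma fl_join (x : {ffun 'I_n -> bool}) (y : {ffun 'I_m -> bool}) : fl (fjoin x y) = x.
Proof. by apply/ffunP => i; rewrite ffunE fjoinl. Qed.

Lemma fr_join (x : {ffun 'I_n -> bool}) (y : {ffun 'I_m -> bool}) : fr (fjoin x y) = y.
Proof. by apply/ffunP => i; rewrite ffunE fjoinr. Qed.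

Lemma walk_join x y V : walk w (fjoin x y) V = walk wl x V + walk wr y V.
Proof.
rewrite /walk big_split_ord /=; congr (_ + _); apply: eq_bigr => i _.
  by rewrite fjoinl.
by rewrite fjoinr.
Qed.

Lemma lr_join x y V : lr w (fjoin x y) V = lr wl x V * lr wr y V.
Proof.
rewrite /lr big_split_ord /=; congr (_ * _); apply: eq_bigr => i _.
  by rewrite fjoinl.
by rewrite fjoinr.
Qed.

Lemma nonlin_join x y V : nonlin w (fjoin x y) V =
  nonlin wl x V + nonlin wr y V + (lr wl x V - 1) * (lr wr y V - 1).
Proof. by rewrite /nonlin lr_join walk_join; ring. Qed.

Lemma gram_le_l G : gram_le w G -> gram_le wl G.
Proof.
move=> wG b; apply: le_trans (wG b); rewrite big_split_ord /= lerDl.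
by apply: sumr_ge0 => i _; rewrite sqr_ge0.
Qed.

Lemma gram_le_r G : gram_le w G -> gram_le wr G.
Proof.
move=> wG b; apply: le_trans (wG b); rewrite big_split_ord /= lerDr.
by apply: sumr_ge0 => i _; rewrite sqr_ge0.
Qed.

End halves.

(** Cauchy-Schwarz between the coordinate biases of h, which the level-one
    inequality bounds, and the image of a under w, which G bounds. *)
Lemma linear_part n (w : 'I_n -> I -> R) G (h : {ffun 'I_n -> bool} -> R)
    (a : I -> R) : 0 <= lam -> 0 <= G -> gram_le w G -> density h ->
  avg (fun x => h x * \sum_V a V * (lam * walk w x V)) <=
  lam * Num.sqrt (5 * G) * nrm a * Num.sqrt (ent h).
Proof.
move=> lam0 G0 wG hd.
have -> : avg (fun x => h x * \sum_V a V * (lam * walk w x V)) =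
    lam * \sum_i avg (fun x => h x * sgb (x i)) * \sum_V a V * w i V.
  rewrite mulr_sumr.
  under [RHS]eq_bigr do rewrite -avgZr -avgZl.
  rewrite -avg_sum; apply: eq_avg => x.
  rewrite mulr_sumr; under eq_bigr do rewrite /walk !mulr_sumr.
  rewrite exchange_big /=; apply: eq_bigr => i _.
  by rewrite !mulr_sumr; apply: eq_bigr => V _; ring.
rewrite -!mulrA ler_wpM2l// (le_trans (ler_norm _))// -sqrtr_sqr.
rewrite /nrm -!sqrtrM ?mulr_ge0 ?sumsq_ge0// ler_wsqrtr//.
apply: le_trans (sum_CauchySchwarz _ _ _) _.
have := level1_inequality hd; have := wG a.
set A := \sum_(i < n) (\sum_V _) ^+ 2; set B := \sum_(i < n) avg _ ^+ 2.
set s := \sum_V _ => lA lB.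
have -> : 5 * G * (s * ent h) = (5 * ent h) * (G * s) by ring.
by apply: ler_pM => //; apply: sumr_ge0 => i _; rewrite sqr_ge0.
Qed.

(** The power 2 ^ r, by doubling, so that a block of size [sz r.+1] is by
    definition made of two blocks of size [sz r]. *)
Fixpoint sz r : nat := if r is r'.+1 then (sz r' + sz r')%N else 1%N.

Lemma szE r : sz r = (2 ^ r)%N.
Proof. by elim: r => //= r ->; rewrite expnS mul2n addnn. Qed.

Variable B : R.

(** Bounds the distance to 1 of the likelihood ratio of a block of size 2 ^ r
    whose walk is at most B standard deviations; see [lr_near1]. *)
Definition zeta r : R := 4 * lam * B * Num.sqrt (sz r)%:R.

(** Typical walks are required of left halves only: in the recursion the left
    half supplies a coefficient to the right half, never conversely. *)
Fixpoint good r : ('I_(sz r) -> I -> R) -> {ffun 'I_(sz r) -> bool} -> bool :=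
  if r is r'.+1 then fun w x =>
    [&& good (wl w) (fl x), good (wr w) (fr x) &
     [forall V, `|walk (wl w) (fl x) V| <= B * Num.sqrt (sz r')%:R]]
  else fun _ _ => true.

Hypothesis lam0 : 0 <= lam.
Hypothesis lam12 : lam <= 1 / 2.
Hypothesis B1 : 1 <= B.
Let B0 : 0 <= B := le_trans ler01 B1.

Lemma lam_sgb_bound b (u : R) : u ^+ 2 = 1 -> - (1 / 2) <= lam * (sgb b * u).
Proof.
move=> u1; have : (sgb b * u) ^+ 2 = 1 by rewrite exprMn u1 [sgb b ^+ 2]expr2 sgb2 mulr1.
move: (sgb b * u) => s s1; have sN1 : -1 <= s by nra.
by have := lam0; have := lam12; nra.
Qed.

Lemma lr_bounds n (w : 'I_n -> I -> R) x V : (forall i, w i V ^+ 2 = 1) ->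
  expR (lam * walk w x V - 2 * lam ^+ 2 * n%:R) <= lr w x V <=
  expR (lam * walk w x V).
Proof.
move=> w1; apply/andP; split; last first.
  rewrite /walk mulr_sumr expR_sum ler_prod// => i _; rewrite expR_ge1Dx andbT.
  by have := lam_sgb_bound (x i) (w1 i); lra.
have -> : lam * walk w x V - 2 * lam ^+ 2 * n%:R = \sum_i
  (lam * (sgb (x i) * w i V) - 2 * (lam * (sgb (x i) * w i V)) ^+ 2).
  rewrite sumrB -mulr_sumr; congr (_ - _).
  rewrite (eq_bigr (fun=> 2 * lam ^+ 2)) => [|i _].
    by rewrite sumr_const card_ord mulr_natr.
  by rewrite !exprMn w1 [sgb _ ^+ 2]expr2 sgb2; ring.
rewrite expR_sum ler_prod// => i _; rewrite expR_ge0/= expR_sub_sqr_le//.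
exact: lam_sgb_bound.
Qed.

Lemma zeta_ge0 r : 0 <= zeta r.
Proof. by rewrite !mulr_ge0 ?sqrtr_ge0. Qed.

Lemma zetaS r : zeta r.+1 = Num.sqrt 2 * zeta r.
Proof.
by rewrite /zeta/= addnn -mul2n natrM sqrtrM// mulrCA.
Qed.

Lemma lr_near1 r (w : 'I_(sz r) -> I -> R) x V :
  (forall i, w i V ^+ 2 = 1) -> zeta r <= 1 / 2 ->
  `|walk w x V| <= B * Num.sqrt (sz r)%:R -> `|lr w x V - 1| <= zeta r.
Proof.
move=> w1 z1; rewrite ler_norml => /andP[lo hi].
have := lr_bounds x w1; have := zeta_ge0 r; rewrite /zeta in z1 *.
set q := Num.sqrt _ in z1 lo hi *.
have q0 : 0 <= q by exact: sqrtr_ge0.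
have -> : (sz r)%:R = q ^+ 2 by rewrite sqr_sqrtr.
set S := walk _ _ _ in lo hi *; move=> z0 /andP[le1 le2].
have lq : lam * q <= lam * B * q by rewrite mulrAC ler_peMr ?mulr_ge0.
have lS : lam * S <= lam * B * q by rewrite -mulrA ler_wpM2l.
have lS' : - (lam * B * q) <= lam * S by rewrite -mulrA -mulrN ler_wpM2l.
have p0 : 0 <= lam * B * q by rewrite !mulr_ge0.
have := expR_ge1Dx (lam * S - 2 * lam ^+ 2 * q ^+ 2).
have : expR (lam * S) <= expR (lam * B * q) by rewrite ler_expR.
have := @expR_le_1D2 _ (lam * B * q).
move: le1 le2; move: (expR (lam * S - _)) (expR (lam * S)) (expR (lam * B * q)).
move=> e1 e2 e3 le1 le2 /(_ _ p0)/wrap[]; first by lra.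
have lq0 : 0 <= lam * q by rewrite mulr_ge0.
have : 2 * lam ^+ 2 * q ^+ 2 <= lam * q.
  have -> : 2 * lam ^+ 2 * q ^+ 2 = 2 * (lam * q) * (lam * q) by ring.
  rewrite ler_piMl //; lra.
rewrite ler_norml => *; apply/andP; split; lra.
Qed.

Lemma sqrtD_le (s t : R) : 0 <= s -> 0 <= t ->
  Num.sqrt s + Num.sqrt t <= Num.sqrt 2 * Num.sqrt (s + t).
Proof.
move=> s0 t0; rewrite -sqrtrM//.
rewrite -[leLHS]ger0_norm ?addr_ge0 ?sqrtr_ge0// -sqrtr_sqr ler_wsqrtr//.
have := sqr_ge0 (Num.sqrt s - Num.sqrt t).
rewrite sqrrB sqrrD !sqr_sqrtr//; lra.
Qed.

Section tree.
Variable G : R.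
Hypothesis G0 : 0 <= G.

Let a0 := lam * Num.sqrt (5 * G).
Let a0_ge0 : 0 <= a0. Proof. by rewrite mulr_ge0 ?sqrtr_ge0. Qed.
Let C r : R := 2 * a0 * r%:R * zeta r.
Let C_ge0 r : 0 <= C r.
Proof. by rewrite !mulr_ge0 ?zeta_ge0. Qed.

(** Induction along the dyadic tree.  By [nonlin_join] the nonlinear part of a
    block is that of its two halves plus a cross term (L' - 1)(L'' - 1).  The
    chain rule splits the entropy of h between the left half and the right half
    given the left.  Given the left half, the cross term is an average of
    L'' - 1 against the test vector a (L' - 1), whose norm is at most zeta |a|:
    the induction hypothesis and [linear_part] apply to it.  Each level costs
    a multiple of zeta, and the factor sqrt 2 that recombines the square roots
    of the two entropies is absorbed by zeta, which grows by sqrt 2. *)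
Lemma nonlinear_part r (w : 'I_(sz r) -> I -> R)
    (h : {ffun 'I_(sz r) -> bool} -> R) (a : I -> R) :
  2 * r%:R * zeta r <= 1 -> (forall i V, w i V ^+ 2 = 1) -> gram_le w G ->
  density h -> (forall x, h x != 0 -> good w x) ->
  avg (fun x => h x * \sum_V a V * nonlin w x V) <=
  2 * (lam * Num.sqrt (5 * G)) * r%:R * zeta r * nrm a * Num.sqrt (ent h).
Proof.
rewrite -/a0 -/(C r); elim: r w h a => [|r IH] w h a zr w1 wG hd hgood.
  rewrite (eq_avg (g := fun=> 0)) => [|x].
    by rewrite avg0 !mulr_ge0 ?sqrtr_ge0.
  rewrite big1 ?mulr0// => V _.
  by rewrite /nonlin /lr /walk !big_ord1; ring.
have s2 : 1 <= Num.sqrt 2 :> R by rewrite -[leLHS]sqrtr1 ler_wsqrtr ?ler1n.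
have zr' : 2 * r%:R * zeta r <= 1.
  apply: le_trans zr; rewrite zetaS; apply: ler_pM => //; rewrite ?mulr_ge0 ?zeta_ge0//.
    by rewrite ler_wpM2l// ler_nat.
  by rewrite ler_peMl ?zeta_ge0.
have z1 : zeta r <= 1 / 2.
  move: zr; rewrite zetaS -[r.+1%:R]natr1; have := zeta_ge0 r.
  have := ler0n R r; move: (zeta r) (r%:R) (Num.sqrt 2) s2 => z p s s1 p0 z0.
  have le_z : z <= s * z by rewrite ler_peMl.
  have : 0 <= p * (s * z) by rewrite !mulr_ge0// (le_trans ler01).
  lra.
have CA : C r <= a0.
  have -> : C r = a0 * (2 * r%:R * zeta r) by rewrite /C; ring.
  by rewrite ler_piMr.
have avg_j f := @avg_fjoin R (sz r) (sz r) bool f.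
set h1 := marg (@fjoin (sz r) (sz r) bool) h.
pose h2 := cond (@fjoin (sz r) (sz r) bool) h.
have h1d : density h1 := marg_density avg_j hd.
have h2d x : density (h2 x) := cond_density avg_j hd x.
have hE x y : h1 x * h2 x y = h (fjoin x y) := marg_cond avg_j hd x y.
have sup2 x y : h1 x != 0 -> h2 x y != 0 ->
  [/\ good (wl w) x, good (wr w) y & forall V, `|lr (wl w) x V - 1| <= zeta r].
  move=> n1 n2; have := hgood (fjoin x y); rewrite -hE mulf_neq0// => /(_ isT).
  rewrite /= fl_join fr_join => /and3P[g1 g2 /forallP g3]; split=> // V.
  by apply: lr_near1 => // i; exact: w1.
have sup1 x : h1 x != 0 ->
  good (wl w) x /\ forall V, `|lr (wl w) x V - 1| <= zeta r.
  move=> n1; suff [y n2] : exists y, h2 x y != 0 by have [] := sup2 x y n1 n2.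
  apply/existsP; apply: contraT; rewrite negb_exists => /forallP n2.
  have := (h2d x).2; rewrite (eq_avg (g := fun=> 0)) => [|y].
    by rewrite avg0 => /eqP; rewrite eq_sym oner_eq0.
  by apply/eqP; have := n2 y; rewrite negbK.
have wl1 i V : wl w i V ^+ 2 = 1 by exact: w1.
have wr1 i V : wr w i V ^+ 2 = 1 by exact: w1.
have left_half : avg (fun x => h1 x * \sum_V a V * nonlin (wl w) x V) <=
    C r * nrm a * Num.sqrt (ent h1).
  by apply: IH => //; [exact: gram_le_l | move=> x /sup1[]].
(* The right half and the cross term are read under the conditional density,
   where the factor lr - 1 of the left half is a constant vector in V. *)
have right_half x : h1 x * avg (fun y => h2 x y * \sum_V a V *
    (nonlin (wr w) y V + (lr (wl w) x V - 1) * (lr (wr w) y V - 1))) <=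
    h1 x * ((C r + zeta r * (a0 + C r)) * nrm a * Num.sqrt (ent (h2 x))).
  have [->|n1] := eqVneq (h1 x) 0; first by rewrite !mul0r.
  rewrite ler_wpM2l//; first exact: h1d.1.
  have g2 y : h2 x y != 0 -> good (wr w) y by move=> /(sup2 x y n1)[].
  have [_ lx] := sup1 x n1.
  pose b V := a V * (lr (wl w) x V - 1).
  have nb : nrm b <= zeta r * nrm a by apply: nrmM_le => //; exact: zeta_ge0.
  rewrite (eq_avg (g := fun y => h2 x y * \sum_V a V * nonlin (wr w) y V +
    (h2 x y * \sum_V b V * nonlin (wr w) y V +
     h2 x y * \sum_V b V * (lam * walk (wr w) y V)))); last first.
    move=> y; rewrite -!mulrDr -!big_split; congr (_ * _).
    by apply: eq_bigr => V _; rewrite /= /b /nonlin; ring.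
  have wrG := gram_le_r wG.
  have e1 := IH _ _ a zr' wr1 wrG (h2d x) g2.
  have e2 := IH _ _ b zr' wr1 wrG (h2d x) g2.
  have e3 := linear_part b lam0 G0 wrG (h2d x).
  have e4 : (C r + a0) * nrm b * Num.sqrt (ent (h2 x)) <=
            (C r + a0) * (zeta r * nrm a) * Num.sqrt (ent (h2 x)).
    by rewrite ler_wpM2r ?sqrtr_ge0// ler_wpM2l// addr_ge0.
  rewrite !avgD; move: e1 e2 e3 e4; rewrite -/a0.
  move: (Num.sqrt _) => s; move: (nrm a) (nrm b) => na nb'; lra.
have -> : avg (fun x => h x * \sum_V a V * nonlin w x V) =
    avg (fun x => h1 x * \sum_V a V * nonlin (wl w) x V) +
    avg (fun x => h1 x * avg (fun y => h2 x y * \sum_V a V *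
    (nonlin (wr w) y V + (lr (wl w) x V - 1) * (lr (wr w) y V - 1)))).
  rewrite (avg_marg_cond avg_j hd) -avgD; apply: eq_avg => x.
  rewrite -mulrDr; congr (_ * _).
  have E c : c = avg (fun y => h2 x y * c) by rewrite avgZr (h2d x).2 mul1r.
  rewrite [\sum_V a V * nonlin (wl w) x V]E -avgD; apply: eq_avg => y.
  rewrite -mulrDr -big_split; congr (_ * _); apply: eq_bigr => V _ /=.
  by rewrite nonlin_join; ring.
apply: le_trans (lerD left_half (le_avg right_half)) _.
set c := C r + _; set b1 := ent h1; set b2 := avg (fun x => h1 x * ent (h2 x)).
have eh : ent h = b1 + b2 := ent_chain avg_j hd.
have b10 : 0 <= b1 by exact: ent_ge0.
have b20 : 0 <= b2 by apply: avg_ge0 => x; rewrite mulr_ge0 ?ent_ge0// h1d.1.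
have c0 : 0 <= c by rewrite !addr_ge0 ?mulr_ge0 ?zeta_ge0 ?addr_ge0.
have e5 : avg (fun x => h1 x * (c * nrm a * Num.sqrt (ent (h2 x)))) <=
    c * nrm a * Num.sqrt b2.
  rewrite (eq_avg (g := fun x => c * nrm a * (h1 x * Num.sqrt (ent (h2 x)))));
    last by move=> x; ring.
  rewrite avgZl ler_wpM2l ?mulr_ge0 ?nrm_ge0//.
  by apply: density_avg_sqrt => // x; exact: ent_ge0.
apply: le_trans (lerD (lexx _) e5) _; rewrite eh.
have e6 := sqrtD_le b10 b20.
have e7 : Num.sqrt b2 <= Num.sqrt (b1 + b2) by rewrite ler_wsqrtr// lerDr.
have e8 : C r * Num.sqrt 2 + zeta r * (a0 + C r) <= C r.+1.
  rewrite {3}/C zetaS -[r.+1%:R]natr1.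
  have : zeta r * C r <= zeta r * a0 by rewrite ler_wpM2l ?zeta_ge0.
  have : a0 * zeta r <= a0 * (Num.sqrt 2 * zeta r).
    by rewrite ler_wpM2l// ler_peMl ?zeta_ge0.
  rewrite /C; move: (Num.sqrt 2) (zeta r) (r%:R) => p q p'; lra.
have -> : C r * nrm a * Num.sqrt b1 + c * nrm a * Num.sqrt b2 =
  nrm a * (C r * (Num.sqrt b1 + Num.sqrt b2) + zeta r * (a0 + C r) * Num.sqrt b2).
  by rewrite /c; ring.
have -> : C r.+1 * nrm a * Num.sqrt (b1 + b2) = nrm a * (C r.+1 * Num.sqrt (b1 + b2)).
  by ring.
rewrite ler_wpM2l ?nrm_ge0//.
apply: le_trans (_ : (C r * Num.sqrt 2 + zeta r * (a0 + C r)) * Num.sqrt (b1 + b2) <= _).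
  rewrite [leRHS]mulrDl; apply: lerD; first by rewrite -[leRHS]mulrA ler_wpM2l.
  by rewrite ler_wpM2l// mulr_ge0 ?zeta_ge0 ?addr_ge0.
by rewrite ler_wpM2r ?sqrtr_ge0.
Qed.

(** The level-one inequality survives the passage from the linear statistic to
    the full likelihood ratio: the linear and nonlinear bounds are applied with
    the vector of the averages themselves as test vector. *)
Lemma lr_level1 r (w : 'I_(sz r) -> I -> R) (h : {ffun 'I_(sz r) -> bool} -> R) :
  2 * r%:R * zeta r <= 1 -> (forall i V, w i V ^+ 2 = 1) -> gram_le w G ->
  density h -> (forall x, h x != 0 -> good w x) ->
  \sum_V avg (fun x => h x * (lr w x V - 1)) ^+ 2 <=
  20 * lam ^+ 2 * G * ent h.
Proof.
move=> zr w1 wG hd hgood; pose a V := avg (fun x => h x * (lr w x V - 1)).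
have e0 := ent_ge0 hd.
have key : nrm a ^+ 2 <= 2 * a0 * nrm a * Num.sqrt (ent h).
  rewrite nrm_sqr.
  have -> : \sum_V a V ^+ 2 = avg (fun x => h x * \sum_V a V * nonlin w x V) +
     avg (fun x => h x * \sum_V a V * (lam * walk w x V)).
    rewrite -avgD [RHS](eq_avg (g := fun x => \sum_V a V * (h x * (lr w x V - 1)))).
      by rewrite avg_sum; apply: eq_bigr => V _; rewrite avgZl.
    move=> x; rewrite -mulrDr -big_split mulr_sumr; apply: eq_bigr => V _ /=.
    by rewrite /nonlin; ring.
  have e1 := nonlinear_part a zr w1 wG hd hgood.
  have e2 := linear_part a lam0 G0 wG hd.
  apply: le_trans (lerD e1 e2) _; rewrite -/a0.
  have : a0 * (2 * r%:R * zeta r) * (nrm a * Num.sqrt (ent h)) <=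
         a0 * 1 * (nrm a * Num.sqrt (ent h)).
    by rewrite ler_wpM2r ?mulr_ge0 ?nrm_ge0 ?sqrtr_ge0// ler_wpM2l.
  lra.
have -> : 20 * lam ^+ 2 * G * ent h = (2 * a0 * Num.sqrt (ent h)) ^+ 2.
  by rewrite !exprMn !sqr_sqrtr// ?mulr_ge0//; ring.
rewrite -nrm_sqr.
have [->|n0] := eqVneq (nrm a) 0; first by rewrite expr0n sqr_ge0.
have np : 0 < nrm a by rewrite lt_neqAle eq_sym n0 nrm_ge0.
rewrite lerXn2r ?nnegrE ?nrm_ge0 ?mulr_ge0 ?sqrtr_ge0//.
rewrite -(ler_pM2r np) -expr2 (le_trans key)//.
by rewrite mulrAC.
Qed.

End tree.
End block.

(** * What a short message reveals about a block *)

Section moments.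
Variables (R : realType) (I : finType) (lam : R).
Hypothesis lam0 : 0 <= lam.
Hypothesis lam12 : lam <= 1 / 2.
Local Notation sgb := (sgb R).

Lemma cube_card_gt0 n : (0 < #|{ffun 'I_n -> bool}|)%N.
Proof. by rewrite card_ffun card_bool expn_gt0. Qed.

Lemma avg_sgb_factor (f : R -> R) (u : R) : u ^+ 2 = 1 ->
  avg (fun b => f (sgb b * u)) = (f 1 + f (-1)) / 2.
Proof.
move=> /eqP; rewrite sqrf_eq1 => /orP[]/eqP->; rewrite avg_bool /sgb expr0 expr1;
  by rewrite ?(mulN1r, mul1r, opprK)//; rewrite addrC.
Qed.

Section sign_block.
Variables (n : nat) (w : 'I_n -> I -> R) (V : I).
Hypothesis w1 : forall i, w i V ^+ 2 = 1.

Lemma lr_ge0 x : 0 <= lr lam w x V.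
Proof.
apply: prodr_ge0 => i _; have := lam_sgb_bound lam0 lam12 (x i) (w1 i); lra.
Qed.

Lemma avg_lr : avg (fun x => lr lam w x V) = 1.
Proof.
rewrite (avg_ffun_prod (fun i b => 1 + lam * (sgb b * w i V))) big1// => i _.
by rewrite (@avg_sgb_factor (fun u => 1 + lam * u))//; field.
Qed.

(** The fourth power of each factor averages to 1 + 6 lam^2 + lam^4, at most
    1 + 7 lam^2. *)
Lemma avg_lr4 : avg (fun x => (lr lam w x V - 1) ^+ 4) <=
  1 + expR (7 * lam ^+ 2 * n%:R).
Proof.
apply: le_trans (_ : avg (fun x => 1 + lr lam w x V ^+ 4) <= _).
  apply: le_avg => x; have l0 := lr_ge0 x; move: (lr _ _ _ _) l0 => l l0.
  have [l1|l1] := leP l 1.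
    apply: le_trans (_ : 1 <= _); last by rewrite lerDl exprn_ge0.
    rewrite (_ : (l - 1) ^+ 4 = (1 - l) ^+ 4); last by ring.
    by apply: exprn_ile1; lra.
  apply: le_trans (_ : l ^+ 4 <= _); last by rewrite lerDr.
  by rewrite lerXn2r ?nnegrE; lra.
rewrite avgD avg_cst ?cube_card_gt0// lerD2l.
under eq_avg do rewrite /lr -prodrXl.
rewrite (avg_ffun_prod (fun i b => (1 + lam * (sgb b * w i V)) ^+ 4)).
rewrite mulr_natr -[n in X in _ <= X]card_ord -sumr_const expR_sum ler_prod// => i _.
rewrite (@avg_sgb_factor (fun u => (1 + lam * u) ^+ 4))//.
have -> : ((1 + lam * 1) ^+ 4 + (1 + lam * -1) ^+ 4) / 2 = 1 + (6 * lam ^+ 2 + lam ^+ 4) by field.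
have l4 : lam ^+ 4 <= lam ^+ 2.
  by rewrite ler_wiXn2l//; have := lam0; have := lam12; lra.
have l20 := sqr_ge0 lam; have l40 : 0 <= lam ^+ 4 by rewrite exprn_ge0.
apply/andP; split; first by lra.
apply: le_trans (expR_ge1Dx _) _; rewrite ler_expR; lra.
Qed.

Lemma walk_tail (t : R) : 0 < t ->
  avg (fun x => (t * Num.sqrt n%:R < `|walk w x V|)%R%:R) <= 2 * expR (- (t ^+ 2 / 5)).
Proof.
move=> t0; set q := Num.sqrt n%:R.
have [n0|n0] := posnP n.
  rewrite (eq_avg (g := fun=> 0)) ?avg0 ?mulr_ge0 ?expR_ge0// => x.
  have -> : walk w x V = 0.
    by rewrite /walk big1// => i; have := ltn_ord i; rewrite {2}n0.
  by rewrite normr0 ltNge mulr_ge0 ?sqrtr_ge0 ?ltW.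
have q0 : 0 < q by rewrite sqrtr_gt0 ltr0n.
(* The exponential tilt that is optimal for the sub-Gaussian bound. *)
pose u := 2 * t / (5 * q).
have uq : u * (t * q) = 2 / 5 * t ^+ 2 by rewrite /u; field; rewrite gt_eqF.
have u0 : 0 < u by rewrite divr_gt0 ?mulr_gt0.
apply: le_trans (_ : avg (fun x => expR (- (u * (t * q))) *
    (expR (u * walk w x V) + expR (- (u * walk w x V)))) <= _).
  apply: le_avg => x; set S := walk _ _ _.
  case: ltP => S0 /=; last by rewrite mulr_ge0 ?addr_ge0 ?expR_ge0.
  rewrite mulrDr -!expRD.
  have [Sp|Sn] := leP 0 S.
    apply: le_trans (_ : expR (- (u * (t * q)) + u * S) <= _); last first.
      by rewrite lerDl expR_ge0.
    rewrite -[leLHS]expR0 ler_expR addrC subr_ge0 ler_pM2l//.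
    by rewrite -[S]ger0_norm// ltW.
  apply: le_trans (_ : expR (- (u * (t * q)) - u * S) <= _); last first.
    by rewrite lerDr expR_ge0.
  rewrite -[leLHS]expR0 ler_expR addrC -mulrN subr_ge0 ler_pM2l//.
  by rewrite -ltr0_norm// ltW.
have mgf (v : R) : avg (fun x => expR (v * walk w x V)) <= expR (5 / 4 * v ^+ 2 * n%:R).
  under eq_avg do rewrite /walk mulr_sumr expR_sum.
  rewrite (avg_ffun_prod (fun i b => expR (v * (sgb b * w i V)))).
  rewrite mulr_natr -[n in X in _ <= X]card_ord -sumr_const expR_sum ler_prod// => i _.
  rewrite (@avg_sgb_factor (fun z => expR (v * z)))// mulr1 mulrN1.
  by rewrite cosh_le_expR divr_ge0 ?addr_ge0 ?expR_ge0.
rewrite avgZl avgD.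
have := mgf u; have := mgf (- u); rewrite sqrrN.
under eq_avg do rewrite mulNr.
move: (avg _) (avg _) => A1 A2 h1 h2.
apply: le_trans (_ : expR (- (u * (t * q))) * (2 * expR (5 / 4 * u ^+ 2 * n%:R)) <= _).
  by rewrite ler_wpM2l ?expR_ge0//; lra.
rewrite mulrCA -expRD ler_wpM2l// ler_expR.
have -> : n%:R = q ^+ 2 by rewrite sqr_sqrtr.
have -> : 5 / 4 * u ^+ 2 * q ^+ 2 = t ^+ 2 / 5 by rewrite /u; field; rewrite gt_eqF.
rewrite uq; lra.
Qed.

End sign_block.

(** A union bound over the [sz r - 1] left halves of the tree, each compared
    with the tail at the size of its own walk. *)
Lemma bad_prob (B : R) r (w : 'I_(sz r) -> I -> R) : 0 < B ->
  (forall i V, w i V ^+ 2 = 1) ->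
  avg (fun x => (~~ good B w x)%:R) <=
  (sz r)%:R * (#|I|%:R * (2 * expR (- (B ^+ 2 / 5)))).
Proof.
move=> B0; set e := #|I|%:R * _.
have e0 : 0 <= e by rewrite !mulr_ge0 ?expR_ge0.
move=> w1; suff : avg (fun x => (~~ good B w x)%:R) <= (sz r)%:R * e - e.
  by move=> /le_trans; apply; rewrite gerBl.
elim: r w w1 => [|r IH] w w1 /=; first by rewrite avg0 mul1r subrr.
rewrite (avg_fjoin (a := sz r) (b := sz r)).
apply: le_trans (_ : avg (fun x => avg (fun y => (~~ good B (wl w) x)%:R +
   (~~ good B (wr w) y)%:R + \sum_V
   (B * Num.sqrt (sz r)%:R < `|walk (wl w) x V|)%R%:R)) <= _).
  apply: le_avg => x; apply: le_avg => y.
  rewrite fl_join fr_join -/(good B (wl w) x) -/(good B (wr w) y).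
  have s0 : 0 <= \sum_V (B * Num.sqrt (sz r)%:R < `|walk (wl w) x V|)%R%:R :> R.
    by apply: sumr_ge0.
  case: (good B (wl w) x); case: (good B (wr w) y) => //=; rewrite ?mulr0n ?add0r ?addr0;
    try by (rewrite ?lerDl ?ler_wpDr// ?ler_wpDl).
  case: forallP => //= /forallP; rewrite negb_forall => /existsP[V].
  rewrite -ltNge => ltV; rewrite (bigD1 V)//= ltV lerDl; exact: sumr_ge0.
have cgt := cube_card_gt0 (sz r).
under eq_avg do rewrite !avgD !avg_cst//.
rewrite !avgD avg_cst// avg_sum.
have IHl := IH (wl w) (fun i V => w1 _ V).
have IHr := IH (wr w) (fun i V => w1 _ V).
have : \sum_V avg (fun x => (B * Num.sqrt (sz r)%:R < `|walk (wl w) x V|)%R%:R) <= e.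
  rewrite /e mulr_natl -sumr_const; apply: ler_sum => V _.
  by apply: walk_tail => // i; exact: w1.
rewrite natrD; lra.
Qed.

End moments.

Section partition.
Variable R : realType.

Definition cavg (T : finType) (A : pred T) (f : T -> R) : R :=
  #|A|%:R^-1 * \sum_(x | A x) f x.

(** The entropy of a law on at most K points; the 1 makes up for a total mass
    that may be smaller than one. *)
Lemma sum_entropy_le (P : finType) (S : pred P) (K : nat) (q : P -> R) :
  (0 < K)%N -> (#|S| <= K)%N -> (forall p, 0 <= q p) -> \sum_(p | S p) q p <= 1 ->
  \sum_(p | S p) q p * ln (q p)^-1 <= ln K%:R + 1.
Proof.
move=> K0 SK q0 q1; have KR : 0 < K%:R :> R by rewrite ltr0n.
apply: le_trans (_ : \sum_(p | S p) (q p * ln K%:R + K%:R^-1) <= _).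
  apply: ler_sum => p _.
  have [->|qn] := eqVneq (q p) 0; first by rewrite !mul0r add0r invr_ge0 ltW.
  have qp : 0 < q p by rewrite lt_neqAle eq_sym qn q0.
  have z0 : 0 < (q p)^-1 / K%:R by rewrite divr_gt0 ?invr_gt0.
  have le1 : ln ((q p)^-1 / K%:R) <= (q p)^-1 / K%:R - 1.
    by rewrite -[X in ln X](subrKC 1) le_ln1Dx//; lra.
  rewrite ln_div ?posrE ?invr_gt0// in le1.
  have := ler_wpM2l (q0 p) le1.
  have -> : q p * ((q p)^-1 / K%:R - 1) = K%:R^-1 - q p.
    by rewrite mulrBr mulr1 mulrA divff// mul1r.
  lra.
rewrite big_split /= -mulr_suml sumr_const; apply: lerD.
  by rewrite ler_piMl// ln_ge0// ler1n.
by rewrite -[leLHS]mulr_natl ler_pdivrMr// mul1r ler_nat.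
Qed.

Variables (I : finType) (lam B G : R) (r : nat).
Hypothesis lam0 : 0 <= lam.
Hypothesis lam12 : lam <= 1 / 2.
Hypothesis B1 : 1 <= B.
Hypothesis G0 : 0 <= G.
Hypothesis zr : 2 * r%:R * zeta lam B r <= 1.
Variable w : 'I_(sz r) -> I -> R.
Hypothesis w1 : forall i V, w i V ^+ 2 = 1.
Hypothesis wG : gram_le w G.
Local Notation X := {ffun 'I_(sz r) -> bool}.
Local Notation M x V := (lr lam w x V - 1).

(** [lr_level1] for the uniform law on a set of good inputs, whose entropy is
    the logarithm of the inverse density of the set. *)
Lemma good_cell (A : pred X) : (forall x, A x -> good B w x) ->
  \sum_V (\sum_(x | A x) M x V) ^+ 2 <=
  #|A|%:R ^+ 2 * (20 * lam ^+ 2 * G * ln (#|A|%:R / #|X|%:R)^-1).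
Proof.
move=> Ag; have [A0|A0] := posnP #|A|.
  rewrite A0 expr0n mul0r big1// => V _; rewrite big1 ?expr0n// => x Ax.
  by have : A x = false := card0_eq A0 x; rewrite Ax.
have AR : 0 < #|A|%:R :> R by rewrite ltr0n.
have XR : 0 < #|X|%:R :> R by rewrite ltr0n (cube_card_gt0 (sz r)).
pose h x : R := (A x)%:R * (#|X|%:R / #|A|%:R).
have hE f : avg (fun x => h x * f x) = #|A|%:R^-1 * \sum_(x | A x) f x.
  rewrite /avg [X in _ * X](eq_bigr (fun x => #|X|%:R / #|A|%:R * ((A x)%:R * f x)));
    last by move=> x _; rewrite /h; ring.
  rewrite -mulr_sumr !mulrA mulVf ?gt_eqF// mul1r; congr (_ * _).
  by rewrite [RHS]big_mkcond; apply: eq_bigr => x _; case: (A x); rewrite ?mul1r ?mul0r.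
have hd : density h.
  split; first by move=> x; rewrite mulr_ge0 ?divr_ge0 ?ler0n.
  have := hE (fun=> 1); under eq_avg do rewrite mulr1; move=> ->.
  by rewrite sumr_const -[1 *+ _]mulr_natl mulr1 mulVf ?gt_eqF.
have eh : ent h = ln (#|A|%:R / #|X|%:R)^-1.
  rewrite /ent hE (eq_bigr (fun=> ln (#|X|%:R / #|A|%:R))); last first.
    by move=> x Ax; rewrite /h Ax mul1r.
  by rewrite sumr_const -[ln _ *+ _]mulr_natl mulKf ?gt_eqF// invf_div.
have hg x : h x != 0 -> good B w x.
  by rewrite /h; case: (boolP (A x)) => [/Ag//|_]; rewrite mul0r eqxx.
have := lr_level1 lam0 lam12 B1 G0 zr w1 wG hd hg.
under eq_bigr do rewrite hE exprMn.
rewrite eh -mulr_sumr exprVn => le1.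
rewrite -(ler_pM2l (_ : 0 < (#|A|%:R ^+ 2)^-1)) ?invr_gt0 ?exprn_gt0//.
by apply: le_trans le1 _; rewrite mulKf// expf_neq0// gt_eqF.
Qed.

(** [good_cell] is applied to the good part of each cell of [rho].  With q its
    density, the contribution of the cell to the average is q ln (1 / q), and
    these add up to the entropy of the message, at most ln K + 1.  The bad
    part of each cell is left to Cauchy-Schwarz. *)
Lemma message_bound (P : finType) (rho : X -> P) (K : nat) :
  (0 < K)%N -> (#|[set rho x | x in X]| <= K)%N ->
  \sum_V avg (fun x => cavg [pred y | rho y == rho x] (fun y => M y V) ^+ 2) <=
  40 * lam ^+ 2 * G * (ln K%:R + 1) +
  2 * \sum_V avg (fun x => (~~ good B w x)%:R * M x V ^+ 2).
Proof.
move=> K0 SK.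
pose A p := [pred y : X | rho y == p].
pose Ag p := [pred y : X | (rho y == p) && good B w y].
pose q p : R := #|Ag p|%:R / #|X|%:R.
pose S := [pred p | p \in [set rho x | x in X]].
have XR : 0 < #|X|%:R :> R by rewrite ltr0n (cube_card_gt0 (sz r)).
have cells (F : X -> R) : \sum_x F x = \sum_(p | S p) \sum_(x | A p x) F x.
  by rewrite (partition_big rho S)//= => x _; apply: imset_f.
have cell p : S p -> #|A p|%:R * \sum_V cavg (A p) (fun y => M y V) ^+ 2 <=
    40 * lam ^+ 2 * G * (#|Ag p|%:R * ln (q p)^-1) +
    2 * \sum_V \sum_(x | A p x) (~~ good B w x)%:R * M x V ^+ 2.
  move=> /imsetP[x0 _ px].
  have A0 : 0 < #|A p|%:R :> R.
    by rewrite ltr0n; apply/card_gt0P; exists x0; rewrite inE px.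
  have AgA : #|Ag p|%:R <= #|A p|%:R :> R.
    by rewrite ler_nat; apply: subset_leq_card; apply/fintype.subsetP => y; rewrite !inE => /andP[].
  pose sg V := \sum_(x | Ag p x) M x V.
  pose sb V := \sum_(x | A p x) (~~ good B w x)%:R * M x V.
  have sE V : \sum_(x | A p x) M x V = sg V + sb V.
    rewrite /sg /sb (bigID (good B w)) /=; congr (_ + _).
    rewrite big_mkcondr; apply: eq_bigr => x _.
    by case: (good _ _ _); rewrite ?mul0r ?mul1r.
  have sg2 : \sum_V sg V ^+ 2 <= #|Ag p|%:R * (#|A p|%:R *
      (20 * lam ^+ 2 * G * ln (q p)^-1)).
    have := @good_cell (Ag p) (fun x => @proj2 _ _ \o andP).
    rewrite -/(q p) => /le_trans; apply; rewrite expr2 -mulrA ler_wpM2l// ler_wpM2r//.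
    rewrite !mulr_ge0 ?sqr_ge0//.
    have [->|qn] := eqVneq (q p) 0; first by rewrite invr0 ln0.
    have qp : 0 < q p by rewrite lt_neqAle eq_sym qn divr_ge0.
    by rewrite ln_ge0// invf_ge1// ler_pdivrMr// mul1r ler_nat max_card.
  have sb2 : \sum_V sb V ^+ 2 <= #|A p|%:R *
      \sum_V \sum_(x | A p x) (~~ good B w x)%:R * M x V ^+ 2.
    rewrite mulr_sumr; apply: ler_sum => V _.
    have := sum_CauchySchwarz (A p) (fun=> 1) (fun x => (~~ good B w x)%:R * M x V).
    under eq_bigr do rewrite mul1r.
    rewrite -/(sb V) => /le_trans; apply.
    under eq_bigr do rewrite expr1n.
    rewrite sumr_const -[1 *+ _]mulr_natl mulr1 ler_wpM2l// ler_sum// => x _.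
    by case: (good B w x); rewrite ?mul0r ?mul1r ?expr0n.
  under eq_bigr do rewrite /cavg sE exprMn exprVn.
  rewrite -mulr_sumr.
  have -> (s : R) : #|A p|%:R * ((#|A p|%:R ^+ 2)^-1 * s) = s / #|A p|%:R.
    by field; rewrite gt_eqF.
  rewrite ler_pdivrMr//.
  apply: le_trans (_ : \sum_V (2 * sg V ^+ 2 + 2 * sb V ^+ 2) <= _).
    apply: ler_sum => V _; have := sqr_ge0 (sg V - sb V); rewrite sqrrB sqrrD; lra.
  rewrite big_split /= -!mulr_sumr.
  move: sg2 sb2; move: (\sum_V sg V ^+ 2) (\sum_V sb V ^+ 2) => s1 s2.
  move: (\sum_V _) (ln _) => s3 l; lra.
have avgE V : avg (fun x => cavg (A (rho x)) (fun y => M y V) ^+ 2) =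
    #|X|%:R^-1 * \sum_(p | S p) #|A p|%:R * cavg (A p) (fun y => M y V) ^+ 2.
  rewrite /avg cells; congr (_ * _); apply: eq_bigr => p _.
  rewrite mulr_natl -sumr_const; apply: eq_bigr => x; rewrite inE => /eqP xp.
  by rewrite xp.
under eq_bigr do rewrite avgE.
rewrite -mulr_sumr exchange_big /=.
under eq_bigr do rewrite -mulr_sumr.
apply: le_trans (_ : #|X|%:R^-1 * (\sum_(p | S p)
    (40 * lam ^+ 2 * G * (#|Ag p|%:R * ln (q p)^-1) +
    2 * \sum_V \sum_(x | A p x) (~~ good B w x)%:R * M x V ^+ 2)) <= _).
  by rewrite ler_wpM2l// ler_sum.
rewrite big_split mulrDr /=; apply: lerD; last first.
  rewrite -mulr_sumr mulrCA ler_wpM2l// /avg -mulr_sumr ler_wpM2l//.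
  rewrite exchange_big /=; apply: ler_sum => V _.
  by rewrite [leRHS]cells.
rewrite -mulr_sumr mulrCA ler_wpM2l ?mulr_ge0 ?sqr_ge0//.
rewrite mulr_sumr (eq_bigr (fun p => q p * ln (q p)^-1)); last first.
  by move=> p _; rewrite /q; ring.
apply: sum_entropy_le => //; first by move=> p; rewrite divr_ge0.
rewrite -mulr_suml ler_pdivrMr// mul1r.
have -> : #|X|%:R = \sum_(x : X) 1 :> R by rewrite sumr_const.
rewrite cells; apply: ler_sum => p _.
rewrite -sumr_const [leRHS]big_mkcond [leLHS]big_mkcond.
by apply: ler_sum => x _; rewrite !inE; case: (rho x == p); case: good.
Qed.

(** The contribution of atypical blocks, by moments of the likelihood ratio. *)
Lemma message_bound_explicit (P : finType) (rho : X -> P) (K : nat) :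
  (0 < K)%N -> (#|[set rho x | x in X]| <= K)%N ->
  \sum_V avg (fun x => cavg [pred y | rho y == rho x] (fun y => M y V) ^+ 2) <=
  40 * lam ^+ 2 * G * (ln K%:R + 1) +
  2 * #|I|%:R * Num.sqrt ((1 + expR (7 * lam ^+ 2 * (sz r)%:R)) *
    ((sz r)%:R * (#|I|%:R * (2 * expR (- (B ^+ 2 / 5)))))).
Proof.
move=> K0 SK; apply: le_trans (message_bound K0 SK) _.
rewrite lerD2l -mulrA ler_wpM2l// mulr_natl -sumr_const; apply: ler_sum => V _.
rewrite (le_trans (ler_norm _))// -sqrtr_sqr ler_wsqrtr//.
apply: le_trans (avg_CauchySchwarz _ _) _.
rewrite mulrC; apply: ler_pM.
- by apply: avg_ge0 => x; rewrite sqr_ge0.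
- by apply: avg_ge0 => x; rewrite sqr_ge0.
- under eq_avg do rewrite -exprM.
  by apply: avg_lr4 => // i.
- under eq_avg do rewrite expr2 -natrM mulnb andbb.
  by apply: bad_prob => //; rewrite (lt_le_trans ltr01).
Qed.

End partition.

(** * The Gram form of independent sign vectors *)

Section gram.
Variables (R : realType) (I Om : finType) (y : I -> Om -> R).
Hypothesis Om0 : (0 < #|Om|)%N.
Hypothesis y2 : forall V o, y V o * y V o = 1.
Hypothesis orth : forall V W, avg (fun o => y V o * y W o) = (V == W)%:R.
Local Notation D := (#|I|%:R : R).

Implicit Types S Z : I -> I -> R.
Definition sqk S V W : R := \sum_U S V U * S U W.
Definition frob2 S : R := \sum_V \sum_W S V W ^+ 2.

(** For symmetric matrices, the squared Frobenius norm of S Z is the trace of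
    S^2 Z^2. *)
Lemma sum_sqr_kmul S Z : (forall V W, S V W = S W V) -> (forall V W, Z V W = Z W V) ->
  \sum_V \sum_W (\sum_U S V U * Z U W) ^+ 2 =
  \sum_U \sum_U' sqk S U U' * sqk Z U U'.
Proof.
move=> Ss Zs.
transitivity (\sum_V \sum_W \sum_U \sum_U' (S U V * S V U') * (Z U W * Z W U')).
  apply: eq_bigr => V _; apply: eq_bigr => W _; rewrite expr2 big_distrlr /=.
  apply: eq_bigr => U _; apply: eq_bigr => U' _.
  by rewrite (Ss V U) (Zs W U'); ring.
under eq_bigr do rewrite exchange_big /=.
rewrite exchange_big /=; apply: eq_bigr => U _.
under eq_bigr do rewrite exchange_big /=.
rewrite exchange_big /=; apply: eq_bigr => U' _.
by rewrite /sqk big_distrlr.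
Qed.

(** Fourth moment of a sum of independent centred symmetric kernels: among the
    mixed terms, those that contain one of the two kernels an odd number of
    times vanish on average. *)
Lemma fourth_moment_step (T : finType) (S : T -> I -> I -> R) (Z : Om -> I -> I -> R) :
  (forall s V W, S s V W = S s W V) -> (forall o V W, Z o V W = Z o W V) ->
  (forall V W, avg (fun s => S s V W) = 0) ->
  (forall V W, avg (fun o => Z o V W) = 0) -> (0 < #|T|)%N ->
  avg (fun s => avg (fun o => frob2 (sqk (fun V W => Z o V W + S s V W)))) <=
  avg (fun s => frob2 (sqk (S s))) + avg (fun o => frob2 (sqk (Z o))) +
  6 * avg (fun s => avg (fun o =>
     \sum_U \sum_U' sqk (S s) U U' * sqk (Z o) U U')).
Proof.
move=> Ss Zs S0 Z0 T0.
pose X s o V W := \sum_U S s V U * Z o U W + \sum_U Z o V U * S s U W.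
pose C s o := \sum_U \sum_U' sqk (S s) U U' * sqk (Z o) U U'.
have pt s o : frob2 (sqk (fun V W => Z o V W + S s V W)) <=
    frob2 (sqk (S s)) + frob2 (sqk (Z o)) + 6 * C s o +
    2 * (\sum_V \sum_W sqk (S s) V W * X s o V W +
         \sum_V \sum_W X s o V W * sqk (Z o) V W).
  have C1 := sum_sqr_kmul (Ss s) (Zs o).
  have C2 := sum_sqr_kmul (Zs o) (Ss s).
  have C2' : \sum_V \sum_W (\sum_U Z o V U * S s U W) ^+ 2 = C s o.
    rewrite C2; apply: eq_bigr => U _; apply: eq_bigr => U' _; exact: mulrC.
  have -> : 6 * C s o = 2 * C s o +
     (2 * \sum_V \sum_W (\sum_U S s V U * Z o U W) ^+ 2 +
      2 * \sum_V \sum_W (\sum_U Z o V U * S s U W) ^+ 2).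
    by rewrite C2' C1 /C; ring.
  rewrite /C /frob2 !mulrDr !mulr_sumr -!big_split /=; apply: ler_sum => V _.
  rewrite !mulr_sumr -!big_split /=; apply: ler_sum => W _.
  have -> : sqk (fun V W => Z o V W + S s V W) V W =
     sqk (S s) V W + X s o V W + sqk (Z o) V W.
    rewrite /sqk /X -!big_split; apply: eq_bigr => U _ /=; ring.
  rewrite /X; set P := \sum_U S s V U * Z o U W; set Q := \sum_U Z o V U * S s U W.
  by have := sqr_ge0 (P - Q); rewrite sqrrB; nra.
apply: le_trans (le_avg (fun s => le_avg (pt s))) _.
have OmE c : avg (fun _ : Om => c) = c by rewrite avg_cst.
have TE c : avg (fun _ : T => c) = c by rewrite avg_cst.
under eq_avg do rewrite !avgD OmE !avgZl avgD.
rewrite !avgD !avgZl TE avgD.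
have -> : avg (fun s => avg (fun o => \sum_V \sum_W sqk (S s) V W * X s o V W)) = 0.
  under eq_avg => s.
    rewrite avg_sum big1 => [|V _]; first over.
    rewrite avg_sum big1// => W _; rewrite avgZl /X avgD !avg_sum !big1 ?addr0 ?mulr0//.
      by move=> U _; rewrite avgZr Z0 mul0r.
    by move=> U _; rewrite avgZl Z0 mulr0.
  by rewrite avg0.
have -> : avg (fun s => avg (fun o => \sum_V \sum_W X s o V W * sqk (Z o) V W)) = 0.
  rewrite avg_exchange; under eq_avg => o.
    rewrite avg_sum big1 => [|V _]; first over.
    rewrite avg_sum big1// => W _; rewrite avgZr /X avgD !avg_sum !big1 ?addr0 ?mul0r//.
      by move=> U _; rewrite avgZl S0 mulr0.
    by move=> U _; rewrite avgZr S0 mul0r.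
  by rewrite avg0.
by rewrite addr0 mulr0 addr0 /C.
Qed.

(** The deviation of the rank-one Gram matrix of one sign vector from its mean,
    the identity. *)
Definition gk (o : Om) V W : R := y V o * y W o - (V == W)%:R.

Definition gram_dev n (s : {ffun 'I_n -> Om}) V W : R := \sum_i gk (s i) V W.

Lemma gkC o V W : gk o V W = gk o W V.
Proof. by rewrite /gk mulrC eq_sym. Qed.

Lemma avg_gk V W : avg (fun o => gk o V W) = 0.
Proof. by rewrite avgB orth avg_cst// subrr. Qed.

Lemma y_norm V o : `|y V o| = 1.
Proof. by apply/eqP; rewrite -sqr_norm_eq1 expr2 y2. Qed.

Lemma gk_norm o V W : `|gk o V W| <= 1.
Proof.
rewrite /gk; have [->|n] := eqVneq V W; first by rewrite y2 subrr normr0.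
by rewrite subr0 normrM !y_norm mul1r.
Qed.

Lemma frob2_sqk_gk o : frob2 (sqk (gk o)) <= D ^+ 4.
Proof.
have -> : D ^+ 4 = \sum_(V : I) \sum_(W : I) D ^+ 2.
  by rewrite !sumr_const -mulrnA -[RHS]mulr_natr natrM; ring.
apply: ler_sum => V _; apply: ler_sum => W _.
rewrite -[leLHS]real_normK ?num_real// lerXn2r ?nnegrE//.
rewrite /sqk (le_trans (ler_norm_sum _ _ _))// -sumr_const ler_sum// => U _.
by rewrite normrM mulr_ile1 ?gk_norm.
Qed.

Lemma avg_sqk_gk U U' : avg (fun o => sqk (gk o) U U') = (D - 1) * (U == U')%:R.
Proof.
have -> : avg (fun o => sqk (gk o) U U') =
    avg (fun o => (D - 2) * (y U o * y U' o) + (U == U')%:R).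
  apply: eq_avg => o; rewrite /sqk /gk.
  rewrite (eq_bigr (fun W => y U o * y U' o + (W == U')%:R * ((U == U')%:R - y U o * y U' o)
     + (W == U)%:R * (- (y U o * y U' o)))); last first.
    move=> W _; have yW := y2 W o; have yU := y2 U o; rewrite [W == U]eq_sym.
    have [<-|UW] := eqVneq U W.
      have [<-|_] := eqVneq U U'; first by ring: yU.
      by rewrite mulr1n mulr0n; ring: yU.
    have [<-|WU'] := eqVneq W U'.
      by rewrite (negbTE UW) mulr1n mulr0n; ring: yW.
    by rewrite mulr0n; ring: yW.
  rewrite !big_split /= -!mulr_suml sumr_const.
  have d1 V : \sum_W (W == V)%:R = 1 :> R.
    by rewrite (bigD1 V)//= eqxx big1 ?addr0// => W /negbTE->.
  by rewrite !d1 -[_ *+ _]mulr_natl; ring.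
by rewrite avgD avgZl orth avg_cst//; ring.
Qed.

Lemma avg_frob2_gk : avg (fun o => frob2 (gk o)) <= D ^+ 2.
Proof.
apply: avg_le_cst => // o; rewrite /frob2.
have -> : D ^+ 2 = \sum_(V : I) \sum_(W : I) 1.
  by rewrite !sumr_const -mulrnA natrM expr2.
apply: ler_sum => V _; apply: ler_sum => W _.
by rewrite -[leLHS]real_normK ?num_real// exprn_ile1 ?gk_norm.
Qed.

Lemma card_sgt0 n : (0 < #|{ffun 'I_n -> Om}|)%N.
Proof. by rewrite card_ffun expn_gt0 Om0. Qed.

Lemma gram_devS n (a : {ffun 'I_1 -> Om}) (s : {ffun 'I_n -> Om}) V W :
  gram_dev (fjoin a s) V W = gk (a ord0) V W + gram_dev s V W.
Proof.
rewrite /gram_dev big_split_ord /= big_ord1 fjoinl; congr (_ + _).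
by apply: eq_bigr => i _; rewrite fjoinr.
Qed.

Lemma avg_gram_dev n V W : avg (fun s : {ffun 'I_n -> Om} => gram_dev s V W) = 0.
Proof.
rewrite avg_sum big1// => i _.
by rewrite (avg_coord i (fun o => gk o V W))// avg_gk.
Qed.

Lemma gram_devC n (s : {ffun 'I_n -> Om}) V W : gram_dev s V W = gram_dev s W V.
Proof. by apply: eq_bigr => i _; rewrite gkC. Qed.

Lemma avg_fjoin1 n (f : {ffun 'I_n.+1 -> Om} -> R) (g : {ffun 'I_n -> Om} -> Om -> R) :
  (forall a s, f (fjoin a s : {ffun 'I_(1 + n) -> Om}) = g s (a ord0)) ->
  avg f = avg (fun s => avg (g s)).
Proof.
move=> fg; rewrite (avg_fjoin (a := 1) (b := n)) avg_exchange; apply: eq_avg => s.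
by under eq_avg do rewrite fg; rewrite (avg_coord ord0 (g s)).
Qed.

Lemma second_moment n :
  avg (fun s : {ffun 'I_n -> Om} => frob2 (gram_dev s)) <= n%:R * D ^+ 2.
Proof.
elim: n => [|n IH].
  rewrite mul0r (eq_avg (g := fun=> 0)) ?avg0// => s.
  by rewrite /frob2 big1// => V _; rewrite big1// => W _; rewrite /gram_dev big_ord0 expr0n.
rewrite (avg_fjoin1 (g := fun s o => frob2 (fun V W => gk o V W + gram_dev s V W)));
  last first.
  move=> a s; rewrite /frob2; apply: eq_bigr => V _; apply: eq_bigr => W _.
  by rewrite gram_devS.
have -> : avg (fun s : {ffun 'I_n -> Om} =>
    avg (fun o => frob2 (fun V W => gk o V W + gram_dev s V W))) =
    avg (fun s : {ffun 'I_n -> Om} => frob2 (gram_dev s)) + avg (fun o => frob2 (gk o)).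
  have E s o : frob2 (fun V W => gk o V W + gram_dev s V W) =
      frob2 (@gram_dev n s) + frob2 (gk o) +
      2 * \sum_V \sum_W gk o V W * gram_dev s V W.
    rewrite /frob2 mulr_sumr -!big_split /=; apply: eq_bigr => V _.
    rewrite mulr_sumr -!big_split /=; apply: eq_bigr => W _; ring.
  have E0 s : avg (fun o => \sum_V \sum_W gk o V W * @gram_dev n s V W) = 0.
    rewrite avg_sum big1// => V _; rewrite avg_sum big1// => W _.
    by rewrite avgZr avg_gk mul0r.
  rewrite (eq_avg (g := fun s => frob2 (@gram_dev n s) + avg (fun o => frob2 (gk o)))).
    by rewrite avgD avg_cst// card_sgt0.
  move=> s; rewrite (eq_avg (E s)) !avgD avg_cst// avgZl E0.
  by rewrite mulr0 addr0.
rewrite -[n.+1%:R]natr1 mulrDl mul1r; apply: lerD => //; exact: avg_frob2_gk.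
Qed.

(** In the bound, n^2 D^3 comes from pairs of distinct vectors, and n D^4 from
    each vector alone. *)
Lemma fourth_moment n : avg (fun s : {ffun 'I_n -> Om} => frob2 (sqk (gram_dev s))) <=
  3 * n%:R ^+ 2 * D ^+ 3 + n%:R * D ^+ 4.
Proof.
elim: n => [|n IH].
  rewrite expr0n mulr0 mul0r mul0r addr0 (eq_avg (g := fun=> 0)) ?avg0// => s.
  rewrite /frob2 big1// => V _; rewrite big1// => W _.
  by rewrite /sqk big1 ?expr0n// => U _; rewrite /gram_dev big_ord0 mul0r.
rewrite (avg_fjoin1 (g := fun s o => frob2 (sqk (fun V W => gk o V W + gram_dev s V W))));
  last first.
  move=> a s; rewrite /frob2; apply: eq_bigr => V _; apply: eq_bigr => W _.
  by congr (_ ^+ 2); apply: eq_bigr => U _; rewrite !gram_devS.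
apply: le_trans (fourth_moment_step (@gram_devC n) gkC (@avg_gram_dev n) avg_gk
  (card_sgt0 n)) _.
have -> : avg (fun s : {ffun 'I_n -> Om} => avg (fun o =>
    \sum_U \sum_U' sqk (gram_dev s) U U' * sqk (gk o) U U')) =
    (D - 1) * avg (fun s : {ffun 'I_n -> Om} => frob2 (gram_dev s)).
  rewrite -avgZl; apply: eq_avg => s.
  rewrite avg_sum /frob2 mulr_sumr; apply: eq_bigr => U _.
  rewrite avg_sum (bigD1 U)//= big1 ?addr0 => [|U' UU']; last first.
    by rewrite avgZl avg_sqk_gk eq_sym (negbTE UU') !mulr0.
  rewrite avgZl avg_sqk_gk eqxx mulr1 mulrC /sqk; congr (_ * _).
  by apply: eq_bigr => W _; rewrite (gram_devC s W U) expr2.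
have f4 : avg (fun o => frob2 (sqk (gk o))) <= D ^+ 4.
  by apply: avg_le_cst => // o; exact: frob2_sqk_gk.
have f2 := second_moment n.
have [I0|I0] := posnP #|I|.
  move: IH f4; rewrite I0.
  have -> : avg (fun s : {ffun 'I_n -> Om} => frob2 (gram_dev s)) = 0.
    rewrite (eq_avg (g := fun=> 0)) ?avg0// => s.
    by rewrite /frob2 big1// => V; have := card0_eq I0 V; rewrite inE.
  move: (avg _) (avg _) => A1 A2; rewrite !expr0n /= !mulr0 addr0; lra.
have D1 : 1 <= D by rewrite ler1n.
have m0 : 0 <= avg (fun s : {ffun 'I_n -> Om} => frob2 (gram_dev s)).
  apply: avg_ge0 => s; apply: sumr_ge0 => V _; apply: sumr_ge0 => W _; exact: sqr_ge0.
have : (D - 1) * avg (fun s : {ffun 'I_n -> Om} => frob2 (gram_dev s)) <=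
  D * (n%:R * D ^+ 2) by apply: ler_pM => //; lra.
have D30 : 0 <= D ^+ 3 by rewrite exprn_ge0.
move: (avg _) (avg _) IH f4 => A1 A2; rewrite -[n.+1%:R]natr1; move: (avg _) => A3.
have -> : D * (n%:R * D ^+ 2) = n%:R * D ^+ 3 by ring.
have -> : 3 * (n%:R + 1) ^+ 2 * D ^+ 3 =
   3 * n%:R ^+ 2 * D ^+ 3 + 6 * (n%:R * D ^+ 3) + 3 * D ^+ 3 by ring.
lra.
Qed.

(** The bound on the Gram form is polynomial in the signs, so that it can be
    averaged; it comes from x <= n + x^4 / n^3 applied to the quadratic form of
    the deviation from n times the identity. *)
Definition gram_bound n (s : {ffun 'I_n -> Om}) : R :=
  2 * n%:R + frob2 (sqk (gram_dev s)) / n%:R ^+ 3.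

Lemma frob2_ge0 S : 0 <= frob2 S.
Proof. by apply: sumr_ge0 => V _; apply: sumr_ge0 => W _; exact: sqr_ge0. Qed.

Lemma gram_bound_ge0 n (s : {ffun 'I_n -> Om}) : 0 <= gram_bound s.
Proof. by rewrite addr_ge0 ?divr_ge0 ?frob2_ge0// exprn_ge0. Qed.

(** For q the quadratic form of the deviation S at b, two applications of
    Cauchy-Schwarz give q^4 <= |b|^8 |S^2|^2, in Frobenius norm. *)
Lemma gram_boundP n (s : {ffun 'I_n -> Om}) : (0 < n)%N ->
  gram_le (fun i V => y V (s i)) (gram_bound s).
Proof.
move=> n0 b; set be := \sum_V b V ^+ 2; set F := frob2 (sqk (gram_dev s)).
have be0 : 0 <= be by exact: sumsq_ge0.
have F0 : 0 <= F by exact: frob2_ge0.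
pose Sb V := \sum_W gram_dev s V W * b W.
pose q := \sum_V b V * Sb V.
have -> : \sum_i (\sum_V b V * y V (s i)) ^+ 2 = n%:R * be + q.
  have -> : n%:R * be = \sum_V \sum_W \sum_(i < n) b V * b W * (V == W)%:R.
    rewrite mulr_sumr; apply: eq_bigr => V _.
    rewrite (bigD1 V)//= [X in _ = _ + X]big1 ?addr0 => [|W WV]; last first.
      by rewrite big1// => i _; rewrite eq_sym (negbTE WV) mulr0.
    by rewrite sumr_const card_ord eqxx mulr1 -[RHS]mulr_natl expr2.
  rewrite /q /Sb; under [in X in _ + X]eq_bigr do rewrite mulr_sumr.
  rewrite -big_split /=.
  under eq_bigr do rewrite expr2 big_distrlr /=.
  rewrite exchange_big /=; apply: eq_bigr => V _.
  rewrite -big_split exchange_big /=; apply: eq_bigr => W _.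
  rewrite /gram_dev mulr_suml mulr_sumr -big_split; apply: eq_bigr => i _.
  by rewrite /gk /=; ring.
have q2 : q ^+ 2 <= be * \sum_V Sb V ^+ 2 by exact: sum_CauchySchwarz.
have Sb2 : (\sum_V Sb V ^+ 2) ^+ 2 <= be ^+ 2 * F.
  have -> : \sum_V Sb V ^+ 2 = \sum_p (b p.1 * b p.2) * sqk (gram_dev s) p.1 p.2.
    rewrite -(pair_bigA _ (fun W W' => b W * b W' * sqk (gram_dev s) W W')) /=.
    transitivity (\sum_V \sum_W \sum_W' b W * b W' * (gram_dev s W V * gram_dev s V W')).
      apply: eq_bigr => V _; rewrite expr2 big_distrlr /=.
      apply: eq_bigr => W _; apply: eq_bigr => W' _.
      by rewrite (gram_devC s V W); ring.
    rewrite exchange_big /=; apply: eq_bigr => W _.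
    by rewrite exchange_big /=; apply: eq_bigr => W' _; rewrite /sqk mulr_sumr.
  apply: le_trans (sum_CauchySchwarz _ _ _) _.
  rewrite -(pair_bigA _ (fun W W' => (b W * b W') ^+ 2)).
  rewrite -(pair_bigA _ (fun W W' => sqk (gram_dev s) W W' ^+ 2)) /= -/F.
  rewrite ler_wpM2r// expr2 big_distrlr /=.
  by apply: ler_sum => W _; apply: ler_sum => W' _; rewrite exprMn.
have q4 : q ^+ 4 <= be ^+ 4 * F.
  have -> : q ^+ 4 = q ^+ 2 * q ^+ 2 by ring.
  apply: le_trans (ler_pM (sqr_ge0 _) (sqr_ge0 _) q2 q2) _.
  have -> (c : R) : be * c * (be * c) = be ^+ 2 * c ^+ 2 by ring.
  have -> : be ^+ 4 * F = be ^+ 2 * (be ^+ 2 * F) by ring.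
  by rewrite ler_wpM2l ?sqr_ge0.
have nR : 0 < n%:R :> R by rewrite ltr0n.
rewrite /gram_bound -/F.
suff : q <= n%:R * be + F / n%:R ^+ 3 * be by lra.
have Fn0 : 0 <= F / n%:R ^+ 3 * be by rewrite !mulr_ge0 ?invr_ge0 ?exprn_ge0.
have [qn|nq] := leP q (n%:R * be); first by lra.
have [b0|bn] := eqVneq be 0.
  move: q4 nq; rewrite b0 expr0n !mul0r mulr0 => q4 q0.
  by have := exprn_gt0 4 q0; rewrite ltNge q4.
have bp : 0 < be by rewrite lt_neqAle eq_sym bn.
have nb : 0 < n%:R * be by rewrite mulr_gt0.
have : q * (n%:R * be) ^+ 3 <= be ^+ 4 * F.
  have q0 : 0 <= q := ltW (lt_trans nb nq).
  by apply: le_trans q4; rewrite [leRHS]exprS ler_wpM2l// lerXn2r// ?nnegrE// ltW.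
move=> q3; apply: le_trans (_ : F / n%:R ^+ 3 * be <= _); last first.
  by rewrite lerDr ltW.
rewrite -(ler_pM2r (exprn_gt0 3 nb)) (le_trans q3)// le_eqVlt; apply/orP; left.
by apply/eqP; field; rewrite gt_eqF.
Qed.

(** The fourth moment stays of order n^4, as it should for a Gram matrix close
    to n times the identity, as soon as n^2 reaches D^3. *)
Lemma avg_gram_bound n : (0 < n)%N -> D ^+ 3 <= n%:R ^+ 2 -> D <= n%:R ->
  avg (fun s : {ffun 'I_n -> Om} => gram_bound s) <= 6 * n%:R.
Proof.
move=> n0 Dn Dn1; have nR : 0 < n%:R :> R by rewrite ltr0n.
rewrite /gram_bound avgD [X in _ + X]avgZr avg_cst ?card_sgt0//.
suff : avg (fun s : {ffun 'I_n -> Om} => frob2 (sqk (gram_dev s))) / n%:R ^+ 3 <=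
  4 * n%:R by lra.
rewrite ler_pdivrMr ?exprn_gt0//; apply: le_trans (fourth_moment n) _.
have D0 : 0 <= D by rewrite ler0n.
have : n%:R ^+ 2 * D ^+ 3 <= n%:R ^+ 2 * n%:R ^+ 2 by rewrite ler_wpM2l ?sqr_ge0.
have : n%:R * (D * D ^+ 3) <= n%:R * (n%:R * n%:R ^+ 2).
  by rewrite ler_wpM2l ?ler0n//; apply: ler_pM; rewrite ?exprn_ge0.
have -> : D ^+ 4 = D * D ^+ 3 by ring.
have -> : 4 * n%:R * n%:R ^+ 3 = 4 * (n%:R ^+ 2 * n%:R ^+ 2) :> R by ring.
have -> : n%:R * (n%:R * n%:R ^+ 2) = n%:R ^+ 2 * n%:R ^+ 2 :> R by ring.
lra.
Qed.

End gram.

(** * Distinguishing from a transcript with product structure *)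

Section rectangle.
Variable R : realType.

(** A product of factors close to one is bounded below by its first-order
    expansion; a factor far from one is charged to its squared deviation. *)
Lemma one_sub_prod_le m (de : 'I_m -> R) (u : R) : 0 <= u <= 1 ->
  (forall j, 0 <= 1 + de j) ->
  u * (1 - \prod_j (1 + de j)) <= 6 * (\sum_j de j ^+ 2) + `|\sum_j de j|.
Proof.
move=> /andP[u0 u1] de0; have p0 : 0 <= \prod_j (1 + de j) by apply: prodr_ge0.
have s0 : 0 <= \sum_j de j ^+ 2 by apply: sumr_ge0 => j _; exact: sqr_ge0.
have [/forallP all12|] := boolP [forall j, - (1 / 2) <= de j]; last first.
  rewrite negb_forall => /existsP[j]; rewrite -ltNge => dj.
  have : 1 / 4 <= \sum_j de j ^+ 2.
    rewrite (bigD1 j)//= ler_wpDr//; last by nra.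
    by apply: sumr_ge0 => i _; exact: sqr_ge0.
  by have := normr_ge0 (\sum_j de j); nra.
have : 1 + (\sum_j de j - 2 * \sum_j de j ^+ 2) <= \prod_j (1 + de j).
  apply: le_trans (expR_ge1Dx _) _.
  rewrite mulr_sumr -sumrB expR_sum ler_prod// => j _.
  by rewrite expR_ge0 expR_sub_sqr_le.
have := ler_norm (- \sum_j de j); rewrite normrN.
have := normr_ge0 (\sum_j de j); nra.
Qed.

Lemma cavg_cardM (T : finType) (A : pred T) (f : T -> R) :
  #|A|%:R * cavg A f = \sum_(x | A x) f x.
Proof.
rewrite /cavg mulrA; have [A0|A0] := posnP #|A|.
  rewrite A0 mul0r mul0r big1// => x Ax.
  by have : A x = false := card0_eq A0 x; rewrite Ax.
by rewrite divff ?mul1r// pnatr_eq0 -lt0n.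
Qed.

Lemma cavg_cst (T : finType) (A : pred T) (x : T) (c : R) : A x ->
  cavg A (fun=> c) = c.
Proof.
move=> Ax; rewrite /cavg sumr_const -[c *+ _]mulr_natl mulKf// pnatr_eq0 -lt0n.
by apply/card_gt0P; exists x.
Qed.

Lemma cavgB1 (T : finType) (A : pred T) (x : T) (f : T -> R) : A x ->
  cavg A f = 1 + cavg A (fun y => f y - 1).
Proof.
move=> Ax; rewrite {2}/cavg sumrB mulrBr -/(cavg A f) -/(cavg A (fun=> 1)).
by rewrite (cavg_cst 1 Ax) addrC subrK.
Qed.

Variables (m : nat) (X P : finType) (pi : {ffun 'I_m -> X} -> P).
Variable Rg : P -> 'I_m -> pred X.
Hypothesis X0 : (0 < #|X|)%N.
Hypothesis rectangle : forall x p, (pi x == p) = [forall j, Rg p j (x j)].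

Lemma Rg_pi x j : Rg (pi x) j (x j).
Proof. by have := rectangle x (pi x); rewrite eqxx => /esym/forallP. Qed.

Lemma sum_fiber (g : 'I_m -> X -> R) p :
  \sum_(x | pi x == p) \prod_j g j (x j) = \prod_j \sum_(y | Rg p j y) g j y.
Proof.
rewrite bigA_distr_big_dep; apply: eq_bigl => x; rewrite rectangle.
by apply/forallP/familyP => h j; have := h j.
Qed.

(** Given the transcript the inputs remain independent, so a product averages
    to the product of its conditional averages. *)
Lemma avg_fiber (c : P -> R) (g : 'I_m -> X -> R) :
  avg (fun x => c (pi x) * \prod_j g j (x j)) =
  avg (fun x => c (pi x) * \prod_j cavg (Rg (pi x) j) (g j)).
Proof.
rewrite /avg; congr (_ * _).
rewrite (partition_big pi predT)//= [RHS](partition_big pi predT)//=.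
apply: eq_bigr => p _.
under eq_bigr => x /eqP-> do over.
under [RHS]eq_bigr => x /eqP-> do over.
rewrite -mulr_sumr sum_fiber sumr_const -[RHS]mulr_natl mulrCA; congr (_ * _).
have -> : #|[pred x | pi x == p]|%:R = \prod_j #|Rg p j|%:R :> R.
  transitivity (\sum_(x | pi x == p) \prod_(j < m) 1 : R).
    by rewrite -sumr_const; apply: eq_bigr => x _; rewrite big1.
  by rewrite (sum_fiber (fun _ _ => 1)); apply: eq_bigr => j _; rewrite sumr_const.
by rewrite -big_split /=; apply: eq_bigr => j _; rewrite cavg_cardM.
Qed.

Variable L : 'I_m -> X -> R.
Hypothesis L0 : forall j y, 0 <= L j y.
Hypothesis L1 : forall j, avg (L j) = 1.

Definition dev p j : R := cavg (Rg p j) (fun y => L j y - 1).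

Lemma dev_ge x j : 0 <= 1 + dev (pi x) j.
Proof.
rewrite -(cavgB1 _ (Rg_pi x j)); apply: mulr_ge0; first by rewrite invr_ge0.
by apply: sumr_ge0.
Qed.

Lemma avg_prod_dev (c : P -> R) : avg (fun x => c (pi x) * \prod_j L j (x j)) =
  avg (fun x => c (pi x) * \prod_j (1 + dev (pi x) j)).
Proof.
rewrite avg_fiber; apply: eq_avg => x; congr (_ * _).
by apply: eq_bigr => j _; rewrite (cavgB1 _ (Rg_pi x j)).
Qed.

(** By [avg_fiber] the product of the two deviations has the average of
    (L_i - 1)(L_j - 1), in which the inputs i and j are independent. *)
Lemma dev_orthogonal i j : i != j -> avg (fun x => dev (pi x) i * dev (pi x) j) = 0.
Proof.
move=> ij; pose g l y := if (l == i) || (l == j) then L l y - 1 else 1.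
transitivity (avg (fun x : {ffun 'I_m -> X} => 1 * \prod_l g l (x l))).
  rewrite (avg_fiber (fun=> 1)); apply: eq_avg => x; rewrite mul1r.
  rewrite (bigD1 i)//= (bigD1 j)/=; last by rewrite eq_sym.
  rewrite big1 => [|l /andP[li lj]].
    by rewrite mulr1 /g /dev !eqxx /= orbT.
  by rewrite /g (negbTE li) (negbTE lj)/= (cavg_cst 1 (Rg_pi x l)).
rewrite avgZl mul1r avg_ffun_prod (bigD1 i)//= /g eqxx /= avgB L1.
by rewrite avg_cst// subrr mul0r.
Qed.

Lemma avg_sqr_sum_dev : avg (fun x => (\sum_j dev (pi x) j) ^+ 2) =
  \sum_j avg (fun x => dev (pi x) j ^+ 2).
Proof.
transitivity (avg (fun x => \sum_i \sum_j dev (pi x) i * dev (pi x) j)).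
  by apply: eq_avg => x; rewrite expr2 big_distrlr.
rewrite avg_sum; apply: eq_bigr => i _; rewrite avg_sum (bigD1 i)//=.
by rewrite big1 ?addr0// => j ji; rewrite dev_orthogonal// eq_sym.
Qed.

(** Both laws have total mass one, so the difference is the average of
    (1 - c)(1 - prod (1 + dev)), to which [one_sub_prod_le] applies; the sum of
    the deviations is small in L^2 because they are orthogonal. *)
Lemma transcript_distance (c : P -> R) : (forall p, 0 <= c p <= 1) ->
  avg (fun x => c (pi x) * \prod_j L j (x j)) <= avg (fun x => c (pi x)) +
  (6 * (\sum_j avg (fun x => dev (pi x) j ^+ 2)) +
   Num.sqrt (\sum_j avg (fun x => dev (pi x) j ^+ 2))).
Proof.
move=> c01; have XX : (0 < #|{ffun 'I_m -> X}|)%N by rewrite card_ffun expn_gt0 X0.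
have tot : avg (fun x => 1 * \prod_j (1 + dev (pi x) j)) = 1.
  rewrite -(avg_prod_dev (fun=> 1)) avgZl mul1r avg_ffun_prod big1// => j _; exact: L1.
rewrite avg_prod_dev -lerBlDl.
have -> : avg (fun x => c (pi x) * \prod_j (1 + dev (pi x) j)) - avg (fun x => c (pi x)) =
    avg (fun x => (1 - c (pi x)) * (1 - \prod_j (1 + dev (pi x) j))).
  have {1}-> : avg (fun x => c (pi x)) = 1 - avg (fun x => 1 - c (pi x)).
    by rewrite avgB avg_cst//; ring.
  rewrite -[X in _ - (X - _)]tot -!avgB; apply: eq_avg => x; ring.
apply: le_trans (_ : avg (fun x => 6 * (\sum_j dev (pi x) j ^+ 2) +
    `|\sum_j dev (pi x) j|) <= _).
  apply: le_avg => x; apply: one_sub_prod_le; last by move=> j; exact: dev_ge.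
  by have := c01 (pi x); lra.
rewrite avgD avgZl avg_sum lerD2l (le_trans (avg_le_sqrt _))// ler_wsqrtr//.
under eq_avg do rewrite real_normK ?num_real//.
by rewrite avg_sqr_sum_dev.
Qed.

(** With the other inputs fixed, the conditioning set of input j is the set of
    values that leave the transcript unchanged. *)
Lemma dev_resample j : avg (fun x => dev (pi x) j ^+ 2) =
  avg (fun x => avg (fun y => cavg [pred y' | pi (fupd x j y') == pi (fupd x j y)]
    (fun y' => L j y' - 1) ^+ 2)).
Proof.
rewrite (avg_resample j); apply: eq_avg => x; apply: eq_avg => y; congr (_ ^+ 2).
have RE y' : Rg (pi (fupd x j y)) j y' = (pi (fupd x j y') == pi (fupd x j y)).
  rewrite rectangle; apply/idP/forallP => [Ry i|/(_ j)]; rewrite ffunE.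
    have := Rg_pi (fupd x j y) i; rewrite ffunE.
    by case: eqP => [->//|//].
  by rewrite eqxx.
rewrite /dev /cavg (eq_bigl _ _ RE); congr (_%:R^-1 * _).
exact: eq_card.
Qed.

End rectangle.

(** * Passes over blocks of samples *)

Section protocol.
Variables (m' : nat) (X S : finType) (s0 : S) (T : nat).
Local Notation m := m'.+1.
Variable F : nat -> S -> X -> S.
Local Notation Q := (T * m)%N.

Definition blk (q : nat) : 'I_m := inord (q %% m).

Fixpoint state (x : {ffun 'I_m -> X}) (q : nat) : S :=
  if q is q'.+1 then F q' (state x q') (x (blk q')) else s0.

Definition transcript (x : {ffun 'I_m -> X}) : {ffun 'I_Q -> S} :=
  [ffun q : 'I_Q => state x q.+1].

Definition before (p : {ffun 'I_Q -> S}) (q : nat) : S :=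
  if q is q'.+1 then oapp p s0 (insub q') else s0.

Definition compatible (p : {ffun 'I_Q -> S}) (j : 'I_m) : pred X :=
  fun y => [forall q : 'I_Q, (blk q == j) ==> (F q (before p q) y == p q)].

Lemma before_transcript x q : (q <= Q)%N -> before (transcript x) q = state x q.
Proof. by case: q => //= q qQ; rewrite insubT /= ffunE. Qed.

(** Once the messages are prescribed, whether step q produces the right one
    depends only on the block that is read at step q. *)
Lemma transcript_rectangle x p :
  (transcript x == p) = [forall j, compatible p j (x j)].
Proof.
apply/eqP/forallP => [<- j|comp].
  apply/forallP => q; apply/implyP => /eqP<-.
  by rewrite before_transcript 1?ltnW// ffunE.
have st q : (q <= Q)%N -> state x q = before p q.
  elim: q => //= q IH qQ; rewrite insubT /= IH 1?ltnW//.
  have /forallP/(_ (Ordinal qQ))/implyP := comp (blk q).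
  by move=> /(_ (eqxx _))/eqP.
by apply/ffunP => q; rewrite ffunE st//= valK.
Qed.

(** Block j speaks once per pass: the transcript is a function of its T
    messages once the other blocks are fixed. *)
Lemma transcript_count x j :
  (#|[set transcript (fupd x j y) | y in X]| <= #|S| ^ T)%N.
Proof.
pose f (p : {ffun 'I_Q -> S}) : {ffun 'I_T -> S} := [ffun t : 'I_T => before p (t * m + j).+1].
have lt_step (t : 'I_T) : (t * m + j < Q)%N.
  apply: (@leq_trans (t.+1 * m)%N); first by rewrite mulSn [X in (_ < X)%N]addnC ltn_add2l.
  by rewrite leq_pmul2r.
have f_inj : {in [set transcript (fupd x j y) | y in X] &, injective f}.
  move=> _ _ /imsetP[y _ ->] /imsetP[z _ ->] fyz.
  have agree q : (q <= Q)%N -> state (fupd x j y) q = state (fupd x j z) q.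
    elim: q => // q IH qQ; have [qj|qj] := eqVneq (blk q) j; last first.
      by rewrite /= IH 1?ltnW// !ffunE (negbTE qj).
    have qm : (q %% m)%N = j by rewrite -qj inordK// ltn_pmod.
    have qT : (q %/ m < T)%N by rewrite ltn_divLR.
    have := congr1 (fun g : {ffun 'I_T -> S} => g (Ordinal qT)) fyz.
    by rewrite !ffunE !before_transcript ?lt_step//= -qm -divn_eq.
  by apply/ffunP => q; rewrite !ffunE agree.
rewrite -(card_in_imset f_inj); apply: leq_trans (max_card _) _.
by rewrite card_ffun card_ord.
Qed.

End protocol.

(** * The finite estimation problem *)

Section finite_problem.
Variables (R : realType) (I Om : finType) (y : I -> Om -> R) (flip : bool -> Om -> Om).
Hypothesis Om0 : (0 < #|Om|)%N.
Hypothesis y2 : forall V o, y V o * y V o = 1.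
Hypothesis orth : forall V W, avg (fun o => y V o * y W o) = (V == W)%:R.
Hypothesis flipK : forall b, involutive (flip b).
Hypothesis y_flip : forall b V o, y V (flip b o) = sgb R b * y V o.
Variables (lam B : R) (r m' T : nat) (S : finType) (s0 : S).
Hypothesis lam0 : 0 <= lam.
Hypothesis lam12 : lam <= 1 / 2.
Hypothesis B1 : 1 <= B.
Hypothesis zr : 2 * r%:R * zeta lam B r <= 1.
Local Notation n := (sz r).
Local Notation m := m'.+1.
Local Notation Xs := {ffun 'I_n -> Om}.
Variable F : nat -> S -> Xs -> S.
Local Notation D := (#|I|%:R : R).
Local Notation fin s := (state s0 F s (T * m)).

Definition weight V (s : {ffun 'I_m -> Xs}) : R := \prod_j \prod_i (1 + lam * y V (s j i)).

Definition flips (e : {ffun 'I_m -> {ffun 'I_n -> bool}}) (s : {ffun 'I_m -> Xs})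
  : {ffun 'I_m -> Xs} := [ffun j => [ffun i => flip (e j i) (s j i)]].

Lemma flipsK e : involutive (flips e).
Proof.
by move=> s; apply/ffunP => j; rewrite !ffunE; apply/ffunP => i; rewrite !ffunE flipK.
Qed.

Lemma cubes_card_gt0 : (0 < #|{ffun 'I_m -> {ffun 'I_n -> bool}}|)%N.
Proof. by rewrite card_ffun expn_gt0 (cube_card_gt0 n). Qed.

(** A uniform point of the sample space is a uniform flip of a uniform point;
    given the latter only the bits e remain random. *)
Lemma avg_flips (f : {ffun 'I_m -> Xs} -> R) : avg f =
  avg (fun s : {ffun 'I_m -> Xs} => avg (fun e => f (flips e s))).
Proof.
rewrite avg_exchange -[LHS](@avg_cst _ _ _ cubes_card_gt0); apply: eq_avg => e.
by rewrite [RHS](avg_inj (s := flips e))//; exact: inv_inj (flipsK e).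
Qed.

(** The share of the atypical inputs of one block: B is the threshold, in
    standard deviations, beyond which a walk is atypical. *)
Definition atyp : R := 2 * D * Num.sqrt ((1 + expR (7 * lam ^+ 2 * n%:R)) *
    (n%:R * (D * (2 * expR (- (B ^+ 2 / 5)))))).

(** A bound on the sum over the m blocks, averaged over the index, of the
    squared deviations. *)
Definition info_bound : R := m%:R / D *
  (240 * lam ^+ 2 * n%:R * (ln (#|S| ^ T)%:R + 1) + atyp).

Lemma avg_sqrt_le (U : finType) (f : U -> R) : (forall x, 0 <= f x) ->
  avg (fun x => Num.sqrt (f x)) <= Num.sqrt (avg f).
Proof.
move=> f0; apply: le_trans (avg_le_sqrt _) _.
by rewrite (eq_avg (g := f))// => x; rewrite sqr_sqrtr.
Qed.

(** Given the patterns up to flips, [transcript_distance] applies to the cube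
    of flips for each V; [message_bound_explicit] bounds the squared deviations
    summed over V, with the Gram form of the patterns, which is then averaged
    by [avg_gram_bound].  The square root goes through the averages by
    concavity. *)
Lemma finite_risk_bound (c : I -> S -> R) : (forall V st, 0 <= c V st <= 1) ->
  D ^+ 3 <= n%:R ^+ 2 -> D <= n%:R -> (0 < #|I|)%N ->
  avg (fun V => avg (fun s => c V (fin s) * weight V s)) <=
  avg (fun V => avg (fun s : {ffun 'I_m -> Xs} => c V (fin s))) +
  (6 * info_bound + Num.sqrt info_bound).
Proof.
move=> c01 Dn3 Dn I0.
have S0 : (0 < #|S|)%N by apply/card_gt0P; exists s0.
have K0 : (0 < #|S| ^ T)%N by rewrite expn_gt0 S0.
have n0 : (0 < n)%N by rewrite szE expn_gt0.
have DR : 0 < D by rewrite ltr0n.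
pose w (s : {ffun 'I_m -> Xs}) j (i : 'I_n) V := y V (s j i).
pose L s V j (x : {ffun 'I_n -> bool}) := lr lam (w s j) x V.
pose F' (s : {ffun 'I_m -> Xs}) q st (x : {ffun 'I_n -> bool}) :=
  F q st [ffun i => flip (x i) (s (blk m' q) i)].
pose pi s x := transcript (m' := m') s0 T (F' s) x.
pose Rg s p j := compatible (m' := m') s0 (T := T) (F' s) p j.
have rect s x p : (pi s x == p) = [forall j, Rg s p j (x j)] by exact: transcript_rectangle.
pose Qd V s : R := \sum_j avg (fun x => dev (Rg s) (L s V) (pi s x) j ^+ 2).
have Qd0 V s : 0 <= Qd V s.
  by apply: sumr_ge0 => j _; apply: avg_ge0 => x; exact: sqr_ge0.
have w1 s j i V : w s j i V ^+ 2 = 1 by rewrite expr2 y2.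
have stE s e q : state s0 F (flips e s) q = state (m' := m') s0 (F' s) e q.
  by elim: q => //= q ->; rewrite /F' ffunE.
have weightE V s e : weight V (flips e s) = \prod_j L s V j (e j).
  apply: eq_bigr => j _; apply: eq_bigr => i _.
  by rewrite !ffunE y_flip.
have one V s : avg (fun e => c V (fin (flips e s)) * weight V (flips e s)) <=
    avg (fun e => c V (fin (flips e s))) + (6 * Qd V s + Num.sqrt (Qd V s)).
  have finE e : fin (flips e s) = before s0 (pi s e) (T * m).
    by rewrite stE /pi before_transcript.
  rewrite (eq_avg (g := fun e => c V (before s0 (pi s e) (T * m)) *
     \prod_j L s V j (e j))); last by move=> e; rewrite finE weightE.
  rewrite [in leRHS](eq_avg (g := fun e => c V (before s0 (pi s e) (T * m))));
     last by move=> e; rewrite finE.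
  apply: (@transcript_distance _ _ _ _ _ _ (cube_card_gt0 n) (rect s) (L s V) _ _
     (fun p => c V (before s0 p (T * m)))) => //.
  - by move=> j x; apply: lr_ge0 => // i; exact: w1.
  - by move=> j; apply: avg_lr => i; exact: w1.
have blockQ s j : \sum_V avg (fun x => dev (Rg s) (L s V) (pi s x) j ^+ 2) <=
    40 * lam ^+ 2 * gram_bound y (s j) * (ln (#|S| ^ T)%:R + 1) + atyp.
  under eq_bigr do rewrite (dev_resample (rect s)).
  rewrite -avg_sum; apply: avg_le_cst; first exact: cubes_card_gt0.
  move=> x; apply: (message_bound_explicit lam0 lam12 B1 _ zr (w1 s j) _
    (rho := fun z => pi s (fupd x j z)) K0).
  - exact: gram_bound_ge0.
  - exact: gram_boundP.
  - exact: transcript_count.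
have totQ : avg (fun V => avg (fun s => Qd V s)) <= info_bound.
  have -> : avg (fun V => avg (Qd V)) = D^-1 * avg (fun s => \sum_V Qd V s).
    by rewrite avg_sum.
  apply: le_trans (_ : D^-1 * avg (fun s : {ffun 'I_m -> Xs} => \sum_j (40 * lam ^+ 2 *
    gram_bound y (s j) * (ln (#|S| ^ T)%:R + 1) + atyp)) <= _).
    rewrite ler_wpM2l ?invr_ge0//; apply: le_avg => s.
    by rewrite /Qd exchange_big /=; apply: ler_sum => j _; exact: blockQ.
  rewrite /info_bound [leRHS]mulrAC [leRHS]mulrC ler_wpM2l ?invr_ge0//.
  rewrite avg_sum [leRHS]mulr_natl -[X in _ <= _ *+ X](card_ord m) -sumr_const.
  apply: ler_sum => j _.
  rewrite avgD avgZr avgZl (avg_cst atyp); last by rewrite card_ffun expn_gt0 card_sgt0.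
  rewrite lerD2r (avg_coord j (@gram_bound _ _ _ y n)); last exact: card_sgt0.
  have l0 : 0 <= ln (#|S| ^ T)%:R + 1 :> R by rewrite addr_ge0// ln_ge0// ler1n.
  rewrite ler_wpM2r//.
  have := avg_gram_bound Om0 y2 orth n0 Dn3 Dn.
  by have := sqr_ge0 lam; move: (avg _) (lam ^+ 2) => A l2 *; nra.
have info0 : 0 <= info_bound.
  by apply: le_trans totQ; apply: avg_ge0 => V; apply: avg_ge0 => s.
under eq_avg do rewrite avg_flips.
under [X in _ <= X + _]eq_avg do rewrite avg_flips.
apply: le_trans (le_avg (fun V => le_avg (one V))) _.
under eq_avg do rewrite !avgD avgZl.
rewrite !avgD avgZl lerD2l; apply: lerD; first by rewrite ler_wpM2l.
apply: le_trans (le_avg (fun V => avg_sqrt_le (Qd0 V))) _.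
apply: le_trans (avg_sqrt_le _) _; first by move=> V; exact: avg_ge0.
by rewrite ler_wsqrtr.
Qed.

End finite_problem.

Import numFieldNormedType.Exports.
Local Open Scope classical_set_scope.
Local Open Scope ring_scope.

(** * Densities, mixtures and i.i.d. samples *)

Section density_integral.
Local Open Scope ereal_scope.
Context d (T : measurableType d) (R : realType).
Variables (nu m : {measure set T -> \bar R}) (f : T -> R).
Hypothesis f0 : forall x, (0 <= f x)%R.
Hypothesis mf : measurable_fun [set: T] f.
Hypothesis mE : forall A, measurable A -> m A = \int[nu]_(x in A) (f x)%:E.

Import HBNNSimple.

Lemma integral_density (g : T -> \bar R) : measurable_fun [set: T] g ->
  (forall x, 0 <= g x) -> \int[m]_x g x = \int[nu]_x (g x * (f x)%:E).
Proof.
move=> mg g0; pose g_ := nnsfun_approx measurableT mg.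
have mfE : measurable_fun [set: T] (fun x => (f x)%:E) by exact/measurable_EFinP.
transitivity (limn (fun n => \int[m]_x (g_ n x)%:E)).
  rewrite -monotone_convergence//=.
  - by apply: eq_integral => x _; apply/esym/cvg_lim => //; exact: cvg_nnsfun_approx.
  - by move=> n; exact/measurable_EFinP.
  - by move=> n x _; rewrite lee_fin.
  - by move=> x _ a b ab; rewrite lee_fin; exact/lefP/nd_nnsfun_approx.
transitivity (limn (fun n => \int[nu]_x ((g_ n x)%:E * (f x)%:E))); last first.
  rewrite -monotone_convergence//=.
  - apply: eq_integral => x _; apply/cvg_lim => //.
    by apply: cvgeZr => //; exact: cvg_nnsfun_approx.
  - by move=> n; apply: emeasurable_funM => //; exact/measurable_EFinP.
  - by move=> n x _; rewrite mule_ge0// lee_fin.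
  - move=> x _ a b ab; rewrite lee_wpmul2r ?lee_fin//.
    exact/lefP/nd_nnsfun_approx.
congr (limn _); apply/funext => n.
under eq_integral do rewrite fimfunE -fsumEFin//.
rewrite ge0_integral_fsum//=; last 2 first.
  - by move=> r; exact/measurable_EFinP/measurable_funM.
  - by move=> r x _; rewrite nnfun_muleindic_ge0.
under [RHS]eq_integral => x _.
  rewrite fimfunE -fsumEFin// ge0_mule_fsuml; last first.
    by move=> r; exact: nnfun_muleindic_ge0.
  over.
rewrite ge0_integral_fsum//=; last 2 first.
  - move=> r; apply: emeasurable_funM => //.
    exact/measurable_EFinP/measurable_funM.
  - by move=> r x _; rewrite mule_ge0 ?nnfun_muleindic_ge0 ?lee_fin.
apply: eq_fsbigr => r _.
rewrite integralZl_indic_nnsfun// integral_indic// setIT mE//.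
have [r0|r0] := leP 0%R r; last first.
  rewrite preimage_nnfun0// integral_set0 mule0.
  by under eq_integral do rewrite indic0 mulr0 mul0e; rewrite integral0.
rewrite integral_mkcond -ge0_integralZl//=; last 2 first.
  - by apply/(measurable_restrictT _ _).1 => //; exact: measurable_funTS.
  - by move=> x _; rewrite erestrict_ge0// => y _; rewrite lee_fin.
apply: eq_integral => x _; rewrite EFinM -muleA; congr (_ * _).
rewrite patchE indicE; case: ifPn => _; by rewrite ?mul1e ?mul0e.
Qed.

End density_integral.

Section mixture.
Local Open Scope ereal_scope.
Context d d' (T : measurableType d) (T' : measurableType d') (R : realType).
Variables (E : finType) (p : E -> R) (g : E -> T -> T') (P0 : probability T R).
Hypothesis p0 : forall e, (0 <= p e)%R.
Hypothesis mg : forall e, measurable_fun [set: T] (g e).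

Definition is_mixture (m : set T' -> \bar R) :=
  forall B, measurable B -> m B = \sum_e (p e)%:E * P0 (g e @^-1` B).

Let gm e : {mfun T >-> T'} := mfun_Sub (mem_set (mg e)).
(* Sums of measures are taken along sequences, so the components of the mixture
   are numbered by the enumeration of E and followed by null measures. *)
Let comp (n : nat) : {measure set T' -> \bar R} :=
  if insub n is Some i then
    mscale (NngNum (p0 (enum_val (i : 'I_#|E|)))) (distribution P0 (gm (enum_val i)))
  else mzero.

Let comp_sum (B : set T') : msum comp #|E| B = \sum_e (p e)%:E * P0 (g e @^-1` B).
Proof.
rewrite /msum /= (reindex (fun i : 'I_#|E| => enum_val i)) /=; last first.
  by apply: onW_bij; exact: enum_val_bij.
by apply: eq_bigr => i _; rewrite /comp valK.
Qed.

Lemma mixture_exists (P' : probability T' R) : (\sum_e p e = 1)%R ->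
  exists m : probability T' R, is_mixture m.
Proof.
move=> p1; pose M : {measure set T' -> \bar R} := msum comp #|E|.
have tot : M setT = 1.
  rewrite [LHS]comp_sum -[RHS](congr1 EFin p1) -sumEFin; apply: eq_bigr => e _.
  by rewrite preimage_setT probability_setT mule1.
exists (mnormalize M P') => B mB.
rewrite /= /mnormalize tot onee_eq0/= invr1 mule1; exact: comp_sum.
Qed.

Lemma integral_mixture (m : {measure set T' -> \bar R}) (f : T' -> \bar R) :
  is_mixture m -> measurable_fun [set: T'] f -> (forall x, 0 <= f x) ->
  \int[m]_x f x = \sum_e (p e)%:E * \int[P0]_x f (g e x).
Proof.
move=> mm mf f0; rewrite (eq_measure_integral (msum comp #|E|)); last first.
  by move=> A mA _; rewrite [RHS]comp_sum mm.
rewrite ge0_integral_measure_sum//.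
rewrite [RHS](reindex (fun i : 'I_#|E| => enum_val i)) /=; last first.
  by apply: onW_bij; exact: enum_val_bij.
apply: eq_bigr => i _; rewrite /comp valK ge0_integral_mscale//.
by rewrite ge0_integral_distribution.
Qed.

End mixture.

Section fcons.
Variable E : finType.

Definition fcons n (e : E) (f : {ffun 'I_n -> E}) : {ffun 'I_n.+1 -> E} :=
  [ffun i => if unlift ord0 i is Some j then f j else e].

Lemma fcons0 n e (f : {ffun 'I_n -> E}) : fcons e f ord0 = e.
Proof. by rewrite ffunE unlift_none. Qed.

Lemma fconsS n e (f : {ffun 'I_n -> E}) j : fcons e f (lift ord0 j) = f j.
Proof. by rewrite ffunE liftK. Qed.

Lemma fcons_bij n : bijective (fun q : E * {ffun 'I_n -> E} => fcons q.1 q.2).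
Proof.
exists (fun f : {ffun 'I_n.+1 -> E} => (f ord0, [ffun j => f (lift ord0 j)])).
  move=> [e f] /=; rewrite fcons0; congr pair.
  by apply/ffunP => j; rewrite ffunE fconsS.
move=> f; apply/ffunP => i /=; case: (unliftP ord0 i) => [j|] ->.
  by rewrite fconsS ffunE.
by rewrite fcons0.
Qed.

End fcons.

Section iid_mixture.
Local Open Scope ereal_scope.
Context d d' (T : measurableType d) (T' : measurableType d') (R : realType).
Variables (E : finType) (p : E -> R) (g : E -> T -> T').
Variables (P0 : probability T R) (P : probability T' R).
Hypothesis p0 : forall e, (0 <= p e)%R.
Hypothesis mg : forall e, measurable_fun [set: T] (g e).

Definition tmap n (e : {ffun 'I_n -> E}) (x : n.-tuple T) : n.-tuple T' :=
  [tuple g (e i) (tnth x i) | i < n].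

Lemma measurable_tmap n (e : {ffun 'I_n -> E}) : measurable_fun [set: n.-tuple T] (tmap e).
Proof.
apply/measurable_fun_tnthP => i.
rewrite (_ : _ \o _ = fun x => g (e i) (tnth x i)).
  by apply: (measurableT_comp (mg (e i))); exact: measurable_tnth.
by apply/funext => x; rewrite /= tnth_mktuple.
Qed.

Lemma iidS d0 (T0 : measurableType d0) (Q : probability T0 R) n (B : set (n.+1.-tuple T0)) :
  iid Q n.+1 B = \int[Q]_x iid Q n (fun s : n.-tuple T0 => B [tuple of x :: s]).
Proof.
apply: eq_integral => x _; congr (iid Q n _).
by apply/seteqP; split => s; rewrite /xsection /= inE.
Qed.

Lemma measurable_cons_fix d0 (T0 : measurableType d0) n (B : set (n.+1.-tuple T0)) (x : T0) :
  measurable B -> measurable (fun s : n.-tuple T0 => B [tuple of x :: s]).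
Proof.
move=> mB; rewrite -[X in measurable X]setTI.
by apply: (@measurable_cons _ _ _ _ (fun=> x) n id) => //.
Qed.

Lemma measurable_iid_cons d0 (T0 : measurableType d0) (Q : probability T0 R) n
    (B : set (n.+1.-tuple T0)) : measurable B ->
  measurable_fun [set: T0] (fun x => iid Q n (fun s : n.-tuple T0 => B [tuple of x :: s])).
Proof.
move=> mB; have mC : measurable ((@consp _ T0 n) @^-1` B).
  by rewrite -[_ @^-1` _]setTI; exact: measurable_consp.
have := measurable_fun_xsection (iid Q n) mC.
rewrite (_ : _ \o _ = fun x => iid Q n (fun s : n.-tuple T0 => B [tuple of x :: s]))//.
apply/funext => x /=; congr (iid Q n _).
by apply/seteqP; split => s; rewrite /xsection /= inE.
Qed.

(** Mixtures pass to i.i.d. samples: draw all the mixing variables first. *)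
Lemma iid_mixture n : is_mixture p g P0 P ->
  is_mixture (fun e : {ffun 'I_n -> E} => \prod_i p (e i))%R (@tmap n) (iid P0 n) (iid P n).
Proof.
move=> mix; elim: n => [|n IH] B mB.
  pose e0 : {ffun 'I_0 -> E} := ffun0 (card_ord 0).
  have e0P e : e = e0 by apply/ffunP => -[].
  rewrite (bigD1 e0)//= big_ord0 mul1e big1 ?adde0; last first.
    by move=> e; rewrite (e0P e) eqxx.
  rewrite /dirac !indicE; congr (_%:R%:E); congr nat_of_bool.
  by apply/idP/idP; rewrite !inE /= [tmap _ _]tuple0.
have W0 m (e : {ffun 'I_m -> E}) : (0 <= \prod_i p (e i))%R by apply: prodr_ge0.
have mT (e : {ffun 'I_n.+1 -> E}) : measurable (tmap e @^-1` B).
  by rewrite -[_ @^-1` _]setTI; exact: measurable_tmap.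
rewrite iidS (integral_mixture p0 mg mix); last 2 first.
  - exact: measurable_iid_cons.
  - by move=> x; exact: measure_ge0.
rewrite (reindex _ (onW_bij _ (@fcons_bij E n))) /=.
rewrite -(pair_bigA _ (fun e f => (\prod_i p (fcons e f i))%:E *
   iid P0 n.+1 (tmap (fcons e f) @^-1` B))) /=.
apply: eq_bigr => e _.
transitivity ((p e)%:E * \int[P0]_x \sum_(f : {ffun 'I_n -> E}) (\prod_i p (f i))%:E *
    iid P0 n (fun s : n.-tuple T => (tmap (fcons e f) @^-1` B) [tuple of x :: s])).
  congr (_ * _); apply: eq_integral => x _.
  rewrite IH; last exact: measurable_cons_fix.
  apply: eq_bigr => f _; congr (_ * iid P0 n _).
  apply/seteqP; split => s /=; congr (B _); apply: eq_from_tnth => i;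
    case: (unliftP ord0 i) => [j|] ->;
    by rewrite ?tnthS ?tnth0 !tnth_mktuple ?fconsS ?fcons0 ?tnthS ?tnth0.
rewrite ge0_integral_sum//; last 2 first.
  - by move=> f; apply: emeasurable_funM => //; exact: measurable_iid_cons.
  - by move=> f x _; rewrite mule_ge0 ?lee_fin.
rewrite ge0_sume_distrr; last first.
  by move=> f _; apply: integral_ge0 => x _; rewrite mule_ge0 ?lee_fin.
apply: eq_bigr => f _; rewrite ge0_integralZl_EFin//; last 1 first.
  exact: measurable_iid_cons.
rewrite muleA -EFinM -iidS; congr ((_%:E) * _).
by rewrite big_ord_recl fcons0; congr (_ * _)%R; apply: eq_bigr => i _; rewrite fconsS.
Qed.

End iid_mixture.

Section iid_integrals.
Local Open Scope ereal_scope.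
Context d (T : measurableType d) (R : realType) (P : probability T R).

Lemma iid_coord n (i : 'I_n) (A : set T) : measurable A ->
  iid P n [set x | A (tnth x i)] = P A.
Proof.
move=> mA; pose B j := if j == i then A else setT.
have -> : [set x : n.-tuple T | A (tnth x i)] = [set x | forall j, B j (tnth x j)].
  apply/seteqP; split => x /=.
    by move=> Ax j; rewrite /B; case: eqP => [->|].
  by move=> /(_ i); rewrite /B eqxx.
rewrite iid_box; last by move=> j; rewrite /B; case: eqP.
rewrite (bigD1 i)//= /B eqxx big1 ?mule1// => j /negbTE->.
exact: probability_setT.
Qed.

Lemma integral_iid_coord n (i : 'I_n) (f : T -> \bar R) :
  measurable_fun [set: T] f -> (forall x, 0 <= f x) ->
  \int[iid P n]_x f (tnth x i) = \int[P]_x f x.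
Proof.
move=> mf f0; pose X : {mfun n.-tuple T >-> T} := mfun_Sub (mem_set (measurable_tnth i)).
transitivity (\int[distribution (iid P n) X]_x f x).
  by rewrite ge0_integral_distribution.
apply: eq_measure_integral => A mA _; exact: iid_coord.
Qed.

Lemma measurable_prod_tnth n (f : 'I_n -> T -> R) :
  (forall i, measurable_fun [set: T] (f i)) ->
  measurable_fun [set: n.-tuple T] (fun x => \prod_i f i (tnth x i))%R.
Proof.
move=> mf; apply: measurable_prod => i _.
by apply: (measurableT_comp (mf i)); exact: measurable_tnth.
Qed.

Lemma integral_iid_prod n (f : 'I_n -> T -> R) :
  (forall i, measurable_fun [set: T] (f i)) -> (forall i x, (0 <= f i x)%R) ->
  \int[iid P n]_x (\prod_i f i (tnth x i))%:E = \prod_i \int[P]_x (f i x)%:E.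
Proof.
elim: n f => [|n IH] f mf f0.
  rewrite [RHS]big_ord0 (eq_integral (cst 1%E)) => [|x _]; last by rewrite big_ord0.
  by rewrite integral_cst// mul1e; exact: probability_setT.
have F0 m (h : 'I_m -> T -> R) (x : m.-tuple T) : (forall i y, (0 <= h i y)%R) ->
  0 <= (\prod_i h i (tnth x i))%:E by move=> h0; rewrite lee_fin prodr_ge0.
have mF := measurable_prod_tnth mf.
rewrite /= ge0_integral_distribution//=; last 2 first.
  - exact/measurable_EFinP.
  - by move=> x; exact: F0.
rewrite (fubini_tonelli1 (m1 := P) (m2 := iid P n)
   (fun z => (\prod_i f i (tnth (consp z) i))%:E)); last 2 first.
  - apply/measurable_EFinP; apply: (measurableT_comp mF); exact: measurable_consp.
  - by move=> x; exact: F0.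
rewrite big_ord_recl.
transitivity (\int[P]_x ((f ord0 x)%:E *
    \int[iid P n]_s (\prod_i f (lift ord0 i) (tnth s i))%:E)).
  apply: eq_integral => x _; rewrite /fubini_F.
  rewrite -ge0_integralZl//.
  - apply: eq_integral => s _ /=; rewrite big_ord_recl -EFinM tnth0; congr (_ * _)%:E%R.
    by apply: eq_bigr => i _; rewrite tnthS.
  - by apply/measurable_EFinP; apply: (@measurable_prod_tnth n (fun i => f (lift ord0 i))).
  - by move=> s _; apply: (F0 n (fun i => f (lift ord0 i))).
  - by rewrite lee_fin.
rewrite ge0_integralZr//.
- by rewrite (IH (fun i => f (lift ord0 i))).
- exact/measurable_EFinP.
- by move=> x _; rewrite lee_fin.
- by apply: integral_ge0 => s _; apply: (F0 n (fun i => f (lift ord0 i))).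
Qed.

End iid_integrals.

(** * The standard Gaussian law and its signs *)

Section normal.
Context {R : realType}.
Local Notation N01 := (normal_prob (0 : R) 1).
Local Notation pdf := (normal_pdf (0 : R) 1).
Local Notation leb := (@lebesgue_measure R).
Local Notation mR := (measurableTypeR R).

Lemma normal_pdfN x : pdf (- x) = pdf x.
Proof.
rewrite !normal_pdfE ?oner_neq0// /normal_fun /=.
by rewrite !subr0 sqrrN.
Qed.

Lemma normal_probN (B : set mR) : measurable B ->
  N01 ((-%R : mR -> mR) @^-1` B) = N01 B.
Proof.
move=> mB; rewrite /normal_prob.
under eq_integral do rewrite -normal_pdfN.
have mN : measurable_fun [set: mR] (-%R : mR -> mR) by exact: oppr_measurable.
transitivity (\int[pushforward leb (-%R : mR -> mR)]_(x in B) (pdf x)%:E)%E.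
  rewrite ge0_integral_pushforward//.
  - apply/measurable_EFinP; apply: measurable_funTS; exact: measurable_normal_pdf.
  - by move=> x _; rewrite lee_fin normal_pdf_ge0.
by apply: eq_measure_integral => A mA _; exact: lebesgue_measureN.
Qed.

Definition signed (b : bool) (x : mR) : mR := sgb R b * `|x|.

Lemma measurable_signed b : measurable_fun [set: mR] (signed b).
Proof. by apply: measurable_funM => //; exact: normr_measurable. Qed.

(** A centred Gaussian is a fair sign times an independent modulus. *)
Lemma normal_signed : is_mixture (fun=> 1 / 2) signed N01 N01.
Proof.
move=> B mB; rewrite big_bool /= /signed /sgb expr0 expr1.
have mge0 : measurable [set x : mR | 0 <= x] by rewrite -set_itvcy.
have mgt0 : measurable [set x : mR | 0 < x] by rewrite -set_itvoy.
have mnorm (A : set mR) : measurable A -> measurable ((fun x : mR => `|x| : mR) @^-1` A).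
  by move=> mA; rewrite -[_ @^-1` _]setTI; exact: normr_measurable.
have mopp (A : set mR) : measurable A -> measurable ((-%R : mR -> mR) @^-1` A).
  by move=> mA; rewrite -[_ @^-1` _]setTI; exact: oppr_measurable.
have split_at0 (A C : set mR) : measurable A -> measurable C ->
    N01 A = (N01 (A `&` C) + N01 (A `&` ~` C))%E.
  move=> mA mC; rewrite -measureU.
  - by rewrite -setIUr setUv setIT.
  - exact: measurableI.
  - by apply: measurableI => //; exact: measurableC.
  - by rewrite setIACA setICr setI0.
have flip_part (C C' : set mR) : measurable C -> (-%R : mR -> mR) @^-1` C = C' ->
    N01 (((-%R : mR -> mR) @^-1` B) `&` C') = N01 (B `&` C).
  by move=> mC <-; rewrite -preimage_setI normal_probN//; exact: measurableI.
set Bp := ((fun x : mR => 1 * `|x|) @^-1` B).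
set Bn := ((fun x : mR => -1 * `|x|) @^-1` B).
have mBp : measurable Bp.
  rewrite /Bp (_ : (fun x : mR => 1 * `|x|) = (fun x => `|x|)); first exact: mnorm.
  by apply/funext => x; rewrite mul1r.
have mBn : measurable Bn.
  rewrite /Bn (_ : _ @^-1` B = (fun x : mR => `|x| : mR) @^-1` ((-%R : mR -> mR) @^-1` B)).
    by apply: mnorm; exact: mopp.
  by apply/seteqP; split => x /=; rewrite mulN1r.
rewrite (split_at0 Bp _ mBp mge0) (split_at0 Bn _ mBn mge0).
have -> : Bp `&` [set x | 0 <= x] = B `&` [set x : mR | 0 <= x].
  by apply/seteqP; split => x /= [+ x0]; rewrite /Bp /= mul1r ger0_norm.
have -> : Bp `&` ~` [set x | 0 <= x] = ((-%R : mR -> mR) @^-1` B) `&` ~` [set x : mR | 0 <= x].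
  by apply/seteqP; split => x /= [+ /negP]; rewrite -ltNge /Bp /= mul1r => + x0;
    rewrite ltr0_norm// => Bx; split => //; apply/negP; rewrite -ltNge.
have -> : Bn `&` [set x | 0 <= x] = ((-%R : mR -> mR) @^-1` B) `&` [set x : mR | 0 <= x].
  by apply/seteqP; split => x /= [+ x0]; rewrite /Bn /= mulN1r ger0_norm.
have -> : Bn `&` ~` [set x | 0 <= x] = B `&` ~` [set x : mR | 0 <= x].
  by apply/seteqP; split => x /= [+ /negP]; rewrite -ltNge /Bn /= mulN1r => + x0;
    rewrite ltr0_norm// ?opprK => Bx; split => //; apply/negP; rewrite -ltNge.
have E1 : (-%R : mR -> mR) @^-1` [set x | 0 < x] = ~` [set x : mR | 0 <= x].
  by apply/seteqP; split => x /=; rewrite oppr_gt0 ltNge => /negP.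
have E2 : (-%R : mR -> mR) @^-1` (~` [set x | 0 < x]) = [set x : mR | 0 <= x].
  by rewrite -preimage_setC E1 setCK.
rewrite (flip_part _ _ mgt0 E1) (flip_part _ _ (measurableC mgt0) E2).
have N0 C : (0 <= N01 C)%E by exact: measure_ge0.
rewrite -ge0_muleDr; [|exact: (adde_ge0 (N0 _) (N0 _))|exact: (adde_ge0 (N0 _) (N0 _))].
set a := N01 (_ `&` [set x | 0 <= x]); set b := N01 (_ `&` [set x | 0 < x]).
set c := N01 (_ `&` ~` [set x | 0 < x]); set e := N01 (_ `&` ~` [set x | 0 <= x]).
have h1 : N01 B = (a + e)%E by exact: split_at0.
have h2 : N01 B = (b + c)%E by exact: split_at0.
have -> : (c + e + (a + b) = N01 B + N01 B)%E.
  by rewrite {1}h1 h2 [LHS]addeC [(c + e)%E]addeC addeACA.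
rewrite -mule2n -mule_natl muleA -EFinM.
by rewrite (_ : 1 / 2 * 2 = 1)%R ?mul1e//; field.
Qed.

End normal.

(** ** Absolute mean *)

Section normal_mean.
Context {R : realType}.
Local Notation N01 := (normal_prob (0 : R) 1).
Local Notation pdf := (normal_pdf (0 : R) 1).
Local Notation leb := (@lebesgue_measure R).
Local Notation mR := (measurableTypeR R).

Lemma normal_prob0 : N01 [set (0 : R)] = 0%E.
Proof.
have := normal_prob_dominates (0 : R) 1 => /null_content_dominatesP; apply.
  exact: measurable_set1.
exact: lebesgue_measure_set1.
Qed.

Let c : R := (Num.sqrt (pi *+ 2))^-1.

Lemma normal_pdf01 x : pdf x = c * expR (- (x ^+ 2 / 2)).
Proof.
rewrite normal_pdfE ?oner_neq0// /normal_peak /normal_fun /c.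
by rewrite expr1n mul1r subr0 mulNr.
Qed.

Let F (x : R) : R := - (c * expR (- (x ^+ 2 / 2))).

Let dF (x : R) : is_derive x (1 : R) F (x * pdf x).
Proof.
have h1 : is_derive x (1 : R) (fun y : R => - (y ^+ 2 / 2)) (- x).
  have h2 : is_derive x (1 : R) (fun y : R => y ^+ 2) (2 * x).
    apply: is_derive_eq.
    by rewrite /GRing.scale /=; ring.
  rewrite (_ : (fun y : R => - (y ^+ 2 / 2)) = (- 2^-1) \*: (fun y : R => y ^+ 2)); last first.
    by apply/funext => y /=; rewrite /GRing.scale /= mulNr mulrC.
  apply: is_derive_eq.
  by rewrite /GRing.scale /=; field.
have h3 : is_derive x (1 : R) (expR \o (fun y : R => - (y ^+ 2 / 2)))
    (- x * expR (- (x ^+ 2 / 2))).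
  apply: is_derive_eq.
  by rewrite /GRing.scale /=; ring.
rewrite (_ : F = (- c) \*: (expR \o (fun y : R => - (y ^+ 2 / 2)))); last first.
  by apply/funext => y /=; rewrite /F /GRing.scale /= mulNr.
apply: is_derive_eq.
by rewrite /GRing.scale /= normal_pdf01; ring.
Qed.

Let cvgF : F x @[x --> +oo] --> (0 : R).
Proof.
rewrite -oppr0; apply: cvgN; rewrite -(mulr0 c); apply: cvgMr.
apply: (@cvg_comp _ _ _ (fun x : R => x ^+ 2 / 2) (fun z => expR (- z)) _
  (pinfty_nbhs R)); last exact: cvgr_expR.
apply/cvgryPge => A; near=> x.
have x2 : 2 <= x by near: x; exact: nbhs_pinfty_ge.
have xA : A <= x by near: x; apply: nbhs_pinfty_ge; rewrite num_real.
rewrite (le_trans xA)//; nra.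
Unshelve. all: by end_near. Qed.

(** The primitive of x pdf x is - pdf x, so half of the integral is pdf 0. *)
Lemma normal_mean_abs : (\int[N01]_x (`|x|)%:E = (Num.sqrt (2 / pi))%:E)%E.
Proof.
rewrite (@integral_density _ _ _ leb N01 pdf); first last.
- by move=> x; rewrite lee_fin.
- by apply/measurable_EFinP; exact: normr_measurable.
- by [].
- exact: measurable_normal_pdf.
- by move=> x; exact: normal_pdf_ge0.
under eq_integral do rewrite -EFinM.
have cpdf : continuous pdf by apply: continuous_normal_pdf; rewrite oner_neq0.
have cf : continuous (fun x : R => `|x| * pdf x).
  by move=> x; apply: cvgM; [exact: norm_continuous|exact: cpdf].
rewrite ge0_symfun_integralT//; last 2 first.
- by move=> x; rewrite mulr_ge0 ?normal_pdf_ge0.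
- by move=> x /=; rewrite normrN normal_pdfN.
rewrite -set_itvcy (@ge0_continuous_FTC2y _ _ F 0 0).
- rewrite sub0e -EFinN /F expr0n mul0r oppr0 expR0 mulr1 opprK -EFinM; congr (_%:E).
  have E1 : Num.sqrt (pi *+ 2) = Num.sqrt 2 * Num.sqrt pi :> R.
    by rewrite -sqrtrM// mulr_natl.
  have E2 : Num.sqrt (2 / pi) = Num.sqrt 2 / Num.sqrt pi :> R.
    by rewrite sqrtrM// sqrtrV// pi_ge0.
  have s2 : Num.sqrt 2 * Num.sqrt 2 = 2 :> R by rewrite -expr2 sqr_sqrtr.
  have s20 : Num.sqrt 2 != 0 :> R by rewrite gt_eqF// sqrtr_gt0.
  rewrite /c E1 E2 -[X in X / _]s2; field.
  by rewrite s20 gt_eqF// sqrtr_gt0 pi_gt0.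
- by move=> x _; rewrite mulr_ge0 ?normal_pdf_ge0.
- exact: continuous_subspaceT.
- exact: cvgF.
- by move=> x _; have [] := dF x.
- apply/cvg_at_right_filter.
  have -> : F = (fun x => - pdf x).
    by apply/funext => x; rewrite normal_pdf01.
  by apply: cvgN; exact: cpdf.
- move=> x; rewrite in_itv/= andbT => x0; rewrite derive1E.
  have -> := @derive_val _ _ _ _ _ _ _ (dF x).
  by rewrite ger0_norm// ltW.
Qed.

End normal_mean.

(** * The sign law as a mixture over sign patterns *)

Notation pattern k d := {ffun 'I_k -> {ffun 'I_d -> bool}}.
Notation multi_index k d := {ffun 'I_k -> 'I_d}.

Section sign_patterns.
Variables (R : realType) (k d : nat).
Local Notation pattern := (pattern k d).
Local Notation index := (multi_index k d).
Local Notation sgb := (sgb R).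

(** The sign of the entry V of the tensor of views; see [views_act]. *)
Definition ysign (V : index) (s : pattern) : R := \prod_a sgb (s a (V a)).

Lemma ysign2 V s : ysign V s * ysign V s = 1.
Proof. by rewrite /ysign -big_split big1// => a _; exact: sgb2. Qed.

Lemma avg_sgb : avg (fun b => sgb b) = 0.
Proof. by rewrite avg_bool /sgb expr0 expr1 subrr mul0r. Qed.

Lemma card_row_gt0 : (0 < #|{ffun 'I_d -> bool}|)%N.
Proof. by rewrite card_ffun card_bool expn_gt0. Qed.

Lemma card_pattern_gt0 : (0 < #|{: pattern}|)%N.
Proof. by rewrite card_ffun expn_gt0 card_row_gt0. Qed.

(** Where V and W differ, some bit occurs in exactly one of the two products. *)
Lemma ysign_orth V W : avg (fun s => ysign V s * ysign W s) = (V == W)%:R.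
Proof.
rewrite (eq_avg (g := fun s : {ffun 'I_k -> {ffun 'I_d -> bool}} =>
  \prod_a (sgb (s a (V a)) * sgb (s a (W a))))); last by move=> s; rewrite -big_split.
rewrite (avg_ffun_prod (fun a (r : {ffun 'I_d -> bool}) => sgb (r (V a)) * sgb (r (W a)))).
have row (u v : 'I_d) : avg (fun r : {ffun 'I_d -> bool} => sgb (r u) * sgb (r v)) = (u == v)%:R.
  have [->|uv] := eqVneq u v.
    by under eq_avg do rewrite sgb2; rewrite avg_cst// card_row_gt0.
  rewrite (avg_resample u) (eq_avg (g := fun=> 0)) ?avg0// => r.
  rewrite (eq_avg (g := fun b => sgb b * sgb (r v))); last first.
    by move=> b; rewrite !ffunE eqxx eq_sym (negbTE uv).
  by rewrite avgZr avg_sgb mul0r.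
under eq_bigr do rewrite row.
have [->|VW] := eqVneq V W; first by rewrite big1// => a _; rewrite eqxx.
have /existsP[a Va] : [exists a, V a != W a].
  apply: contraNT VW; rewrite negb_exists => /forallP VW.
  by apply/eqP/ffunP => a; have := VW a; rewrite negbK => /eqP.
by rewrite (bigD1 a)//= (negbTE Va) mul0r.
Qed.

(** Negating the first view is a symmetry that reverses every product sign. *)
Definition flip_first (b : bool) (s : pattern) : pattern :=
  [ffun a : 'I_k => if a == 0 :> nat then [ffun i => b (+) s a i] else s a].

Lemma flip_firstK b : involutive (flip_first b).
Proof.
move=> s; apply/ffunP => a; rewrite !ffunE; case: ifP => a0; last by rewrite ?a0.
by apply/ffunP => i; rewrite !ffunE a0 ffunE addKb.
Qed.

Lemma ysign_flip b V s : (0 < k)%N -> ysign V (flip_first b s) = sgb b * ysign V s.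
Proof.
move=> k0; rewrite /ysign (bigD1 (Ordinal k0))//= [in RHS](bigD1 (Ordinal k0))//=.
rewrite /flip_first !ffunE /= sgbM -mulrA; congr (_ * (_ * _)).
by apply: eq_bigr => a a0; rewrite /flip_first ffunE ifN.
Qed.

Lemma avg_ysign V : (0 < k)%N -> avg (ysign V) = 0.
Proof.
move=> k0; have := avg_inj (ysign V) (inv_inj (@flip_firstK true)).
rewrite (eq_avg (g := fun s => -1 * ysign V s)); last first.
  by move=> s; rewrite ysign_flip// /sgb expr1.
rewrite avgZl; lra.
Qed.

End sign_patterns.

Section tensors.
Variables (R : realType) (k d : nat).
Hypothesis d0 : (0 < d)%N.

Definition basis_tensor (V : multi_index k d) : tensor R k d :=
  scaled_outer (fun a j => (j == V a)%:R).

Lemma sqrt_dk_gt0 : 0 < sqrt_dk R k d.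
Proof. by rewrite sqrtr_gt0 exprn_gt0// ltr0n. Qed.

Lemma basis_tensorE V j : basis_tensor V j = sqrt_dk R k d * (j == V)%:R.
Proof.
rewrite !ffunE; congr (_ * _).
have [->|jV] := eqVneq j V; first by rewrite big1// => a _; rewrite eqxx.
have /existsP[a ja] : [exists a, j a != V a].
  apply: contraNT jV; rewrite negb_exists => /forallP jV.
  by apply/eqP/ffunP => a; have := jV a; rewrite negbK => /eqP.
by rewrite (bigD1 a)//= (negbTE ja) mul0r.
Qed.

Lemma inner_basis (U : tensor R k d) V : inner U (basis_tensor V) = sqrt_dk R k d * U V.
Proof.
rewrite /inner (bigD1 V)//= big1 ?addr0 => [|j /negbTE jV]; last first.
  by rewrite basis_tensorE jV !mulr0.
by rewrite basis_tensorE eqxx mulr1 mulrC.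
Qed.

Lemma basis_tensor_basis V : basis_param (basis_tensor V).
Proof. by exists V. Qed.

Lemma basis_kcca (U : tensor R k d) : basis_param U -> kcca_param U.
Proof.
move=> [i ->]; exists (fun a j => (j == i a)%:R); split=> // a.
rewrite (bigD1 (i a))//= eqxx expr1n big1 ?addr0// => j /negbTE->.
by rewrite expr0n.
Qed.

End tensors.

Section gaussian_sample.
Variables (R : realType) (k d : nat).
Local Notation sampl := (sample R k d).
Local Notation gam := (std_gaussian R k d).
Local Notation mR := (measurableTypeR R).
Local Notation sgb := (sgb R).

Definition act (s : pattern k d) : sampl -> sampl :=
  tmap (fun r : {ffun 'I_d -> bool} => tmap (@signed R) r) s.

Lemma measurable_act s : measurable_fun [set: sampl] (act s).
Proof.
by apply: measurable_tmap => r; apply: measurable_tmap; exact: measurable_signed.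
Qed.

Lemma tnth_act s x a i :
  tnth (tnth (act s x) a) i = sgb (s a i) * `|tnth (tnth x a) i|.
Proof. by rewrite /act /tmap !tnth_mktuple. Qed.

(** The signs of a Gaussian vector are uniform and independent of its moduli. *)
Lemma gaussian_mixture : is_mixture (fun _ : pattern k d => #|{: pattern k d}|%:R^-1 : R)
  act gam gam.
Proof.
have m1 : is_mixture (fun r : {ffun 'I_d -> bool} => \prod_(i < d) (1 / 2) : R)
    (fun r => tmap (@signed R) r) (iid (normal_prob (0 : R) 1) d) (iid (normal_prob (0 : R) 1) d).
  by apply: (@iid_mixture _ _ _ _ _ _ (fun=> 1 / 2) (@signed R) _ _ _
    (@measurable_signed R)); [move=> b; lra | exact: normal_signed].
have m2 : is_mixture (fun s : {ffun 'I_k -> {ffun 'I_d -> bool}} =>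
    \prod_(a < k) \prod_(i < d) (1 / 2) : R) act gam gam.
  apply: (@iid_mixture _ _ _ _ _ _ (fun=> \prod_(i < d) (1 / 2)) _ _ _ _ _ _ m1).
    by move=> r; apply: prodr_ge0 => i _; lra.
  by move=> r; apply: measurable_tmap; exact: measurable_signed.
move=> B mB; rewrite (m2 B mB); apply: eq_bigr => s _; congr (_%:E * _)%E.
rewrite !prodr_const !card_ord !card_ffun card_bool !card_ord.
by rewrite !natrX div1r !exprVn exprAC.
Qed.

Definition modulus (V : multi_index k d) (x : sampl) : R :=
  \prod_a `|tnth (tnth x a) (V a)|.

Lemma modulus_ge0 V x : 0 <= modulus V x.
Proof. by apply: prodr_ge0. Qed.

Lemma measurable_coord2 a i : measurable_fun [set: sampl]
  (fun x : sampl => tnth (tnth x a) i : mR).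
Proof.
apply: (measurableT_comp (f := fun y : d.-tuple mR => tnth y i)); exact: measurable_tnth.
Qed.

Lemma measurable_modulus V : measurable_fun [set: sampl] (modulus V).
Proof.
apply: measurable_prod => a _.
exact: (measurableT_comp (f := fun z : mR => `|z| : mR) (@normr_measurable R setT)
  (measurable_coord2 a (V a))).
Qed.

Lemma measurable_views j : measurable_fun [set: sampl] (fun x => views x j).
Proof.
rewrite (_ : (fun x => _) = fun x : sampl => \prod_a tnth (tnth x a) (j a)).
  by apply: measurable_prod => a _; exact: measurable_coord2.
by apply/funext => x; rewrite ffunE.
Qed.

Lemma views_act s x V : views (act s x) V = ysign R V s * modulus V x.
Proof.
rewrite ffunE /ysign /modulus -big_split; apply: eq_bigr => a _.
exact: tnth_act.
Qed.

Lemma modulus_gt0_ae V : {ae gam, forall x, 0 < modulus V x}.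
Proof.
have coord a : {ae gam, forall x, tnth (tnth x a) (V a) != 0}.
  exists [set x : sampl | tnth (tnth x a) (V a) = 0]; split.
  - rewrite (_ : mkset _ = (fun x : sampl => tnth (tnth x a) (V a) : mR) @^-1` [set 0])//.
    by rewrite -[_ @^-1` _]setTI; apply: measurable_coord2 => //; exact: measurable_set1.
  - pose Z := [set y : d.-tuple mR | tnth y (V a) = 0].
    have mZ : measurable Z.
      rewrite (_ : Z = (fun y : d.-tuple mR => tnth y (V a)) @^-1` [set 0])//.
      by rewrite -[_ @^-1` _]setTI; apply: measurable_tnth => //; exact: measurable_set1.
    rewrite [LHS](@iid_coord _ _ _ (iid (normal_prob (0 : R) 1) d) k a Z mZ).
    rewrite [LHS](@iid_coord _ _ _ (normal_prob (0 : R) 1) d (V a) [set (0 : R)])//.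
    exact: normal_prob0.
  - by move=> x /= /negP; rewrite negbK => /eqP.
have FF := ae_filter_ringOfSetsType gam.
apply: filterS (filter_forall FF coord) => x xV; apply: prodr_gt0 => a _.
by rewrite normr_gt0.
Qed.

Lemma lambda_kE : lambda_k R k = Num.sqrt (2 / pi) ^+ k.
Proof.
have p0 : 0 <= 2 / pi :> R by rewrite divr_ge0// pi_ge0.
by rewrite /lambda_k [k%:R / 2]mulrC powRrM powR12_sqrt// powR_mulrn// sqrtr_ge0.
Qed.

Lemma lambda_k_gt0 : 0 < lambda_k R k.
Proof. by rewrite lambda_kE exprn_gt0// sqrtr_gt0 divr_gt0// pi_gt0. Qed.

Lemma integral_modulus V : (\int[gam]_x (modulus V x)%:E = (lambda_k R k)%:E)%E.
Proof.
rewrite (@integral_iid_prod _ _ _ (iid (normal_prob (0 : R) 1) d) k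
   (fun a (y : d.-tuple mR) => `|tnth y (V a)|)).
- rewrite lambda_kE (eq_bigr (fun=> (Num.sqrt (2 / pi))%:E)).
    by rewrite prodEFin prodr_const card_ord.
  move=> a _; rewrite (integral_iid_coord _ (V a) (f := fun x : mR => (`|x|)%:E)).
  + exact: normal_mean_abs.
  + by apply/measurable_EFinP; exact: normr_measurable.
  + by move=> x; rewrite lee_fin.
- move=> a; exact: (measurableT_comp (f := fun z : mR => `|z| : mR)
    (@normr_measurable R setT) (measurable_tnth (V a))).
- by [].
Qed.

Section tilted.
Variables (lambda : R) (V : multi_index k d).
Hypothesis k0 : (0 < k)%N.
Hypothesis d0 : (0 < d)%N.
Hypothesis lam0 : 0 <= lambda.
Hypothesis lam1 : lambda <= lambda_k R k.
Local Notation lam := (lambda / lambda_k R k).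

(** The law of the pattern of signs under the sign law of V: the likelihood
    ratio is a function of the pattern, outside a negligible set. *)
Definition pattern_law (s : pattern k d) : R :=
  #|{: pattern k d}|%:R^-1 * (1 + lam * ysign R V s).

Lemma lam_ge0 : 0 <= lam.
Proof. by rewrite divr_ge0// ltW// lambda_k_gt0. Qed.

Lemma lam_le1 : lam <= 1.
Proof. by rewrite ler_pdivrMr ?mul1r// lambda_k_gt0. Qed.

Lemma tilt_ge0 (u : R) : u * u = 1 -> 0 <= 1 + lam * u.
Proof.
move=> u1; have : -1 <= u by nra.
by have := lam_ge0; have := lam_le1; move: lam => l l1 l0 uN; nra.
Qed.

Lemma pattern_law_ge0 s : 0 <= pattern_law s.
Proof. by rewrite mulr_ge0 ?invr_ge0// tilt_ge0// ysign2. Qed.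

Lemma sum_pattern_law : \sum_s pattern_law s = 1.
Proof.
rewrite -mulr_sumr -/(avg _) avgD avgZl avg_ysign// mulr0 addr0 avg_cst//.
exact: card_pattern_gt0.
Qed.

Lemma likelihood_ratioE x : likelihood_ratio lambda (basis_tensor R V) x =
  1 + lam * Num.sg (views x V).
Proof.
rewrite /likelihood_ratio inner_basis// [sqrt_dk _ _ _ * _]mulrC mulfK//.
by rewrite gt_eqF// sqrt_dk_gt0.
Qed.

Lemma sg_ysign s : Num.sg (ysign R V s) = ysign R V s.
Proof.
have /eqP := ysign2 R V s; rewrite -expr2 sqrf_eq1 => /orP[]/eqP->.
  exact: sgr1.
exact: sgrN1.
Qed.

Lemma measurable_sg : measurable_fun [set: R] (Num.sg : R -> R).
Proof.
rewrite (_ : Num.sg = \1_(`]0, +oo[ : set R) \- \1_(`]-oo, 0[ : set R) :> (R -> R)).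
  by apply: measurable_funB; exact: measurable_indic.
apply/funext => x; rewrite /= !indicE.
have -> : (x \in `]0, +oo[%classic) = (0 < x) by rewrite mem_setE in_itv/= andbT.
have -> : (x \in `]-oo, 0[%classic) = (x < 0) by rewrite mem_setE in_itv.
case: (ltgtP x 0) => [x0|x0|->]; first by rewrite ltr0_sg// sub0r.
  by rewrite gtr0_sg// subr0.
by rewrite sgr0 subrr.
Qed.

(** No coordinate vanishes almost surely, and then the sign of the entry V of
    the tensor of views is [ysign V] of the pattern. *)
Lemma sign_law_mixture (m : probability sampl R) :
  is_mixture pattern_law act gam m -> sign_law lambda (basis_tensor R V) m.
Proof.
move=> mm B mB; rewrite (mm B mB).
pose f x : \bar R := (likelihood_ratio lambda (basis_tensor R V) x)%:E.
have f0 x : (0 <= f x)%E.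
  rewrite lee_fin likelihood_ratioE.
  have := lam_ge0; have := lam_le1; move: lam => l l1 l0.
  case: (ltgtP (views x V) 0) => [x0|x0|->].
  - by rewrite ltr0_sg// mulrN1 subr_ge0.
  - by rewrite gtr0_sg// mulr1 addr_ge0.
  - by rewrite sgr0 mulr0 addr0.
have mf : measurable_fun [set: sampl] f.
  apply/measurable_EFinP.
  rewrite (_ : likelihood_ratio _ _ = fun x => 1 + lam * Num.sg (views x V)); last first.
    by apply/funext => x; exact: likelihood_ratioE.
  apply: measurable_funD => //; apply: measurable_funM => //.
  apply: (measurableT_comp measurable_sg); exact: measurable_views.
rewrite integral_mkcond (integral_mixture _ _ gaussian_mixture); last 4 first.
- by move=> s; rewrite invr_ge0.
- exact: measurable_act.
- by apply/(measurable_restrictT _ _).1 => //; exact: measurable_funTS.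
- by move=> x; rewrite erestrict_ge0// => y _; exact: f0.
apply: eq_bigr => s _; rewrite /pattern_law EFinM -muleA; congr (_ * _)%E.
have mS : measurable (act s @^-1` B).
  by rewrite -[_ @^-1` _]setTI; exact: measurable_act.
transitivity (\int[gam]_(x in act s @^-1` B) (1 + lam * ysign R V s)%:E)%E.
  by rewrite integral_cst.
rewrite [LHS]integral_mkcond; apply: ge0_ae_eq_integral => //.
- by apply/(measurable_restrictT _ _).1.
- apply: (measurableT_comp (f := f \_ B)); last exact: measurable_act.
  by apply/(measurable_restrictT _ _).1 => //; exact: measurable_funTS.
- move=> x _; apply: erestrict_ge0 => y _ /=.
  by rewrite lee_fin tilt_ge0// ysign2.
- by move=> x _; rewrite erestrict_ge0// => y _; exact: f0.
apply: filterS (modulus_gt0_ae V) => x mx _.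
rewrite !patchE (_ : (x \in act s @^-1` B) = (act s x \in B)); last first.
  by apply/idP/idP; rewrite !inE.
case: ifPn => // _; rewrite /f likelihood_ratioE views_act sgrM.
by rewrite [Num.sg (modulus _ _)]gtr0_sg// mulr1 sg_ysign.
Qed.

End tilted.
End gaussian_sample.

Section kcca.
Variables (R : realType) (k d : nat).
Local Notation sampl := (sample R k d).
Local Notation gam := (std_gaussian R k d).
Variables (lambda : R) (V : multi_index k d).
Hypothesis k0 : (0 < k)%N.
Hypothesis d0 : (0 < d)%N.
Hypothesis lam0 : 0 <= lambda.
Hypothesis lam1 : lambda <= lambda_k R k.
Local Notation lam := (lambda / lambda_k R k).

Lemma integral_views_part (m : probability sampl R) (h : R -> R) (j : multi_index k d) :
  is_mixture (pattern_law lambda V) (@act R k d) gam m ->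
  measurable_fun [set: R] h -> (forall u, 0 <= h u) ->
  (forall u v, 0 <= v -> h (u * v) = h u * v) ->
  (\int[m]_x (h (views x j))%:E =
   (lambda_k R k * \sum_s pattern_law lambda V s * h (ysign R j s))%:E)%E.
Proof.
move=> mm mh h0 hM.
have p0 s : 0 <= pattern_law lambda V s by exact: pattern_law_ge0.
rewrite (integral_mixture p0 (@measurable_act R k d) mm); last 2 first.
- by apply/measurable_EFinP; apply: (measurableT_comp mh); exact: measurable_views.
- by move=> x; rewrite lee_fin.
rewrite mulr_sumr -sumEFin; apply: eq_bigr => s _.
under eq_integral do rewrite views_act hM ?modulus_ge0// EFinM.
rewrite ge0_integralZl//; last 3 first.
- by apply/measurable_EFinP; exact: measurable_modulus.
- by move=> x _; rewrite lee_fin modulus_ge0.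
- by rewrite lee_fin.
by rewrite integral_modulus -!EFinM; congr (_%:E); ring.
Qed.

Lemma sum_pattern_law_ysign j :
  \sum_s pattern_law lambda V s * ysign R j s = lam * (j == V)%:R.
Proof.
transitivity (avg (fun s => (1 + lam * ysign R V s) * ysign R j s)).
  by rewrite /avg mulr_sumr; apply: eq_bigr => s _; rewrite mulrA.
rewrite (eq_avg (g := fun s => ysign R j s + lam * (ysign R j s * ysign R V s))).
  by rewrite avgD avgZl avg_ysign// ysign_orth add0r.
by move=> s; ring.
Qed.

(** The positive and negative parts of a coordinate of the tensor of views are
    handled separately, the modulus being independent of the sign pattern. *)
Lemma kcca_law_mixture (m : probability sampl R) :
  is_mixture (pattern_law lambda V) (@act R k d) gam m ->
  kcca_law lambda (basis_tensor R V) m.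
Proof.
move=> mm j; pose f (x : sampl) : \bar R := (views x j)%:E.
have mf : measurable_fun [set: sampl] f by apply/measurable_EFinP; exact: measurable_views.
have hp : measurable_fun [set: R] (fun u : R => Num.max u 0).
  exact: measurable_maxr.
have hn : measurable_fun [set: R] (fun u : R => Num.max (- u) 0).
  by apply: measurable_maxr => //; exact: oppr_measurable.
have maxM (u v : R) : 0 <= v -> Num.max (u * v) 0 = Num.max u 0 * v.
  by move=> v0; rewrite maxr_pMl// mul0r.
split.
  apply/integrableP; split=> //.
  rewrite (eq_integral (fun x => (`|views x j|)%:E))//.
  rewrite (integral_views_part (h := fun u => `|u|) j mm) ?ltry//.
  by move=> u v v0; rewrite normrM (ger0_norm v0).
rewrite unlock -/f integralE.
have -> : (\int[m]_x (f^\+ x) = \int[m]_x (Num.max (views x j) 0)%:E)%E.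
  by apply: eq_integral => x _; rewrite funeposE /f -EFin_max.
have -> : (\int[m]_x (f^\- x) = \int[m]_x (Num.max (- views x j) 0)%:E)%E.
  by apply: eq_integral => x _; rewrite funenegE /f -EFin_max.
rewrite (integral_views_part (h := fun u => Num.max u 0) j mm)//; last 1 first.
  by move=> u; rewrite le_max lexx orbT.
rewrite (integral_views_part (h := fun u => Num.max (- u) 0) j mm)//; last 2 first.
- by move=> u; rewrite le_max lexx orbT.
- by move=> u v v0; rewrite -mulNr maxM.
rewrite -EFinB -mulrBr -sumrB; congr (_%:E).
rewrite (eq_bigr (fun s => pattern_law lambda V s * ysign R j s)); last first.
  move=> s _; rewrite -mulrBr; congr (_ * _).
  move: (ysign R j s) => u; rewrite /Order.max oppr_lt0.
  by case: (ltgtP u 0) => [_|_|->]; rewrite ?sub0r ?opprK ?subr0 ?subrr.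
rewrite sum_pattern_law_ysign basis_tensorE.
have lk : lambda_k R k != 0 by rewrite gt_eqF// lambda_k_gt0.
have sk : sqrt_dk R k d != 0 by rewrite gt_eqF// sqrt_dk_gt0.
by field; rewrite lk sk.
Qed.

End kcca.

(** * Memory-bounded algorithms as block protocols *)

Section padding.
Variables (R : realType) (Om : finType) (q : Om -> R).
Hypothesis q1 : avg q = 1.

(** Samples that are never read can be averaged out. *)
Lemma avg_inj_marginal (N : nat) (K : finType) (io : 'I_N -> K) (f : {ffun 'I_N -> Om} -> R) :
  injective io ->
  avg (fun e : {ffun K -> Om} => (\prod_k q (e k)) * f [ffun i => e (io i)]) =
  avg (fun e : {ffun 'I_N -> Om} => (\prod_i q (e i)) * f e).
Proof.
move=> ioI; pose g (e0 : {ffun 'I_N -> Om}) k o : R :=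
  q o * \prod_(i | io i == k) (o == e0 i)%:R.
have -> : avg (fun e : {ffun K -> Om} => (\prod_k q (e k)) * f [ffun i => e (io i)]) =
    avg (fun e : {ffun K -> Om} => \sum_(e0 : {ffun 'I_N -> Om}) f e0 * \prod_k g e0 k (e k)).
  apply: eq_avg => e; rewrite (bigD1 [ffun i => e (io i)])//= [X in _ = _ + X]big1 ?addr0 => [|e0 ne].
    rewrite [LHS]mulrC; congr (_ * _); apply: eq_bigr => k _.
    by rewrite /g big1 ?mulr1// => i /eqP<-; rewrite ffunE eqxx.
  have /existsP[i ei] : [exists i, e (io i) != e0 i].
    apply: contraNT ne; rewrite negb_exists => /forallP ne.
    by apply/eqP/ffunP => i; rewrite ffunE; have := ne i; rewrite negbK => /eqP->.
  rewrite (bigD1 (io i))//= /g (bigD1 i)//= (negbTE ei).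
  by rewrite !(mul0r, mulr0).
rewrite avg_sum /avg mulr_sumr; apply: eq_bigr => e0 _.
rewrite -[LHS]/(avg (fun e : {ffun K -> Om} => f e0 * \prod_k g e0 k (e k))).
rewrite avgZl avg_ffun_prod [RHS]mulrCA [RHS]mulrA [RHS]mulrC; congr (_ * _).
have gio i : avg (g e0 (io i)) = #|Om|%:R^-1 * q (e0 i).
  rewrite /avg (bigD1 (e0 i))//= big1 ?addr0 => [|o oe]; last first.
    by rewrite /g (bigD1 i)//= (negbTE oe) mul0r mulr0.
  rewrite /g big1 ?mulr1// => l /eqP/ioI->; by rewrite eqxx.
rewrite (bigID [pred k | k \in codom io]) /= [X in _ * X]big1 ?mulr1; last first.
  move=> k kio; rewrite -q1; apply: eq_avg => o; rewrite /g big1 ?mulr1// => i /eqP E.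
  by rewrite -E codom_f in kio.
transitivity (\prod_i avg (g e0 (io i))).
  rewrite -(big_imset (h := io) (A := predT) (fun k => avg (g e0 k)))/=; last first.
    by move=> ? ? _ _; exact: ioI.
  by apply: eq_bigl => k; apply/codomP/imsetP => [[i ->]|[i _ ->]]; exists i.
under eq_bigr do rewrite gio.
by rewrite big_split prodr_const /= card_ffun !card_ord natrX exprVn mulrC.
Qed.

Lemma avg_curry (J L : finType) (f : {ffun J -> {ffun L -> Om}} -> R) :
  avg f = avg (fun e : {ffun J * L -> Om} => f [ffun j => [ffun l => e (j, l)]]).
Proof.
rewrite (avg_bij f (s := fun e : {ffun J * L -> Om} =>
  [ffun j => [ffun l => e (j, l)]] : {ffun J -> {ffun L -> Om}}))//.
exists (fun s : {ffun J -> {ffun L -> Om}} => [ffun p => s p.1 p.2]).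
  by move=> e; apply/ffunP => -[j l]; rewrite !ffunE.
by move=> s; apply/ffunP => j; rewrite ffunE; apply/ffunP => l; rewrite !ffunE.
Qed.

Lemma avg_blocks (N m n : nat) (io : 'I_N -> 'I_m * 'I_n) (f : {ffun 'I_N -> Om} -> R) :
  injective io ->
  avg (fun s : {ffun 'I_m -> {ffun 'I_n -> Om}} =>
    (\prod_j \prod_l q (s j l)) * f [ffun i => s (io i).1 (io i).2]) =
  avg (fun e : {ffun 'I_N -> Om} => (\prod_i q (e i)) * f e).
Proof.
move=> ioI; rewrite -(avg_inj_marginal f ioI) avg_curry; apply: eq_avg => e.
rewrite pair_big /=; congr (_ * f _).
  by apply: eq_bigr => -[j l] _; rewrite !ffunE.
by apply/ffunP => i; rewrite !ffunE -surjective_pairing.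
Qed.

End padding.

Section blocks.
Context {disp : measure_display} {X : measurableType disp} {Y : Type}.
Variables (N T s : nat) (A : mem_alg X Y N T s) (Om : finType) (h : Om -> X -> X).
Variables (x : N.-tuple X) (m' n : nat) (o0 : Om).
Local Notation m := m'.+1.
Local Notation S := (s.-tuple bool).
Hypothesis n0 : (0 < n)%N.
Hypothesis Nmn : (N <= m * n)%N.

(** One update of the algorithm on the i-th sample, altered by the pattern o;
    out-of-range times and samples change nothing. *)
Definition alg_step (t i : nat) (st : S) (o : Om) : S :=
  if insub t is Some t' then
    if insub i is Some i' then update A t' i' st (h o (tnth x i')) else st
  else st.

Definition block_step (q : nat) (st : S) (b : {ffun 'I_n -> Om}) : S :=
  foldl (fun st (l : 'I_n) => alg_step (q %/ m) (q %% m * n + l) st (b l)) st (enum 'I_n).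

Lemma io_row (i : 'I_N) : (i %/ n < m)%N.
Proof. by rewrite ltn_divLR// (leq_trans (ltn_ord i)). Qed.

Lemma io_col (i : 'I_N) : (i %% n < n)%N.
Proof. by rewrite ltn_pmod. Qed.

Definition block_index (i : 'I_N) : 'I_m * 'I_n := (Ordinal (io_row i), Ordinal (io_col i)).

Lemma block_index_inj : injective block_index.
Proof.
move=> i i' [ei em]; apply: val_inj.
by rewrite /= (divn_eq i n) (divn_eq i' n) ei em.
Qed.

Lemma foldl_ord M (B : Type) (g : B -> 'I_M -> B) (g' : B -> nat -> B) z :
  (forall b (i : 'I_M), g b i = g' b i) -> foldl g z (enum 'I_M) = foldl g' z (iota 0 M).
Proof.
move=> gg'; rewrite -val_enum_ord; elim: (enum 'I_M) z => //= i l IH z.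
by rewrite gg' IH.
Qed.

(** A pass over the N samples is a pass over the m blocks of n samples, where
    the samples beyond N are idle; [block_index] places sample i. *)
Lemma final_state_protocol (e : {ffun 'I_m -> {ffun 'I_n -> Om}}) :
  final_state A (tmap h [ffun i => e (block_index i).1 (block_index i).2] x) =
  state [tuple of nseq s false] block_step e (T * m).
Proof.
pose get (i : nat) : Om :=
  oapp (fun j => oapp (fun l => e j l) o0 (insub (i %% n)%N)) o0 (insub (i %/ n)%N).
pose st := state [tuple of nseq s false] block_step e.
have mid t j : (j <= m)%N -> st (t * m + j)%N =
    foldl (fun b i => alg_step t i b (get i)) (st (t * m)%N) (iota 0 (j * n)).
  elim: j => [|j IH] jm; first by rewrite addn0 mul0n.
  have -> : st (t * m + j.+1)%N =
      block_step (t * m + j) (st (t * m + j)%N) (e (blk m' (t * m + j))).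
    by rewrite addnS.
  rewrite (IH (ltnW jm)) mulSn [(n + _)%N]addnC iotaD foldl_cat add0n.
  set z := foldl _ _ _.
  rewrite /block_step /blk modnMDl divnMDl// modn_small// divn_small// addn0.
  rewrite -[X in iota X n]addn0 iotaDl -val_enum_ord -map_comp.
  elim: (enum 'I_n) z => //= l L IHL z; rewrite IHL; congr (foldl _ _ _).
  congr alg_step; rewrite /get modnMDl modn_small// divnMDl// divn_small// addn0.
  rewrite (insubT (fun a => (a < m)%N) jm) /= (insubT (fun a => (a < n)%N) (ltn_ord l)) /=.
  by congr (e _ _); apply: val_inj; rewrite /= ?inordK.
have pass t (ht : (t < T)%N) :
    one_pass A (tmap h [ffun i => e (block_index i).1 (block_index i).2] x)
      (st (t * m)%N) (Ordinal ht) = st (t.+1 * m)%N.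
  rewrite mulSn addnC (mid t m (leqnn _)).
  rewrite /one_pass (@foldl_ord _ _ _ (fun b i => alg_step t i b (get i))); last first.
    move=> b i; rewrite /alg_step insubT /= (insubT (fun a => (a < N)%N) (ltn_ord i)) /=.
    rewrite (_ : Sub (i : nat) (ltn_ord i) = i); last exact: val_inj.
    congr update.
    rewrite tnth_mktuple; congr (h _ _); rewrite ffunE /get.
    by rewrite (insubT (fun j => (j < m)%N) (io_row i)) /= (insubT (fun j => (j < n)%N) (io_col i)).
  rewrite -(subnKC Nmn) iotaD foldl_cat add0n.
  set z := foldl _ _ (iota 0 N).
  have : all (fun i => (N <= i)%N) (iota N (m * n - N)).
    by apply/allP => i; rewrite mem_iota => /andP[].
  elim: (iota N _) z => //= i L IHL z /andP[iN Lall].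
  have -> : alg_step t i z (get i) = z by rewrite /alg_step insubT/= insubN// -leqNgt.
  exact: IHL.
rewrite /final_state.
have {}pass : forall t : 'I_T, one_pass A (tmap h [ffun i => e (block_index i).1
    (block_index i).2] x) (st (t * m)%N) t = st (t.+1 * m)%N.
  by move=> [t ht]; exact: pass.
have gen a (l : seq 'I_T) : map val l = iota a (size l) ->
    foldl (one_pass A (tmap h [ffun i => e (block_index i).1 (block_index i).2] x))
     (st (a * m)%N) l = st ((a + size l) * m)%N.
  elim: l a => [|t l IH] a //=; first by rewrite addn0.
  by move=> [ta /IH] IHl; rewrite -ta pass ta IHl// addSnnS.
have := gen 0%N (enum 'I_T); rewrite mul0n add0n size_enum_ord; apply.
by rewrite val_enum_ord.
Qed.

End blocks.

Section state_measurable.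
Context {disp : measure_display} {X : measurableType disp} {Y : Type}.
Variables (N T s : nat) (A : mem_alg X Y N T s).
Local Notation S := (s.-tuple bool).

Lemma measurable_state_set (P : set S) : measurable P.
Proof.
have single (st : S) : measurable [set st].
  have -> : [set st] = \bigcap_(i in [set: 'I_s]) ((fun y : S => tnth y i) @^-1` [set tnth st i]).
    apply/seteqP; split => y /=; first by move=> -> i.
    by move=> yst; apply: eq_from_tnth => i; exact: yst.
  apply: fin_bigcap_measurable => // i _.
  by rewrite -[_ @^-1` _]setTI; exact: measurable_tnth.
rewrite (_ : P = \bigcup_(st in P) [set st]); last first.
  by apply/seteqP; split => st; [exists st | move=> [st' Pst' ->]].
apply: fin_bigcup_measurable => [|st _].
  exact: finite_finset.
exact: single.
Qed.

Lemma measurable_final_state : measurable_fun [set: N.-tuple X] (final_state A).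
Proof.
have step t i (f : N.-tuple X -> S) : measurable_fun [set: N.-tuple X] f ->
    measurable_fun [set: N.-tuple X] (fun x => update A t i (f x) (tnth x i)).
  move=> mf _ B mB; rewrite setTI.
  have -> : (fun x => update A t i (f x) (tnth x i)) @^-1` B =
      \bigcup_(st in [set: S]) ((f @^-1` [set st]) `&`
        (fun x => update A t i st (tnth x i)) @^-1` B).
    apply/seteqP; split => x /=; first by move=> Bx; exists (f x).
    by move=> [st _ /= [<-]].
  apply: fin_bigcup_measurable => [|st _]; first exact: finite_finset.
  apply: measurableI.
    by rewrite -[_ @^-1` _]setTI; apply: mf => //; exact: measurable_state_set.
  rewrite -[_ @^-1` _]setTI.
  apply: (measurableT_comp (measurable_update A t i st) (measurable_tnth i)) => //.
have pass t (L : seq 'I_N) (f : N.-tuple X -> S) : measurable_fun [set: N.-tuple X] f ->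
    measurable_fun [set: N.-tuple X]
      (fun x => foldl (fun st i => update A t i st (tnth x i)) (f x) L).
  by elim: L f => //= i L IH f mf; apply: (IH (fun x => update A t i (f x) (tnth x i))); exact: step.
have all (L : seq 'I_T) (f : N.-tuple X -> S) : measurable_fun [set: N.-tuple X] f ->
    measurable_fun [set: N.-tuple X] (fun x => foldl (one_pass A x) (f x) L).
  by elim: L f => //= t L IH f mf; apply: (IH (fun x => one_pass A x (f x) t)); exact: pass.
exact: (all _ (fun=> [tuple of nseq s false])).
Qed.

End state_measurable.

Section parseval.
Variables (R : realType) (k d : nat).
Hypothesis d0 : (0 < d)%N.

Lemma overlap_basis (U : tensor R k d) (V : multi_index k d) :
  overlap (basis_tensor R V) U = U V ^+ 2 / \sum_W U W ^+ 2.
Proof.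
have innerC (U1 U2 : tensor R k d) : inner U1 U2 = inner U2 U1.
  by apply: eq_bigr => j _; rewrite mulrC.
have UU (U1 : tensor R k d) : inner U1 U1 = \sum_W U1 W ^+ 2.
  by apply: eq_bigr => j _; rewrite expr2.
have U0 (U1 : tensor R k d) : 0 <= inner U1 U1.
  by rewrite UU sumr_ge0// => j _; exact: sqr_ge0.
have bb : inner (basis_tensor R V) (basis_tensor R V) = sqrt_dk R k d ^+ 2.
  by rewrite inner_basis basis_tensorE eqxx mulr1 expr2.
rewrite /overlap real_normK ?num_real// /tnorm !sqr_sqrtr// bb (UU U) innerC inner_basis.
rewrite exprMn.
have s0 : sqrt_dk R k d ^+ 2 != 0 by rewrite expf_neq0// gt_eqF// sqrt_dk_gt0.
by rewrite invfM mulrACA mulfV// mul1r.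
Qed.

(** The squared correlations of one tensor with an orthogonal family sum to at
    most one, so few of them are large. *)
Lemma null_success (U : tensor R k d) (t : R) : t != 0 ->
  avg (fun V : multi_index k d => (t ^+ 2 / d%:R ^+ k <= overlap (basis_tensor R V) U)%R%:R)
    <= (t ^+ 2)^-1.
Proof.
move=> t0; have t2 : 0 < t ^+ 2 by rewrite exprn_even_gt0.
have D0 : 0 < d%:R ^+ k :> R by rewrite exprn_gt0// ltr0n.
apply: le_trans (_ : avg (fun V : multi_index k d => d%:R ^+ k / t ^+ 2 *
   overlap (basis_tensor R V) U) <= _).
  apply: le_avg => V.
  case: (leP (t ^+ 2 / d%:R ^+ k) (overlap (basis_tensor R V) U)) => le1 /=.
    rewrite [leLHS](_ : _ = d%:R ^+ k / t ^+ 2 * (t ^+ 2 / d%:R ^+ k)); last first.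
      by rewrite mulrA divfK ?gt_eqF// divff ?gt_eqF.
    by rewrite ler_wpM2l// divr_ge0// ltW.
  rewrite mulr_ge0 //; first by rewrite divr_ge0// ltW.
  rewrite overlap_basis divr_ge0 ?sqr_ge0//.
  by apply: sumr_ge0 => W _; exact: sqr_ge0.
rewrite avgZl /avg; under eq_bigr do rewrite overlap_basis.
rewrite -mulr_suml card_ffun !card_ord natrX.
set u := \sum_V _; have u1 : u / u <= 1.
  by have [->|un] := eqVneq u 0; rewrite ?mul0r// divff.
have -> : d%:R ^+ k / t ^+ 2 * ((d%:R ^+ k)^-1 * (u / u)) = (t ^+ 2)^-1 * (u / u).
  by rewrite mulrA [d%:R ^+ k / _]mulrC mulfK// gt_eqF.
by rewrite ler_piMr// invr_ge0 ltW.
Qed.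

End parseval.

(** * The risk bound in a fixed dimension *)

Section fixed_dimension.
Variables (R : realType) (k d N T s : nat).
Variable A : mem_alg (sample R k d) (tensor R k d) N T s.
Variables (t lambda : R).
Hypothesis k0 : (0 < k)%N.
Hypothesis d0 : (0 < d)%N.
Hypothesis t0 : t != 0.
Hypothesis lam0 : 0 <= lambda.
Hypothesis lam1 : lambda <= lambda_k R k.
Local Notation lam := (lambda / lambda_k R k).
Local Notation gam := (std_gaussian R k d).
Local Notation S := (s.-tuple bool).
Local Notation patt := (pattern k d).
Local Notation idx := (multi_index k d).

Definition success (V : idx) (st : S) : R :=
  (t ^+ 2 / d%:R ^+ k <= overlap (basis_tensor R V) (estimator A st))%R%:R.

(** The probability of success given the moduli of the samples: x enters only
    through [act], which overwrites the signs. *)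
Definition cond_success (V : idx) (x : N.-tuple (sample R k d)) : R :=
  \sum_(e : {ffun 'I_N -> patt}) (\prod_i pattern_law lambda V (e i)) *
    success V (final_state A (tmap (@act R k d) e x)).

Lemma success_ge0 V st : 0 <= success V st.
Proof. exact: ler0n. Qed.

Lemma pattern_weight_ge0 V (e : {ffun 'I_N -> patt}) : 0 <= \prod_i pattern_law lambda V (e i).
Proof. by apply: prodr_ge0 => i _; exact: pattern_law_ge0. Qed.

Lemma measurable_success V (e : {ffun 'I_N -> patt}) :
  measurable_fun [set: N.-tuple (sample R k d)]
    (fun x => success V (final_state A (tmap (@act R k d) e x))).
Proof.
have mt : measurable_fun [set: N.-tuple (sample R k d)] (tmap (@act R k d) e).
  exact: (measurable_tmap (@measurable_act R k d)).
apply: (measurableT_comp (f := success V) (g := fun x => final_state A (tmap (@act R k d) e x))).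
  by move=> _ B _; rewrite setTI; exact: measurable_state_set.
exact: (measurableT_comp (measurable_final_state A) mt).
Qed.

Lemma measurable_success_set V : measurable
  [set x : N.-tuple (sample R k d) |
     t ^+ 2 / d%:R ^+ k <= overlap (basis_tensor R V) (output A x)].
Proof.
pose P := [set st : S | t ^+ 2 / d%:R ^+ k <= overlap (basis_tensor R V) (estimator A st)].
rewrite (_ : mkset _ = final_state A @^-1` P)// -[X in measurable X]setTI.
by apply: measurable_final_state => //; exact: measurable_state_set.
Qed.

Lemma success_prob_integral V (m : probability (sample R k d) R) :
  is_mixture (pattern_law lambda V) (@act R k d) gam m ->
  success_prob A t (basis_tensor R V) m =
  (\int[iid gam N]_x (cond_success V x)%:E)%E.
Proof.
move=> mm; rewrite /success_prob; have mE := measurable_success_set V.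
set E := [set x | _] in mE *.
have p0 e : 0 <= pattern_law lambda V e by exact: pattern_law_ge0.
rewrite (iid_mixture p0 (@measurable_act R k d) mm mE).
rewrite /cond_success; under [RHS]eq_integral do rewrite -sumEFin.
have mt e := measurable_tmap (@measurable_act R k d) (n := N) e.
rewrite ge0_integral_sum//; last 2 first.
- move=> e; apply/measurable_EFinP; apply: measurable_funM => //.
  exact: measurable_success.
- by move=> e x _; rewrite lee_fin mulr_ge0 ?success_ge0 ?pattern_weight_ge0.
apply: eq_bigr => e _; under [RHS]eq_integral do rewrite EFinM.
rewrite ge0_integralZl//; last 3 first.
- by apply/measurable_EFinP; exact: measurable_success.
- by move=> x _; rewrite lee_fin success_ge0.
- by rewrite lee_fin pattern_weight_ge0.
congr (_ * _)%E.
rewrite -[X in iid gam N X]setIT -integral_indic//; last first.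
  by rewrite -[X in measurable X]setTI; exact: mt.
apply: eq_integral => x _; rewrite indicE /success; congr (_%:R%:E); congr nat_of_bool.
by apply/idP/idP; rewrite inE.
Qed.

Variables (B : R) (r m' : nat).
Hypothesis lam12 : lam <= 1 / 2.
Hypothesis B1 : 1 <= B.
Hypothesis zr : 2 * r%:R * zeta lam B r <= 1.
Hypothesis Nmn : (N <= m'.+1 * sz r)%N.
Hypothesis Dn3 : ((d ^ k) ^ 3 <= sz r ^ 2)%N.
Hypothesis Dn : (d ^ k <= sz r)%N.

Definition risk_error : R :=
  6 * info_bound idx lam B r m' T S + Num.sqrt (info_bound idx lam B r m' T S).

Lemma card_index : #|{: idx}| = (d ^ k)%N.
Proof. by rewrite card_ffun !card_ord. Qed.

Lemma avg_cond_success x : avg (fun V => cond_success V x) <= (t ^+ 2)^-1 + risk_error.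
Proof.
have n0 : (0 < sz r)%N by rewrite szE expn_gt0.
have P0 := card_pattern_gt0 k d.
have [s0 _] := card_gt0P P0.
pose F := block_step A (@act R k d) x m' (n := sz r).
pose fin (e : {ffun 'I_m'.+1 -> {ffun 'I_(sz r) -> patt}}) :=
  state [tuple of nseq s false] F e (T * m'.+1).
pose q (V : idx) (o : patt) := 1 + lam * ysign R V o.
have q1 V : avg (q V) = 1.
  by rewrite avgD avgZl avg_ysign// mulr0 addr0 avg_cst.
have condE V : cond_success V x = avg (fun e => success V (fin e) * weight (@ysign R k d) lam V e).
  transitivity (avg (fun e : {ffun 'I_N -> patt} => (\prod_i q V (e i)) *
     success V (final_state A (tmap (@act R k d) e x)))).
    rewrite /avg mulr_sumr; apply: eq_bigr => e _; rewrite mulrA; congr (_ * _).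
    have -> : #|{: {ffun 'I_N -> patt}}|%:R = #|{: patt}|%:R ^+ N :> R.
      by rewrite card_ffun card_ord natrX.
    by rewrite /pattern_law big_split prodr_const /= card_ord exprVn.
  rewrite -(avg_blocks (q1 V) _ (@block_index_inj _ _ _ n0 Nmn)).
  apply: eq_avg => e; rewrite mulrC /fin -(final_state_protocol A (@act R k d) x s0 n0 Nmn e).
  by [].
under eq_avg do rewrite condE.
have c01 V st : 0 <= success V st <= 1 by rewrite ler0n lern1 leq_b1.
have I0 : (0 < #|{: idx}|)%N by rewrite card_index expn_gt0 d0.
have l0 : 0 <= lam by rewrite divr_ge0// ltW// lambda_k_gt0.
have D3 : #|{: idx}|%:R ^+ 3 <= (sz r)%:R ^+ 2 :> R by rewrite card_index -!natrX ler_nat.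
have D1 : #|{: idx}|%:R <= (sz r)%:R :> R by rewrite card_index ler_nat.
have main := finite_risk_bound P0 (@ysign2 R k d) (@ysign_orth R k d)
  (@flip_firstK k d) (fun b V o => @ysign_flip R k d b V o k0) m' T
  [tuple of nseq s false] l0 lam12 B1 zr F c01 D3 D1 I0.
apply: le_trans main _.
rewrite lerD2r avg_exchange; apply: avg_le_cst => [|e].
  by apply/card_gt0P; exists [ffun=> [ffun=> s0]].
exact: null_success.
Qed.

(** The average of the success probabilities over the basis tensors is at most
    the bound, since this already holds given the moduli; so one of them is. *)
Lemma worst_case_bound :
  exists (V : idx) (m : probability (sample R k d) R),
    [/\ is_mixture (pattern_law lambda V) (@act R k d) gam m &
    (success_prob A t (basis_tensor R V) m <= ((t ^+ 2)^-1 + risk_error)%:E)%E].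
Proof.
have I0 : (0 < #|{: idx}|)%N by rewrite card_index expn_gt0 d0.
have mx V : {m : probability (sample R k d) R |
    is_mixture (pattern_law lambda V) (@act R k d) gam m}.
  have p0 e : 0 <= pattern_law lambda V e by exact: pattern_law_ge0.
  have p1 : \sum_e pattern_law lambda V e = 1 by exact: sum_pattern_law.
  by apply/cid; exact: (mixture_exists gam p0 (@measurable_act R k d) gam p1).
pose p V := success_prob A t (basis_tensor R V) (sval (mx V)).
set b := _ + risk_error.
suff [V pV] : exists V, (p V <= b%:E)%E.
  by exists V, (sval (mx V)); split => //; exact: (svalP (mx V)).
apply/not_existsP => pb.
have cs0 V x : 0 <= cond_success V x.
  by apply: sumr_ge0 => e _; rewrite mulr_ge0 ?success_ge0 ?pattern_weight_ge0.
have mcs V : measurable_fun [set: N.-tuple (sample R k d)] (cond_success V).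
  apply: measurable_sum => e; apply: measurable_funM => //; exact: measurable_success.
have sum_le : (\sum_V p V <= (#|{: idx}|%:R * b)%:E)%E.
  rewrite (eq_bigr (fun V => \int[iid gam N]_x (cond_success V x)%:E))%E; last first.
    by move=> V _; exact: success_prob_integral (svalP (mx V)).
  rewrite -ge0_integral_sum//; last 2 first.
  - by move=> V; apply/measurable_EFinP.
  - by move=> V x _; rewrite lee_fin.
  apply: le_trans (_ : (\int[iid gam N]_x (#|{: idx}|%:R * b)%:E <= _)%E); last first.
    by rewrite integral_cst// [X in (_ * X)%E]probability_setT mule1.
  apply: ge0_le_integral => //.
  - by move=> x _; rewrite sume_ge0// => V _; rewrite lee_fin.
  - by apply: emeasurable_sum => V; apply/measurable_EFinP.
  - move=> x _; rewrite sumEFin lee_fin.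
    rewrite -ler_pdivrMl ?ltr0n//; exact: avg_cond_success.
have pE V : p V = (fine (p V))%:E.
  by rewrite fineK// fin_num_measure//; exact: measurable_success_set.
have : (#|{: idx}|%:R * b < \sum_V fine (p V))%R.
  have [V0 _] := card_gt0P I0.
  rewrite mulr_natl -sumr_const; apply: ltr_sum => [|V _].
    by apply/hasP; exists V0; rewrite ?mem_index_enum.
  by have /negP := pb V; rewrite -ltNge pE lte_fin.
rewrite ltNge -lee_fin -sumEFin => /negP; apply.
by under eq_bigr do rewrite -pE.
Qed.

End fixed_dimension.

(** * Polynomial orders of growth *)

Section growth.
Variable R : realType.
Implicit Types (a b : nat -> R) (p q : R).

Definition Ogrow a p := exists2 C : R, 0 <= C & \forall d \near \oo, a d <= C * d%:R `^ p.

Lemma near_gt0 : \forall d \near \oo, (0 < d)%N.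
Proof. by exists 1%N. Qed.

Lemma le_Ogrow a b p : (\forall d \near \oo, a d <= b d) -> Ogrow b p -> Ogrow a p.
Proof.
move=> ab [C C0 bC]; exists C => //; near=> d.
by apply: (@le_trans _ _ (b d)); near: d.
Unshelve. all: by end_near. Qed.

Lemma Ogrow_weak a p q : p <= q -> Ogrow a p -> Ogrow a q.
Proof.
move=> pq [C C0 aC]; exists C => //; near=> d.
apply: (@le_trans _ _ (C * d%:R `^ p)); first by near: d.
rewrite ler_wpM2l// ler_powR// ler1n; near: d; exact: near_gt0.
Unshelve. all: by end_near. Qed.

Lemma OgrowD a b p : Ogrow a p -> Ogrow b p -> Ogrow (fun d => a d + b d) p.
Proof.
move=> [C C0 aC] [C' C'0 bC]; exists (C + C'); first exact: addr_ge0.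
near=> d; rewrite mulrDl; apply: lerD; near: d; [exact: aC|exact: bC].
Unshelve. all: by end_near. Qed.

Lemma OgrowM a b p q : (forall d, 0 <= a d) -> (forall d, 0 <= b d) ->
  Ogrow a p -> Ogrow b q -> Ogrow (fun d => a d * b d) (p + q).
Proof.
move=> a0 b0 [C C0 aC] [C' C'0 bC]; exists (C * C'); first exact: mulr_ge0.
near=> d; have d0 : (0 < d)%N by near: d; exact: near_gt0.
rewrite powRD; last by apply/implyP => _; rewrite pnatr_eq0 -lt0n.
by rewrite mulrACA; apply: ler_pM => //; near: d.
Unshelve. all: by end_near. Qed.

Lemma Ogrow_cst (c : R) : Ogrow (fun=> c) 0.
Proof.
exists `|c| => //; near=> d; rewrite powRr0 mulr1; exact: ler_norm.
Unshelve. all: by end_near. Qed.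

Lemma OgrowMl (c : R) a p : 0 <= c -> Ogrow a p -> Ogrow (fun d => c * a d) p.
Proof.
move=> c0 [C C0 aC]; exists (c * C); first exact: mulr_ge0.
near=> d; rewrite -mulrA ler_wpM2l//; near: d; exact: aC.
Unshelve. all: by end_near. Qed.

Lemma Ogrow_powR p : Ogrow (fun d => d%:R `^ p) p.
Proof. by exists 1 => //; near=> d; rewrite mul1r. Unshelve. all: by end_near. Qed.

Lemma Ogrow_sqrt a p : Ogrow a p -> Ogrow (fun d => Num.sqrt (a d)) (p / 2).
Proof.
move=> [C C0 aC]; exists (Num.sqrt C); first exact: sqrtr_ge0.
near=> d; rewrite powRrM powR12_sqrt ?powR_ge0// -sqrtrM//.
by rewrite ler_wsqrtr//; near: d.
Unshelve. all: by end_near. Qed.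

Lemma near_powR_ge (p M : R) : 0 < p -> \forall d \near \oo, M <= d%:R `^ p.
Proof.
move=> p0; have [n nM] : exists n : nat, Num.max M 0 `^ p^-1 <= n%:R.
  by exists (Num.bound (Num.max M 0 `^ p^-1)); apply: ltW; apply: archi_boundP; exact: powR_ge0.
near=> d; have nd : (n <= d)%N by near: d; exact: nbhs_infty_ge.
apply: (@le_trans _ _ (Num.max M 0)); first by rewrite le_max lexx.
have M0 : 0 <= Num.max M 0 by rewrite le_max lexx orbT.
have pn0 : p != 0 by rewrite gt_eqF.
have -> : Num.max M 0 = (Num.max M 0 `^ p^-1) `^ p by rewrite -powRrM mulVf// powRr1.
apply: ge0_ler_powR.
- exact: ltW.
- by rewrite nnegrE powR_ge0.
- by rewrite nnegrE.
- by rewrite (le_trans nM)// ler_nat.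
Unshelve. all: by end_near. Qed.

Lemma Ogrow_small a p (e : R) : p < 0 -> 0 < e -> Ogrow a p ->
  \forall d \near \oo, a d <= e.
Proof.
move=> p0 e0 [C C0 aC]; near=> d.
have d0 : (0 < d)%N by near: d; exact: near_gt0.
apply: (@le_trans _ _ (C * d%:R `^ p)); first by near: d.
have : C / e <= d%:R `^ (- p) by near: d; apply: near_powR_ge; rewrite oppr_gt0.
by rewrite powRN ler_pdivrMr// ler_pdivlMl ?powR_gt0 ?ltr0n// mulrC.
Unshelve. all: by end_near. Qed.

(** Stretched exponentials beat every power. *)
Lemma Ogrow_expR (c p q : R) : 0 < c -> 0 < p ->
  Ogrow (fun d => expR (- (c * d%:R `^ p))) q.
Proof.
move=> c0 p0; have [n nq] : exists n : nat, - q / p <= n.+1%:R.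
  exists (Num.bound (`|- q / p|)); apply: le_trans (ler_norm _) _.
  by apply: ltW; apply: lt_le_trans (archi_boundP (normr_ge0 _)) _; rewrite ler_nat.
exists (n.+1`!%:R / c ^+ n.+1); first by rewrite divr_ge0// exprn_ge0// ltW.
near=> d; have d0 : (0 < d)%N by near: d; exact: near_gt0.
have dR : 0 < d%:R :> R by rewrite ltr0n.
set y := c * d%:R `^ p; have y0 : 0 < y by rewrite mulr_gt0 ?powR_gt0.
have : y ^+ n.+1 / n.+1`!%:R <= expR y.
  by apply: le_trans (expR_ge1Dxn n (ltW y0)); rewrite lerDr.
move=> le1; apply: (@le_trans _ _ (n.+1`!%:R / y ^+ n.+1)).
  rewrite expRN -invf_div lef_pV2 ?posrE ?expR_gt0//.
  by rewrite divr_gt0 ?exprn_gt0// ltr0n fact_gt0.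
rewrite /y exprMn invfM mulrA ler_wpM2l//; first by rewrite divr_ge0// exprn_ge0// ltW.
rewrite -powR_mulrn ?powR_ge0// -powRrM -powRN ler_powR ?ler1n//.
by rewrite lerNl mulrC -ler_pdivrMr.
Unshelve. all: by end_near. Qed.

Lemma Ogrow_ln p : 0 < p -> Ogrow (fun d => ln d%:R) p.
Proof.
move=> p0; exists p^-1; first by rewrite invr_ge0 ltW.
near=> d; have d0 : 0 < d%:R :> R by rewrite ltr0n; near: d; exact: near_gt0.
rewrite -ler_pdivrMl ?invr_gt0// invrK -ln_powR ltW// ln_sublinear//.
by rewrite powR_gt0.
Unshelve. all: by end_near. Qed.

Lemma asymp_leP a b : asymp_le a b -> (\forall d \near \oo, 0 < b d) ->
  exists2 C : R, 0 <= C & \forall d \near \oo, a d <= C * b d.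
Proof.
rewrite /asymp_le /limn_esup /limf_esup => /ereal_inf_lt[_ [V ooV <-] supV] b0.
set M := ereal_sup _ in supV.
have [C C0 MC] : exists2 C : R, 0 <= C & (M <= C%:E)%E.
  move: supV; case: M => [x _|//|_]; last by exists 0 => //; rewrite leNye.
  by exists (Num.max x 0); rewrite ?lee_fin le_max lexx ?orbT.
exists C => //; near=> d.
have bd : 0 < b d by near: d.
have Vd : V d by near: d.
have : ((a d)%:E / (b d)%:E <= C%:E)%E.
  by apply: le_trans MC; apply: ereal_sup_ubound; exists d.
by rewrite inver gt_eqF// -EFinM lee_fin ler_pdivrMr.
Unshelve. all: by end_near. Qed.

Lemma Ogrow_asymp a p : asymp_le a (fun d => d%:R `^ p) -> Ogrow a p.
Proof.
move=> /asymp_leP[|C C0 aC]; last by exists C.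
near=> d; rewrite powR_gt0// ltr0n; near: d; exact: near_gt0.
Unshelve. all: by end_near. Qed.

Lemma limn_esup_le_near (u : nat -> \bar R) (c : R) :
  (forall e, 0 < e -> \forall d \near \oo, (u d <= (c + e)%:E)%E) ->
  (limn_esup u <= c%:E)%E.
Proof.
move=> uc; apply/lee_addgt0Pr => e e0.
apply: ereal_inf_le; exists (ereal_sup (u @` [set d | (u d <= (c + e)%:E)%E])).
  by exists [set d | (u d <= (c + e)%:E)%E] => //; exact: uc.
by apply: ge_ereal_sup => _ [d ud <-].
Qed.

End growth.

Section asymptotics.
Variables (R : realType) (k : nat) (lambda : nat -> R).
Variables (gamma eta tau mu : R) (N T s : nat -> nat).
Hypothesis k0 : (0 < k)%N.
Hypothesis lam_gt0 : forall d, 0 < lambda d.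
Hypothesis gammak : 3 * k%:R / 2 < gamma.
Hypothesis lamO : asymp_eq (fun d => lambda d ^+ 2) (fun d => d%:R `^ (- gamma)).
Hypothesis eta1 : 1 <= eta.
Hypothesis tau0 : 0 <= tau.
Hypothesis mu0 : 0 <= mu.
Hypothesis NO : asymp_le (fun d => (N d)%:R * lambda d ^+ 2) (fun d => d%:R `^ eta).
Hypothesis TO : asymp_le (fun d => (T d)%:R : R) (fun d => d%:R `^ tau).
Hypothesis sO : asymp_le (fun d => (s d)%:R : R) (fun d => d%:R `^ mu).
Hypothesis sumk : eta + tau + mu < k%:R.

Local Notation Lk := (lambda_k R k).
Let lam d := lambda d / Lk.
(* The margin in gamma > 3 k / 2 is shared among the slowly growing factors. *)
Let e : R := (gamma - 3 * k%:R / 2) / 8.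
Let B d : R := d%:R `^ e.
(* The block size 2 ^ r is the power of two next to d^{3k/2}. *)
Let r d := up_log 4 (d ^ (3 * k)).
Let n d : R := (sz (r d))%:R.
Let m' d := (N d %/ sz (r d))%N.

Let e_gt0 : 0 < e. Proof. by rewrite divr_gt0// subr_gt0. Qed.
Let gamma0 : 0 < gamma.
Proof. by apply: le_lt_trans gammak; rewrite !mulr_ge0. Qed.

Let n_sqr d : n d ^+ 2 = (4 ^ r d)%:R.
Proof. by rewrite /n szE -natrX -expnM mulnC expnM. Qed.

Lemma near_gt1 : \forall d \near \oo, (1 < d)%N.
Proof. by exists 2%N. Qed.

Let d3k_gt1 d : (1 < d)%N -> (1 < d ^ (3 * k))%N.
Proof. by move=> d1; rewrite -[X in (X < _)%N](exp1n (3 * k)) ltn_exp2r// muln_gt0. Qed.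

Let nO : Ogrow n (3 * k%:R / 2).
Proof.
apply: (@le_Ogrow _ _ (fun d => Num.sqrt (4 * d%:R `^ (3 * k%:R)))).
  near=> d; have d1 : (1 < d)%N by near: d; exact: near_gt1.
  rewrite -[leLHS]ger0_norm// -sqrtr_sqr ler_wsqrtr// n_sqr.
  rewrite -natrM powR_mulrn// -natrX -natrM ler_nat.
  have r0 : (0 < r d)%N by rewrite up_log_gt0 d3k_gt1.
  by rewrite -(prednK r0) expnS leq_mul2l/= ltnW// up_log_gtn// d3k_gt1.
by apply: Ogrow_sqrt; apply: OgrowMl => //; exact: Ogrow_powR.
Unshelve. all: by end_near. Qed.

Let rO : Ogrow (fun d => (r d)%:R : R) e.
Proof.
have ln4 : 1 <= ln 4 :> R.
  have ln2 : ln (1 + - 2^-1) <= - 2^-1 :> R by apply: le_ln1Dx; lra.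
  have half : 1 + - 2^-1 = 2^-1 :> R by field.
  move: ln2; rewrite half lnV ?posrE// => ln2.
  have -> : 4 = 2 ^+ 2 :> R by ring.
  by rewrite lnXn// mulr2n; lra.
apply: (@le_Ogrow _ _ (fun d => 1 + (3 * k)%:R * ln d%:R)).
  near=> d; have d1 : (1 < d)%N by near: d; exact: near_gt1.
  have r0 : (0 < r d)%N by rewrite up_log_gt0 d3k_gt1.
  rewrite -(prednK r0) -natr1 addrC lerD2l.
  rewrite mulr_natl -lnXn ?ltr0n ?(ltn_trans _ d1)// -natrX.
  apply: (@le_trans _ _ (ln (4 ^+ (r d).-1))).
    by rewrite lnXn// -[leRHS]mulr_natl ler_peMr.
  rewrite ler_ln ?posrE ?exprn_gt0// ?ltr0n ?expn_gt0 ?(ltn_trans _ d1)//.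
  by rewrite -natrX ler_nat ltnW// up_log_gtn// d3k_gt1.
apply: OgrowD; first by apply: Ogrow_weak (Ogrow_cst _); exact: ltW.
by apply: OgrowMl => //; exact: Ogrow_ln.
Unshelve. all: by end_near. Qed.

Let lam_ge0 d : 0 <= lam d.
Proof. by rewrite divr_ge0// ltW// lambda_k_gt0. Qed.

Let lam2O : Ogrow (fun d => lam d ^+ 2) (- gamma).
Proof.
apply: (@le_Ogrow _ _ (fun d => (Lk ^+ 2)^-1 * lambda d ^+ 2)).
  by near=> d; rewrite /lam expr_div_n mulrC.
by apply: OgrowMl; [rewrite invr_ge0 sqr_ge0 | apply: Ogrow_asymp; exact: lamO.1].
Unshelve. all: by end_near. Qed.

Let lam1O : Ogrow lam (- gamma / 2).
Proof.
apply: le_Ogrow (Ogrow_sqrt lam2O); near=> d.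
by rewrite sqrtr_sqr ger0_norm.
Unshelve. all: by end_near. Qed.

Let kappaO : Ogrow (fun d => lam d ^+ 2 * n d) (- gamma + 3 * k%:R / 2).
Proof. by apply: OgrowM => // d; exact: sqr_ge0. Qed.

Let near_zeta : \forall d \near \oo, 2 * (r d)%:R * zeta (lam d) (B d) (r d) <= 1.
Proof.
apply: (@Ogrow_small _ _ (e + (- gamma / 2 + (e + 3 * k%:R / 2 / 2)))) => //.
  by rewrite /e; have := gammak; lra.
apply: (@le_Ogrow _ _ (fun d => 8 * ((r d)%:R * (lam d * (B d * Num.sqrt (n d)))))).
  by near=> d; rewrite /zeta /n le_eqVlt; apply/orP; left; apply/eqP; ring.
have B0 d : 0 <= B d by exact: powR_ge0.
apply: OgrowMl => //; apply: OgrowM => //.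
  by move=> d; rewrite (mulr_ge0 (lam_ge0 d)) ?(mulr_ge0 (B0 d)) ?sqrtr_ge0.
apply: OgrowM => //; first by move=> d; rewrite (mulr_ge0 (B0 d)) ?sqrtr_ge0.
apply: OgrowM => //; [exact: Ogrow_powR|exact: Ogrow_sqrt].
Unshelve. all: by end_near. Qed.

Let near_lam : \forall d \near \oo, lam d <= 1 / 2.
Proof.
apply: (Ogrow_small _ _ lam1O); last by lra.
by have := gamma0; lra.
Qed.

Let mO : Ogrow (fun d => (m' d).+1%:R : R) (eta + gamma).
Proof.
have [C C0 lamC] := asymp_leP lamO.2 (nearW _ (fun d => exprn_gt0 2 (lam_gt0 d))).
have invO : Ogrow (fun d => (lambda d ^+ 2)^-1) gamma.
  exists C => //; near=> d; have d0 : (0 < d)%N by near: d; exact: near_gt0.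
  have : d%:R `^ (- gamma) <= C * lambda d ^+ 2 by near: d.
  have l2 : 0 < lambda d ^+ 2 by rewrite exprn_gt0.
  rewrite powRN -ler_pdivrMr// mulrC -ler_pdivlMr ?invr_gt0 ?powR_gt0 ?ltr0n//.
  by rewrite invrK.
have N_O : Ogrow (fun d => (N d)%:R : R) (eta + gamma).
  apply: (@le_Ogrow _ _ (fun d => ((N d)%:R * lambda d ^+ 2) * (lambda d ^+ 2)^-1)).
    by near=> d; rewrite mulfK// gt_eqF// exprn_gt0.
  apply: OgrowM => //; first by move=> d; rewrite mulr_ge0 ?sqr_ge0.
    by move=> d; rewrite invr_ge0 sqr_ge0.
  exact: Ogrow_asymp.
apply: (@le_Ogrow _ _ (fun d => (N d)%:R + 1)).
  by near=> d; rewrite -natr1 lerD2r ler_nat leq_div.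
apply: OgrowD => //; apply: Ogrow_weak (Ogrow_cst _).
by have := gamma0; have := eta1; lra.
Unshelve. all: by end_near. Qed.

Let samplesO : Ogrow (fun d => (m' d).+1%:R * n d * lam d ^+ 2) eta.
Proof.
apply: (@le_Ogrow _ _ (fun d => (Lk ^+ 2)^-1 * ((N d)%:R * lambda d ^+ 2) + lam d ^+ 2 * n d)).
  near=> d.
  have : (m' d).+1%:R * n d <= (N d)%:R + n d.
    by rewrite /n -natrM -natrD ler_nat mulSn addnC leq_add2r leq_divM.
  move=> /(ler_wpM2r (sqr_ge0 (lam d))) /le_trans; apply.
  by rewrite mulrDl [n d * _]mulrC lerD2r /lam expr_div_n mulrA mulrC.
apply: OgrowD.
  apply: OgrowMl; first by rewrite invr_ge0 sqr_ge0.
  exact: Ogrow_asymp.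
by apply: Ogrow_weak kappaO; have := gammak; have := eta1; lra.
Unshelve. all: by end_near. Qed.

Let bitsO : Ogrow (fun d => ln (#|{: (s d).-tuple bool}| ^ T d)%:R + 1 : R) (mu + tau).
Proof.
apply: (@le_Ogrow _ _ (fun d => (s d)%:R * (T d)%:R + 1)).
  near=> d; rewrite lerD2r card_tuple card_bool -expnM natrX lnXn//.
  rewrite -[leLHS]mulr_natl natrM ler_piMr ?mulr_ge0//.
  have := @le_ln1Dx R 1; rewrite -[1 + 1]/(2 : R); apply; lra.
apply: OgrowD.
  by apply: OgrowM => //; exact: Ogrow_asymp.
by apply: Ogrow_weak (Ogrow_cst _); rewrite addr_ge0.
Unshelve. all: by end_near. Qed.

Let info d := info_bound (multi_index k d) (lam d) (B d) (r d) (m' d) (T d) ((s d).-tuple bool : finType).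

Let invDO : Ogrow (fun d => (#|{: multi_index k d}|%:R)^-1 : R) (- k%:R).
Proof.
apply: (@le_Ogrow _ _ (fun d => d%:R `^ (- k%:R))); last exact: Ogrow_powR.
by near=> d; rewrite card_index powRN powR_mulrn// natrX.
Unshelve. all: by end_near. Qed.

Let DO : Ogrow (fun d => (#|{: multi_index k d}|%:R) : R) k%:R.
Proof.
apply: (@le_Ogrow _ _ (fun d => d%:R `^ k%:R)); last exact: Ogrow_powR.
by near=> d; rewrite card_index powR_mulrn// natrX.
Unshelve. all: by end_near. Qed.

Let ln_bits_ge0 d : 0 <= ln (#|{: (s d).-tuple bool}| ^ T d)%:R + 1 :> R.
Proof.
rewrite addr_ge0// ln_ge0// ler1n expn_gt0; apply/orP; left.
by rewrite card_tuple card_bool expn_gt0.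
Qed.

Let main_part : Ogrow (fun d => (m' d).+1%:R * n d * lam d ^+ 2 *
   (240 * (ln (#|{: (s d).-tuple bool}| ^ T d)%:R + 1) * (#|{: multi_index k d}|%:R)^-1))
   (eta + (mu + tau + - k%:R)).
Proof.
have gen c (b iD : nat -> R) : 0 <= c -> (forall d, 0 <= b d) -> (forall d, 0 <= iD d) ->
    Ogrow b (mu + tau) -> Ogrow iD (- k%:R) ->
    Ogrow (fun d => (m' d).+1%:R * n d * lam d ^+ 2 * (c * b d * iD d))
      (eta + (mu + tau + - k%:R)).
  move=> c0 b0 iD0 bO iDO; apply: OgrowM samplesO _ => [d|d|].
  - by apply: mulr_ge0 (sqr_ge0 _); apply: mulr_ge0; exact: ler0n.
  - by rewrite !mulr_ge0.
  - by apply: OgrowM iDO => // [d|]; [rewrite mulr_ge0|exact: OgrowMl].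
apply: gen (ler0n _ _) ln_bits_ge0 _ bitsO invDO => d; rewrite invr_ge0; exact: ler0n.
Qed.

(* A walk exceeds d^e standard deviations with stretched-exponentially
   small probability, so that any power q of d can be claimed for it; q is the
   one for which the exponents add up to -1. *)
Let atyp_part : Ogrow (fun d => (m' d).+1%:R * ((#|{: multi_index k d}|%:R)^-1 *
   atyp (multi_index k d) (lam d) (B d) (r d))) (-1).
Proof.
pose q : R := - 2 * (eta + gamma + 1) - 5 * k%:R / 2.
apply: (@Ogrow_weak _ _ (eta + gamma + (0 + (3 * k%:R / 2 + (k%:R + q))) / 2)).
  by rewrite /q; lra.
apply: OgrowM => // [d|].
  by rewrite /atyp !mulr_ge0 ?invr_ge0 ?sqrtr_ge0.
apply: (@le_Ogrow _ _ (fun d => 2 * Num.sqrt ((1 + expR 7) * (n d *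
   (#|{: multi_index k d}|%:R * (2 * expR (- (1 / 5 * d%:R `^ (2 * e))))))))).
  near=> d; have d0 : (0 < d)%N by near: d; exact: near_gt0.
  have D0 : #|{: multi_index k d}|%:R != 0 :> R by rewrite card_index pnatr_eq0 -lt0n expn_gt0 d0.
  rewrite /atyp [2 * _]mulrC -[_ * 2 * _]mulrA mulKf// ler_wpM2l// ler_wsqrtr//.
  have -> : B d ^+ 2 / 5 = 1 / 5 * d%:R `^ (2 * e).
    by rewrite /B mulrC powRrM powRAC powR_mulrn ?powR_ge0//; field.
  rewrite ler_wpM2r//.
  rewrite lerD2l ler_expR -mulrA ler_piMr//.
  near: d; apply: (Ogrow_small _ _ kappaO); last by [].
  by have := gammak; lra.
apply: OgrowMl => //; apply: Ogrow_sqrt.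
have e70 : 0 <= 1 + expR 7 :> R by rewrite addr_ge0 ?expR_ge0.
apply: OgrowM (Ogrow_cst _) _ => [//|d|].
  by rewrite !mulr_ge0 ?expR_ge0.
apply: OgrowM nO _ => [d|d|]; [exact: ler0n|by rewrite !mulr_ge0 ?expR_ge0|].
apply: OgrowM DO _ => [d|d|]; [exact: ler0n|by rewrite mulr_ge0 ?expR_ge0|].
apply: OgrowMl => //; apply: Ogrow_expR; first by lra.
by rewrite mulr_gt0.
Unshelve. all: by end_near. Qed.

Let p : R := Num.max (eta + (mu + tau + - k%:R)) (-1).

Let p_lt0 : p < 0.
Proof. by rewrite gt_max ltrN10 andbT; have := sumk; lra. Qed.

Let infoO : Ogrow info p.
Proof.
apply: (@le_Ogrow _ _ (fun d => (m' d).+1%:R * n d * lam d ^+ 2 *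
   (240 * (ln (#|{: (s d).-tuple bool}| ^ T d)%:R + 1) * (#|{: multi_index k d}|%:R)^-1) +
   (m' d).+1%:R * ((#|{: multi_index k d}|%:R)^-1 * atyp (multi_index k d) (lam d) (B d) (r d)))).
  near=> d; rewrite /info /info_bound le_eqVlt; apply/orP; left; apply/eqP.
  by rewrite /n; ring.
apply: OgrowD.
  by apply: Ogrow_weak main_part; rewrite le_max lexx.
by apply: Ogrow_weak atyp_part; rewrite le_max lexx orbT.
Unshelve. all: by end_near. Qed.

Variable V_hat : forall d : nat, mem_alg (sample R k d) (tensor R k d) (N d) (T d) (s d).
Variable t : R.
Hypothesis t0 : t != 0.

(** [worst_case_bound] with blocks of about d^{3k/2} samples: its conditions
    and the smallness of its error all hold for large d, because the exponents
    in d are negative. *)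
Lemma hard_instance (eps : R) : 0 < eps -> \forall d \near \oo,
  exists (V : tensor R k d) (m : probability (sample R k d) R),
  [/\ basis_param V, sign_law (lambda d) V m, kcca_law (lambda d) V m &
    (success_prob (V_hat d) t V m <= ((t ^+ 2)^-1 + eps)%:E)%E].
Proof.
move=> eps0.
have errO : Ogrow (fun d => 6 * info d + Num.sqrt (info d)) (p / 2).
  apply: OgrowD; last exact: Ogrow_sqrt.
  by apply: OgrowMl => //; apply: Ogrow_weak infoO; have := p_lt0; lra.
near=> d; have d0 : (0 < d)%N by near: d; exact: near_gt0.
have l12 : lam d <= 1 / 2 by near: d.
have lL : lambda d <= Lk.
  have := l12; rewrite /lam ler_pdivrMr ?lambda_k_gt0// => /le_trans; apply.
  by rewrite ler_piMl ?ltW ?lambda_k_gt0//; lra.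
have B1 : 1 <= B d by near: d; exact: near_powR_ge.
have zr : 2 * (r d)%:R * zeta (lam d) (B d) (r d) <= 1 by near: d.
have sz0 : (0 < sz (r d))%N by rewrite szE expn_gt0.
have Nmn : (N d <= (m' d).+1 * sz (r d))%N.
  by rewrite ltnW// ltn_ceil.
have D3 : ((d ^ k) ^ 3 <= sz (r d) ^ 2)%N.
  by rewrite szE -!expnM [(k * 3)%N]mulnC [(r d * 2)%N]mulnC [(2 ^ _)%N]expnM up_logP.
have D1 : (d ^ k <= sz (r d))%N.
  rewrite -(@leq_exp2r _ _ 2)//; apply: leq_trans D3.
  by rewrite leq_pexp2l// expn_gt0 d0.
have lam0' : 0 <= lambda d by exact: ltW.
have [V [m [mm mle]]] := worst_case_bound (V_hat d) k0 d0 t0 lam0' lL l12 B1 zr Nmn D3 D1.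
exists (basis_tensor R V), m; split.
- exact: basis_tensor_basis.
- exact: sign_law_mixture.
- exact: kcca_law_mixture.
apply: le_trans mle _; rewrite lee_fin lerD2l /risk_error.
by near: d; apply: (Ogrow_small _ eps0 errO); have := p_lt0; lra.
Unshelve. all: by end_near. Qed.

End asymptotics.

Theorem theorem4 (R : realType) (k : nat) (lambda : nat -> R)
    (gamma eta tau mu : R) (N T s : nat -> nat)
    (V_hat : forall d : nat,
       mem_alg (sample R k d) (tensor R k d) (N d) (T d) (s d)) (t : R) :
  (2 <= k)%N ->
  (forall d, 0 < lambda d) ->
  3 * k%:R / 2 < gamma ->
  asymp_eq (fun d => lambda d ^+ 2) (fun d => d%:R `^ (- gamma)) ->
  1 <= eta -> 0 <= tau -> 0 <= mu ->
  asymp_eq (fun d => (N d)%:R * lambda d ^+ 2) (fun d => d%:R `^ eta) ->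
  asymp_eq (fun d => (T d)%:R) (fun d => d%:R `^ tau) ->
  asymp_eq (fun d => (s d)%:R) (fun d => d%:R `^ mu) ->
  eta + tau + mu < k%:R ->
  [/\ (limn_esup (fun d => worst_case_success (V_hat d) t
          (@kcca_param R k d) (@kcca_law R k d (lambda d)))
        <= ((t ^+ 2)%:E)^-1)%E,
      (limn_esup (fun d => worst_case_success (V_hat d) t
          (@kcca_param R k d) (@sign_law R k d (lambda d)))
        <= ((t ^+ 2)%:E)^-1)%E &
      (limn_esup (fun d => worst_case_success (V_hat d) t
          (@basis_param R k d) (@sign_law R k d (lambda d)))
        <= ((t ^+ 2)%:E)^-1)%E].
Proof.
move=> k2 lam_gt0 gammak lamO eta1 tau0 mu0 [NO _] [TO _] [sO _] sumk.
have [->|t0] := eqVneq t 0.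
  by rewrite expr0n inve0; split; exact: leey.
have k0 : (0 < k)%N by exact: ltn_trans k2.
have hard := hard_instance k0 lam_gt0 gammak lamO eta1 tau0 mu0 NO TO sO sumk V_hat t0.
rewrite inver expf_eq0 (negbTE t0) andbF.
split; apply: limn_esup_le_near => eps eps0; apply: filterS (hard eps eps0) => d
  [V [m [Vb Vs Vk le_eps]]]; apply: le_trans le_eps; apply: ereal_inf_lbound;
  exists V, m; split => //; exact: basis_kcca.
Qed.
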